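(* Given a smooth family of algebras with involution $(\mathcal A,\sigma)\to\Delta$ and a smooth nondegenerate diagonal section $\mathcal J\colon\Delta\to\mathcal H\mathrm{erm}(n;\mathcal A,\sigma)$, there is a corresponding smooth family of unitary geometries; that is, the pair $(\mathcal U(\mathcal J;\mathcal A),\mathcal{USt}(\mathcal J;\mathcal A))$ is a smooth family of geometries over $\Delta$.
   Context: A smooth family of algebras over a smooth manifold $\Delta$ is a (finite rank) real vector bundle $\mathcal A\to\Delta$ with a smooth fiberwise-bilinear multiplication and smooth unit section making each fiber $\mathcal A_\delta$ a finite-dimensional associative unital real algebra. An involution $\sigma\colon\mathcal A\to\mathcal A$ is a smooth map over $\Delta$ with $\sigma^2=\mathrm{id}$ restricting on each fiber to a unital $\mathbb R$-linear map with $\sigma(ab)=\sigma(b)\sigma(a)$ (an algebra automorphism when the algebra is commutative; $\sigma=\mathrm{id}$ is allowed in that case). For a matrix $X$ over $\mathcal A_\delta$ let $X^\dagger=\sigma(X)^T$ ($\sigma$ applied entrywise). $\mathcal H\mathrm{erm}(n;\mathcal A,\sigma)=\bigcup_\delta\{X\in\mathrm M(n;\mathcal A_\delta):X^\dagger=X\}$. A section $\mathcal J$ is nondegenerate if each $\mathcal J_\delta$ is invertible, and diagonal if each $\mathcal J_\delta$ is a diagonal matrix. $\mathcal U(\mathcal J;\mathcal A)=\bigcup_\delta\{X\in\mathrm{GL}(n;\mathcal A_\delta):X^\dagger\mathcal J_\delta X=\mathcal J_\delta\}$. $\mathcal{St}(n;\mathcal A)=\bigcup_\delta\left\{\left(\begin{smallmatrix}X&\vec0\\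 \vec v&\alpha\end{smallmatrix}\right): X\in\mathrm{GL}(n-1;\mathcal A_\delta),\ \vec v\in\mathcal A_\delta^{n-1},\ \alpha\in\mathcal A_\delta^\times\right\}$ (projective stabilizers of $(0,\dots,0,1)$), and $\mathcal{USt}(\mathcal J;\mathcal A)=\mathcal U(\mathcal J;\mathcal A)\cap\mathcal{St}(n;\mathcal A)$. The unitary geometry over $\mathcal A_\delta$ associated to $\mathcal J_\delta$ is the homogeneous geometry with automorphism group and point stabilizer the fibers of these over $\delta$. A smooth family over $\Delta$ is a smooth manifold with a smooth submersion to $\Delta$; a subfamily is a closed submanifold on which the projection is still a submersion; a family of groups is a smooth family with smooth identity section and smooth fiberwise multiplication and inversion making each fiber a Lie group. A smooth family of geometries over $\Delta$ is a pair $(\mathcal G,\mathcal C)$ of a family of groups $\mathcal G\to\Delta$ and a closed subfamily of subgroups $\mathcal C\le\mathcal G$. *)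

(* Defs.v *)
From HB Require Import structures.
Set Warnings "-notation-overridden,-notation-incompatible-prefix,-ambiguous-paths".
From mathcomp Require Import all_boot all_order all_algebra.
From mathcomp Require Import all_classical all_reals all_analysis.

Import Order.TTheory GRing.Theory Num.Theory.
Import numFieldNormedType.Exports.

Local Open Scope classical_set_scope.
Local Open Scope ring_scope.

(* * Smooth maps between open subsets of normed spaces *)

Section SmoothFunctions.
Context {R : realType} {V W : normedModType R}.

(* Of interest for O open, in which case only the values of f on O matter. *)
Fixpoint C_on (k : nat) (O : set V) (f : V -> W) : Prop :=
  match k with
  | 0%N => forall x, O x -> {for x, continuous f}
  | k'.+1 => (forall x, O x -> differentiable f x) /\
             (forall v, C_on k' O (fun x => 'D_v f x))
  end.

Definition smooth_on (O : set V) (f : V -> W) : Prop := forall k, C_on k O f.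

End SmoothFunctions.

(* * Smooth manifolds

   The topology of a manifold is not given beforehand: it is the one
   determined by the atlas (see [atlas_open]).  A manifold is modelled on a
   subset of an ambient type T, the union of its chart domains, so that
   submanifolds need no subtypes.  Distinct charts may have distinct
   dimensions, i.e. the dimension of a manifold is only locally constant. *)

(* [cfun] and [cinv] only matter on [cdom] and on its image respectively. *)
Record chart (R : realType) (T : Type) : Type := Chart {
  cdim : nat;
  cdom : set T;
  cfun : T -> 'rV[R]_cdim;
  cinv : 'rV[R]_cdim -> T }.
Arguments Chart {R T cdim} _ _ _.
Arguments cdim {R T} _.
Arguments cdom {R T} _ _.
Arguments cfun {R T} _ _.
Arguments cinv {R T} _ _.

Definition atlas (R : realType) (T : Type) : Type := set (chart R T).

Section Manifolds.
Context {R : realType} {T : Type}.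
Implicit Types (c : chart R T) (A : atlas R T) (S : set T).

Definition chart_valid c : Prop :=
  open (cfun c @` cdom c) /\ (forall x, cdom c x -> cinv c (cfun c x) = x).

Definition compatible c1 c2 : Prop :=
  let O := cfun c1 @` (cdom c1 `&` cdom c2) in
  open O /\ smooth_on O (cfun c2 \o cinv c1).

Definition pts A : set T := \bigcup_(c in A) cdom c.

Definition atlas_open A (W : set T) : Prop :=
  W `<=` pts A /\ forall c, A c -> open (cfun c @` (W `&` cdom c)).

Definition atlas_hausdorff A : Prop :=
  forall x y, pts A x -> pts A y -> x <> y ->
  exists W1 W2, [/\ atlas_open A W1, atlas_open A W2, W1 x, W2 y &
                    W1 `&` W2 = set0].

Definition atlas_second_countable A : Prop :=
  exists2 B : set (set T), countable B &
    (forall W, B W -> atlas_open A W) /\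
    (forall W x, atlas_open A W -> W x ->
       exists2 W', B W' & W' x /\ W' `<=` W).

(* A is a smooth atlas making the set S a smooth manifold. *)
Definition smooth_manifold S A : Prop :=
  [/\ pts A = S,
      forall c, A c -> chart_valid c,
      forall c1 c2, A c1 -> A c2 -> compatible c1 c2,
      atlas_hausdorff A &
      atlas_second_countable A].

Definition max_atlas A : atlas R T :=
  [set c | [/\ chart_valid c, cdom c `<=` pts A &
               forall c', A c' -> compatible c c' /\ compatible c' c]].

(* The atlas induced on S by the slice charts for S, i.e. the charts of the
   maximal atlas in which S is cut out by the vanishing of the last l
   coordinates; the first k coordinates are then a chart of S.  These charts
   cover S exactly when S is an (embedded) submanifold. *)
Definition sub_atlas A S : atlas R T :=
  [set c | exists k l (U : set T) (f : T -> 'rV[R]_(k + l))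
                  (g : 'rV[R]_(k + l) -> T),
     [/\ max_atlas A (Chart U f g),
         forall x, U x -> (S x <-> rsubmx (f x) = 0) &
         c = Chart (U `&` S) (fun x => lsubmx (f x))
                   (fun u => g (row_mx u 0))]].

Definition submanifold A S : Prop := S `<=` pts A /\ S `<=` pts (sub_atlas A S).

Definition closed_submanifold A S : Prop :=
  submanifold A S /\ atlas_open A (pts A `\` S).

End Manifolds.

Definition prod_chart {R : realType} {T1 T2 : Type}
    (c1 : chart R T1) (c2 : chart R T2) : chart R (T1 * T2)%type :=
  Chart (cdom c1 `*` cdom c2)
        (fun p => row_mx (cfun c1 p.1) (cfun c2 p.2))
        (fun w => (cinv c1 (lsubmx w), cinv c2 (rsubmx w))).

Definition prod_atlas {R : realType} {T1 T2 : Type}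
    (A1 : atlas R T1) (A2 : atlas R T2) : atlas R (T1 * T2)%type :=
  [set c | exists c1 c2, [/\ A1 c1, A2 c2 & c = prod_chart c1 c2]].

Section SmoothMaps.
Context {R : realType} {T1 T2 : Type}.
Implicit Types (S : set T1) (f : T1 -> T2).

Definition in_charts (c1 : chart R T1) (c2 : chart R T2) f :
    'rV[R]_(cdim c1) -> 'rV[R]_(cdim c2) :=
  cfun c2 \o f \o cinv c1.

(* S is the manifold with atlas A1; f is only relevant on S. *)
Definition smooth_map S (A1 : atlas R T1) (A2 : atlas R T2) f : Prop :=
  forall x, S x -> exists c1 c2 (O : set 'rV[R]_(cdim c1)),
    [/\ A1 c1 /\ cdom c1 x,
        A2 c2 /\ cdom c2 (f x),
        [/\ open O, O (cfun c1 x) & O `<=` cfun c1 @` cdom c1],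
        (forall u, O u -> cdom c2 (f (cinv c1 u))) &
        smooth_on O (in_charts c1 c2 f)].

Definition submersion S (A1 : atlas R T1) (A2 : atlas R T2) f : Prop :=
  smooth_map S A1 A2 f /\
  forall x, S x -> exists c1 c2,
    [/\ A1 c1 /\ cdom c1 x, A2 c2 /\ cdom c2 (f x) &
        forall w, exists v, 'd (in_charts c1 c2 f) (cfun c1 x) v = w].

End SmoothMaps.

(* * Lie groups and families *)

Section Families.
Context {R : realType}.

Definition group_on {T : Type} (S : set T)
    (one : T) (mul : T -> T -> T) (inv : T -> T) : Prop :=
  [/\ S one /\ (forall x y, S x -> S y -> S (mul x y)),
      forall x, S x -> S (inv x),
      forall x y z, S x -> S y -> S z -> mul x (mul y z) = mul (mul x y) z,
      forall x, S x -> mul one x = x /\ mul x one = x &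
      forall x, S x -> mul (inv x) x = one /\ mul x (inv x) = one].

Definition lie_group {T : Type} (S : set T) (A : atlas R T)
    (one : T) (mul : T -> T -> T) (inv : T -> T) : Prop :=
  [/\ smooth_manifold S A, group_on S one mul inv,
      smooth_map (S `*` S) (prod_atlas A A) A (fun p => mul p.1 p.2) &
      smooth_map S A A inv].

Context {B : Type} (D : atlas R B) {T : Type} (pi : T -> B).

Definition smooth_family (G : set T) (A : atlas R T) : Prop :=
  smooth_manifold G A /\ submersion G A D pi.

Definition closed_subfamily (A : atlas R T) (S : set T) : Prop :=
  closed_submanifold A S /\ submersion S (sub_atlas A S) D pi.

Definition fiber (G : set T) (d : B) : set T := [set x | G x /\ pi x = d].

Definition fiber_square (G : set T) : set (T * T) :=
  [set p | [/\ G p.1, G p.2 & pi p.1 = pi p.2]].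

Definition fiber_square_atlas (G : set T) (A : atlas R T) : atlas R (T * T)%type :=
  sub_atlas (prod_atlas A A) (fiber_square G).

(* mul is only relevant on pairs of points of G in the same fiber. *)
Definition family_of_groups (G : set T) (A : atlas R T)
    (one : B -> T) (mul : T -> T -> T) (inv : T -> T) : Prop :=
  [/\ smooth_family G A,
      smooth_map (pts D) D A one,
      smooth_map (fiber_square G) (fiber_square_atlas G A) A
        (fun p => mul p.1 p.2),
      smooth_map G A A inv &
      forall d, pts D d ->
        lie_group (fiber G d) (sub_atlas A (fiber G d)) (one d) mul inv].

Definition family_of_geometries (G : set T) (A : atlas R T)
    (one : B -> T) (mul : T -> T -> T) (inv : T -> T) (C : set T) : Prop :=
  [/\ family_of_groups G A one mul inv,
      C `<=` G,
      closed_subfamily A C &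
      forall d, pts D d -> group_on (fiber C d) (one d) mul inv].

End Families.

(* * Vector bundles, given by their fibers and local trivializations *)

(* [tfun] and [tinv] only matter over [tdom]. *)
Record trivialization (R : realType) (B : Type) (F : B -> Type) : Type :=
  Trivialization {
    trank : nat;
    tdom : set B;
    tfun : forall d, F d -> 'rV[R]_trank;
    tinv : forall d, 'rV[R]_trank -> F d }.
Arguments trivialization R {B} F.
Arguments Trivialization {R B F trank} _ _ _.
Arguments trank {R B F} _.
Arguments tdom {R B F} _ _.
Arguments tfun {R B F} _ d _.
Arguments tinv {R B F} _ d _.

Definition total_chart {R : realType} {B : Type} {F : B -> Type}
    (c : chart R B) (t : trivialization R F) : chart R {d : B & F d} :=
  Chart [set u | cdom c (tag u) /\ tdom t (tag u)]
        (fun u => row_mx (cfun c (tag u)) (tfun t (tag u) (tagged u)))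
        (fun w => let d := cinv c (lsubmx w) in
                  Tagged F (tinv t d (rsubmx w))).

Definition total_atlas {R : realType} {B : Type} {F : B -> Type}
    (D : atlas R B) (Phi : set (trivialization R F)) : atlas R {d : B & F d} :=
  [set c | exists c0 t, [/\ D c0, Phi t & c = total_chart c0 t]].

(* Compatibility of the charts of the total space says that the changes of
   trivialization are smooth. *)
Definition vector_bundle {R : realType} {B : Type} (D : atlas R B)
    (F : B -> lmodType R) (Phi : set (trivialization R (fun d => F d))) : Prop :=
  (forall t, Phi t -> atlas_open D (tdom t) /\
     forall d, tdom t d ->
       [/\ linear (tfun t d),
           cancel (tfun t d) (tinv t d) &
           cancel (tinv t d) (tfun t d)]) /\
  smooth_manifold [set: {d : B & F d}] (total_atlas D Phi).

(* The fiberwise operations act on total spaces; [fiberwise2] is meaningful on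
   pairs of points in the same fiber. *)
Definition fiberwise1 {B : Type} {F F' : B -> Type}
    (op : forall d, F d -> F' d) (u : {d : B & F d}) : {d : B & F' d} :=
  Tagged F' (op (tag u) (tagged u)).

Definition fiberwise2 {B : choiceType} {F : B -> Type}
    (op : forall d, F d -> F d -> F d) (u v : {d : B & F d}) : {d : B & F d} :=
  Tagged F (op (tag u) (tagged u) (tagged_as u v)).

Definition section {B : Type} {F : B -> Type} (s : forall d, F d) (d : B) :
    {d : B & F d} := Tagged F (s d).

(* * Families of algebras with involution *)

Section AlgebraFamilies.
Context {R : realType} {B : choiceType} (D : atlas R B).
Context {A : B -> algType R} (Phi : set (trivialization R (fun d => A d))).

Let total : Type := {d : B & A d}.
Let E : atlas R total := total_atlas D Phi.

(* Finite dimensionality of the fibers is part of [vector_bundle],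
   bilinearity of the multiplication is part of [algType]. *)
Definition smooth_family_of_algebras : Prop :=
  [/\ vector_bundle D (fun d => A d : lmodType R) Phi,
      smooth_map (fiber_square tag [set: total])
        (fiber_square_atlas tag [set: total] E) E
        (fun p => fiberwise2 (fun d (a b : A d) => a * b) p.1 p.2) &
      smooth_map [set: B] D E (section (fun d => 1 : A d))].

Definition smooth_involution (sigma : forall d, A d -> A d) : Prop :=
  [/\ forall d, involutive (sigma d),
      forall d, linear (sigma d),
      forall d, sigma d 1 = 1,
      forall d a b, sigma d (a * b) = sigma d b * sigma d a &
      smooth_map [set: total] E E (fiberwise1 sigma)].

End AlgebraFamilies.

(* * Matrices over a noncommutative algebra *)

Section Matrices.
Context {K : pzRingType}.

Definition is_inverse (x y : K) : Prop := x * y = 1 /\ y * x = 1.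

Definition invertible (x : K) : Prop := exists y, is_inverse x y.

(* The inverse of an invertible x. *)
Definition inverse (x : K) : K := xget 0 [set y | is_inverse x y].

End Matrices.

Section UnitaryGroups.
Context {K : nzRingType} (sigma : K -> K) {n : nat}.

Definition dagger {m} (X : 'M[K]_m) : 'M[K]_m := (map_mx sigma X)^T.

Definition Herm {m} : set 'M[K]_m := [set X | dagger X = X].

Definition unitary {m} (J : 'M[K]_m) : set 'M[K]_m :=
  [set X | invertible X /\ dagger X *m J *m X = J].

Definition stabilizer : set 'M[K]_(n + 1) :=
  [set M | exists (X : 'M[K]_n) (v : 'rV[K]_n) (alpha : K),
     [/\ invertible X, invertible alpha & M = block_mx X 0 v alpha%:M]].

Definition unitary_stabilizer (J : 'M[K]_(n + 1)) : set 'M[K]_(n + 1) :=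
  unitary J `&` stabilizer.

End UnitaryGroups.

(* The trivializations of the bundle of m x m matrices over A induced by those
   of A: the entries of a matrix are trivialized one by one. *)
Definition mx_trivialization {R : realType} {B : Type} {A : B -> Type} (m : nat)
    (t : trivialization R A) : trivialization R (fun d => 'M[A d]_m) :=
  Trivialization (tdom t)
    (fun d X => mxvec (\matrix_(i < m * m) tfun t d (mxvec X 0 i)))
    (fun d w => vec_mx (\row_(i < m * m) tinv t d (row i (vec_mx w)))).

Definition mx_atlas {R : realType} {B : Type} {A : B -> Type} (D : atlas R B)
    (Phi : set (trivialization R A)) (m : nat) : atlas R {d : B & 'M[A d]_m} :=
  total_atlas D (mx_trivialization m @` Phi).

(* Main.v *)
Require Import Defs.
From HB Require Import structures.
Set Warnings "-notation-overridden,-notation-incompatible-prefix,-ambiguous-paths".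
From mathcomp Require Import all_boot all_order all_algebra.
From mathcomp Require Import all_classical all_reals all_analysis.
From mathcomp Require Import ring lra.

Import Order.TTheory GRing.Theory Num.Theory.
Import numFieldNormedType.Exports.

Local Open Scope classical_set_scope.
Local Open Scope ring_scope.

(** Everything is proved with plots, i.e. maps from an open piece of a row space
    which are smooth in the charts of a manifold: a map between manifolds is
    smooth exactly when it sends plots to plots ([smooth_map_plot],
    [smooth_map_intro]), the plots of a submanifold are the plots of the ambient
    manifold with values in it ([sub_plot], [plot_sub]), and the plots of a
    product are the pairs of plots.  A plot into the bundle of matrices is a
    matrix whose entries are plots into the bundle of algebras ([mplotP]), so
    products, adjoints and inverses of smooth families of matrices are smooth.

    The point is therefore to find slice charts for the unitary groups.  Near a
    unitary X0 over d0, a trivialization turns X into coordinates, and X is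
    unitary when its defect Q(X) = X^dagger J X - J vanishes.  The defect is
    Hermitian, but the space of Hermitian matrices moves with the base point.
    Let P0 be the projector (1 + dagger) / 2 of the fiber over d0.  For d near
    d0 the projector of the fiber over d is close to P0, so P0 is injective on
    the Hermitian matrices over d and unitarity amounts to P0 Q(X) = 0
    ([defect_eq0]).  With K = X0^dagger J H the derivative of Q at X0 in the
    direction H is K + K^dagger = 2 P0 K, and H is determined by K because X0
    and J are invertible.  Hence
      (d, X) |-> (d, (1 - P0) (X0^dagger J (X - X0)) + P0 Q(X))
    has an injective differential at (d0, X0) ([diff_Psi_inj]), and the inverse
    function theorem ([inverse_function]) makes it a chart in which the unitary
    groups are a slice containing all the coordinates of the base.

    As J is diagonal, conjugation by diag(1, ..., 1, -1) preserves the unitary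
    groups, and its fixed points there are exactly the stabilizers: a block
    triangular unitary matrix with respect to a diagonal form is block diagonal
    ([unitary_stabilizerP]).  This involution acts linearly in the above charts,
    where its fixed points are cut out by the vanishing of further coordinates
    ([unitary_local_chart]).

    Finally, in charts that contain the coordinates of the base ([adapted]) the
    projection is a coordinate projection.  This gives the submersions, and
    exhibits the fibers and the fiber square, on which the group laws have to be
    smooth, as slices. *)

(** * Maps of class C^k *)

Section CkCalculus.
Context {R : realType} {V : normedModType R}.
Implicit Types (W : normedModType R) (O : set V) (k : nat).

(** Differentials and directional derivatives at a point only see the germ
    of the map there, which f and g share because O is open. *)
Lemma C_on_eq W k O (f g : V -> W) : open O -> (forall x, O x -> f x = g x) ->
  C_on k O f -> C_on k O g.
Proof.
move=> oO.
have nearO (f' g' : V -> W) x : (forall x, O x -> f' x = g' x) -> O x ->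
    \near x, f' x = g' x.
  by move=> fg Ox; apply: (filterS fg); apply: open_nbhs_nbhs; split.
elim: k f g => [|k IH] f g fg /=.
  move=> cf x Ox; have nfg := nearO _ _ _ fg Ox.
  rewrite /prop_for /continuous_at -fg //.
  by apply: cvg_trans (cf x Ox); apply: near_eq_cvg; apply: filterS nfg => y /= ->.
move=> [df Df]; split.
  move=> x Ox; have nfg := nearO _ _ _ fg Ox.
  have /diff_locallyP [dc fE] := df x Ox.
  apply/diff_locallyP.
  have fE' : g \o shift x = cst (g x) + 'd f x +o_ 0 id.
    apply/eqaddoP => e e0.
    move/eqaddoP: fE => /(_ _ e0) fE.
    have nfg0 : \forall h \near 0, f (h + x) = g (h + x).
      by move: nfg; rewrite (near_shift 0)/= subr0.
    near=> h.
    have := near fE h; rewrite /= => /(_ _) H.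
    rewrite -[X in `|X|]/(g (h + x) - (g x + 'd f x h)) -(near nfg0 h) // -fg //.
    by apply: H.
  by rewrite (diff_unique dc fE'); split.
move=> v; apply: IH (Df v) => x Ox; apply: near_eq_derive; exact: nearO.
Unshelve. all: by end_near. Qed.

Lemma C_on_subset W k O O' (f : V -> W) : O' `<=` O -> C_on k O f -> C_on k O' f.
Proof.
move=> sO; elim: k f => [|k IH] f /=; first by move=> cf x /sO; exact: cf.
by move=> [df Df]; split=> [x /sO|v]; [exact: df|exact: IH].
Qed.

Lemma C_on_local W k O (f : V -> W) :
  (forall x, O x -> exists2 O', O' x & C_on k O' f) -> C_on k O f.
Proof.
elim: k f => [|k IH] f H.
  by move=> x /H [U1 U1x]; apply.
split; first by move=> x /H [U1 U1x [df _]]; apply: df.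
by move=> v; apply: IH => x /H [U1 U1x [_ Df]]; exists U1; [|exact: Df].
Qed.

Lemma C_onW W k O (f : V -> W) : C_on k.+1 O f -> C_on k O f.
Proof.
elim: k f => [|k IH] f; last by case=> df Df; split=> // v; exact: IH.
by move=> [df _] x Ox; exact/differentiable_continuous/df.
Qed.

Lemma C_on_cst W k O (w : W) : C_on k O (fun=> w).
Proof.
elim: k w => [|k IH] w /=; first by move=> x _; exact: cvg_cst.
split=> [x _|v]; first exact: differentiable_cst.
have -> : (fun x : V => 'D_v (fun=> w) x) = fun=> 0; last exact: IH.
by apply/funext => x; exact: derive_cst.
Qed.

Lemma C_onD W k O (f g : V -> W) : open O ->
  C_on k O f -> C_on k O g -> C_on k O (fun x => f x + g x).
Proof.
move=> oO; elim: k f g => [|k IH] f g /=.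
  by move=> cf cg x Ox; apply: cvgD; [exact: cf|exact: cg].
move=> [df Df] [dg Dg]; split; first by move=> x Ox; apply: differentiableD; auto.
move=> v; apply: (C_on_eq _ _ _ (fun x => 'D_v f x + 'D_v g x)) => //; last exact: IH.
by move=> x Ox; rewrite -[RHS]/('D_v (f + g) x) deriveD //; apply: diff_derivable; auto.
Qed.

Lemma C_on_postlin W W' k O (L : {linear W -> W'}) (f : V -> W) : open O ->
  continuous L -> C_on k O f -> C_on k O (fun x => L (f x)).
Proof.
move=> oO cL; elim: k f => [|k IH] f /=.
  by move=> cf x Ox; apply: continuous_comp; [exact: cf|exact: cL].
move=> [df Df]; split.
  move=> x Ox; apply: (@differentiable_comp _ _ _ _ f L); first exact: df.
  exact: linear_differentiable.
move=> v; apply: (C_on_eq _ _ _ (fun x => L ('D_v f x))) => //; last exact: IH.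
move=> x Ox; rewrite [RHS](@deriveE _ _ _ (L \o f)); last first.
  by apply: differentiable_comp; [exact: df|exact: linear_differentiable].
rewrite diff_comp; [|exact: df|exact: linear_differentiable].
by rewrite /= diff_lin // deriveE //; exact: df.
Qed.

Lemma C_onM k O (f g : V -> R) : open O ->
  C_on k O f -> C_on k O g -> C_on k O (fun x => f x * g x).
Proof.
move=> oO; elim: k f g => [|k IH] f g.
  by move=> cf cg x Ox; apply: cvgM; [exact: cf|exact: cg].
move=> Cf Cg; have [cf cg] := (C_onW _ _ _ _ Cf, C_onW _ _ _ _ Cg).
have [[df Df] [dg Dg]] := (Cf, Cg); split.
  by move=> x Ox; apply: differentiableM; auto.
move=> v.
apply: (C_on_eq _ _ _ (fun x => f x * 'D_v g x + g x * 'D_v f x)) => //.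
  by move=> x Ox; rewrite -[RHS]/('D_v (f * g) x) deriveM //; apply: diff_derivable; auto.
by apply: C_onD => //; apply: IH; [exact: cf|exact: Dg|exact: cg|exact: Df].
Qed.

Lemma C_onV k O (f : V -> R) : open O -> (forall x, O x -> f x != 0) ->
  C_on k O f -> C_on k O (fun x => (f x)^-1).
Proof.
move=> oO f0; elim: k => [|k IH].
  by move=> cf x Ox; apply: cvgV; [exact: f0|exact: cf].
move=> Cf; have {}IH := IH (C_onW _ _ _ _ Cf).
have [df Df] := Cf; split; first by move=> x Ox; apply: differentiableV; auto.
move=> v.
apply: (C_on_eq _ _ _ (fun x => (-1) * ((f x)^-1 * (f x)^-1) * 'D_v f x)) => //.
  move=> x Ox; rewrite deriveV; [|exact: f0|by apply: diff_derivable; exact: df].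
  by rewrite -exprVn expr2 mulN1r.
apply: C_onM => //; last exact: Df.
apply: C_onM => //; first exact: C_on_cst.
exact: C_onM.
Qed.

Lemma C_on_sum W k O I (r : seq I) (P : pred I) (f : I -> V -> W) : open O ->
  (forall i, P i -> C_on k O (f i)) ->
  C_on k O (fun x => \sum_(i <- r | P i) f i x).
Proof.
move=> oO Cf; elim: r => [|i r IH].
  by apply: (C_on_eq _ _ _ (fun=> 0)) => //; [move=> x; rewrite big_nil|exact: C_on_cst].
case: (boolP (P i)) => Pi.
  apply: (C_on_eq _ _ _ (fun x => f i x + \sum_(i <- r | P i) f i x)) => //.
    by move=> x; rewrite big_cons Pi.
  by apply: C_onD => //; exact: Cf.
by apply: C_on_eq IH => // x; rewrite big_cons (negbTE Pi).
Qed.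

Lemma C_on_prod k O I (r : seq I) (f : I -> V -> R) : open O ->
  (forall i, C_on k O (f i)) -> C_on k O (fun x => \prod_(i <- r) f i x).
Proof.
move=> oO Cf; elim: r => [|i r IH].
  by apply: (C_on_eq _ _ _ (fun=> 1 : R)) => //; [move=> x; rewrite big_nil|exact: C_on_cst].
apply: (C_on_eq _ _ _ (fun x => f i x * \prod_(i <- r) f i x)) => //.
  by move=> x; rewrite big_cons.
exact: C_onM.
Qed.

Lemma C_on_coord k O m n (f : V -> 'M[R]_(m, n)) i j : open O ->
  C_on k O f -> C_on k O (fun x => f x i j).
Proof.
move=> oO.
have @L : {linear 'M[R]_(m, n) -> R}.
  by exists (fun N : 'M[R]_(_, _) => N i j); do 2![eexists]; do ?[constructor];
     rewrite ?mxE// => ? *; rewrite ?mxE//; move=> ?; rewrite !mxE.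
by apply: (C_on_postlin _ _ _ _ L) => //; exact: coord_continuous.
Qed.

Lemma C_on_mx k O m n (f : V -> 'M[R]_(m, n)) : open O ->
  (forall i j, C_on k O (fun x => f x i j)) -> C_on k O f.
Proof.
move=> oO Cf.
apply: (C_on_eq _ _ _ (fun x => \sum_i \sum_j f x i j *: delta_mx i j)) => //.
  by move=> x _; rewrite -matrix_sum_delta.
do 2 (apply: C_on_sum => // ? _).
set M := delta_mx _ _.
have Mlin : linear (fun r : R => r *: M) by move=> a b c; rewrite scalerDl scalerA.
pose L : {linear R -> 'M[R]_(m, n)} :=
  HB.pack (fun r : R => r *: M) (GRing.isLinear.Build _ _ _ _ _ Mlin).
by apply: (C_on_postlin _ _ _ _ L) => //; exact: scalel_continuous.
Qed.

End CkCalculus.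

Section CkMatrix.
Context {R : realType} {V : normedModType R}.
Implicit Types (O : set V) (k : nat).

Lemma C_on_mulmx k O m n p (f : V -> 'M[R]_(m, n)) (g : V -> 'M[R]_(n, p)) :
  open O -> C_on k O f -> C_on k O g -> C_on k O (fun x => f x *m g x).
Proof.
move=> oO Cf Cg; apply: C_on_mx => // i j.
apply: (C_on_eq _ _ _ (fun x => \sum_l f x i l * g x l j)) => //.
  by move=> x _; rewrite mxE.
by apply: C_on_sum => // l _; apply: C_onM => //; exact: C_on_coord.
Qed.

Lemma C_on_det k O n (f : V -> 'M[R]_n) : open O ->
  C_on k O f -> C_on k O (fun x => \det (f x)).
Proof.
move=> oO Cf; rewrite /determinant; apply: C_on_sum => // s _.
apply: C_onM => //; first exact: C_on_cst.
by apply: C_on_prod => // i; exact: C_on_coord.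
Qed.

(** Cramer's rule. *)
Lemma C_on_invmx k O n (f : V -> 'M[R]_n) : open O ->
  (forall x, O x -> f x \in unitmx) ->
  C_on k O f -> C_on k O (fun x => invmx (f x)).
Proof.
move=> oO fU Cf.
apply: (C_on_eq _ _ _ (fun x => (\det (f x))^-1 *: \adj (f x))) => //.
  by move=> x Ox; rewrite /invmx fU.
apply: C_on_mx => // i j.
apply: (C_on_eq _ _ _ (fun x => (\det (f x))^-1 *
    ((-1) ^+ (j + i) * \det (row' j (col' i (f x)))))) => //.
  by move=> x Ox; rewrite !mxE.
apply: C_onM => //.
  apply: C_onV => //; last exact: C_on_det.
  by move=> x /fU; rewrite unitmxE unitfE.
apply: C_onM => //; first exact: C_on_cst.
apply: C_on_det => //; apply: C_on_mx => // a b.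
apply: (C_on_eq _ _ _ (fun x => f x (lift j a) (lift i b))) => //.
  by move=> x Ox; rewrite !mxE.
exact: C_on_coord.
Qed.

(** Induction on k with the chain rule
    D_v (f o h) = \sum_j (D_v h)_j ((D_(e_j) f) o h), whose factors are of class
    C^(k-1).  This is where the source of f has to be finite-dimensional. *)
Lemma C_on_comp_R k n (O' : set 'rV[R]_n) O (f : 'rV[R]_n -> R) (h : V -> 'rV[R]_n) :
  open O -> (forall x, O x -> O' (h x)) ->
  C_on k O' f -> C_on k O h -> C_on k O (f \o h).
Proof.
move=> oO hO; elim: k f h hO => [|k IH] f h hO.
  by move=> cf ch x Ox; apply: continuous_comp; [exact: ch|apply: cf; exact: hO].
move=> Cf Ch; have ch := C_onW _ _ _ _ Ch.
have [[df Df] [dh Dh]] := (Cf, Ch); split.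
  by move=> x Ox; apply: differentiable_comp; [exact: dh|apply: df; exact: hO].
move=> v; apply: (C_on_eq _ _ _
  (fun x => \sum_j ('D_v h x) 0 j * ('D_(delta_mx 0 j) f \o h) x)) => //.
  move=> x Ox; have dfx := df _ (hO _ Ox); have dhx := dh _ Ox.
  rewrite [RHS]deriveE; last exact: differentiable_comp.
  rewrite diff_comp //= [in RHS](row_sum_delta ('d h x v)) linear_sum.
  by apply: eq_bigr => j _; rewrite linearZ /= !deriveE.
apply: C_on_sum => // j _; apply: C_onM => //.
  by apply: C_on_coord => //; exact: Dh.
by apply: IH => //; exact: Df.
Qed.

Lemma C_on_comp k n m p (O' : set 'rV[R]_n) O (f : 'rV[R]_n -> 'M[R]_(m, p))
    (h : V -> 'rV[R]_n) :
  open O -> open O' -> (forall x, O x -> O' (h x)) ->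
  C_on k O' f -> C_on k O h -> C_on k O (f \o h).
Proof.
move=> oO oO' hO Cf Ch; apply: C_on_mx => // i j.
apply: (C_on_comp_R _ _ O' _ (fun y => f y i j)) => //; exact: C_on_coord.
Qed.

End CkMatrix.

(** * Germs of smooth maps *)

(** Germs make locality automatic: no domain has to be carried along when
    smooth maps are composed. *)
Definition smooth_at {R : realType} {V W : normedModType R} (f : V -> W) (x : V) :=
  exists2 Q : set V, open_nbhs x Q & smooth_on Q f.

Section SmoothAt.
Context {R : realType} {V : normedModType R}.
Implicit Types (W : normedModType R) (x : V).

Lemma smooth_at_near W (f : V -> W) x : smooth_at f x -> \near x, smooth_at f x.
Proof.
move=> [Q [oO Ox] sf]; apply: (@filterS _ _ _ Q); last exact: open_nbhs_nbhs.
by move=> y Oy; exists Q.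
Qed.

Lemma smooth_onP W (Q : set V) (f : V -> W) : open Q ->
  smooth_on Q f <-> (forall x, Q x -> smooth_at f x).
Proof.
move=> oO; split=> [sf x Ox|H k]; first by exists Q.
by apply: C_on_local => x /H [U [_ Ux] sf]; exists U.
Qed.

Lemma smooth_at_eq W (f g : V -> W) x :
  (\near x, f x = g x) -> smooth_at f x -> smooth_at g x.
Proof.
move=> fg [Q [oO Ox] sf]; have : nbhs x (Q `&` [set y | f y = g y]).
  by apply: filterI => //; exact: open_nbhs_nbhs.
rewrite nbhsE => -[U [oU Ux] sU]; exists U => // k.
apply: (C_on_eq _ _ _ f) => //; first by move=> y /sU [].
by apply: C_on_subset (sf k) => y /sU [].
Qed.

Lemma smooth_at_ext W (f g : V -> W) x : f =1 g -> smooth_at f x -> smooth_at g x.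
Proof. by move=> fg; have -> : g = f by apply/funext => y; rewrite fg. Qed.

Lemma smooth_at_differentiable W (f : V -> W) x : smooth_at f x -> differentiable f x.
Proof. by move=> [Q [_ Ox] /(_ 1%N) [df _]]; exact: df. Qed.

Lemma smooth_at_continuous W (f : V -> W) x : smooth_at f x -> {for x, continuous f}.
Proof. by move=> /smooth_at_differentiable /differentiable_continuous. Qed.

Lemma smooth_at_near_set W (f : V -> W) x (Q : set W) :
  smooth_at f x -> open Q -> Q (f x) -> \near x, Q (f x).
Proof.
by move=> /smooth_at_continuous cf oO Ox; apply: cf; exact: open_nbhs_nbhs.
Qed.

Lemma smooth_at_derive W (f : V -> W) x v : smooth_at f x -> smooth_at ('D_v f) x.
Proof. by move=> [Q Ox sf]; exists Q => // k; have [_ Df] := sf k.+1; exact: Df. Qed.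

Lemma smooth_at_cst W (w : W) x : smooth_at (fun=> w) x.
Proof. by exists setT; [exact: (conj openT I)|move=> k; exact: C_on_cst]. Qed.

Lemma smooth_at_id x : smooth_at id x.
Proof.
exists setT; [exact: (conj openT I)|move=> k].
case: k => [|k]; first by move=> y _; exact: cvg_id.
split=> [y _|v]; first exact: ex_diff.
have -> : (fun x : V => 'D_v id x) = fun=> v; last exact: C_on_cst.
by apply/funext => y; exact: derive_id.
Qed.

Lemma smooth_atD W (f g : V -> W) x :
  smooth_at f x -> smooth_at g x -> smooth_at (fun y => f y + g y) x.
Proof.
move=> [Q [oO Ox] sf] [U [oU Ux] sg]; exists (Q `&` U).
  by split=> //; exact: openI.
move=> k; apply: C_onD; first exact: openI.
  by apply: C_on_subset (sf k) => ? [].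
by apply: C_on_subset (sg k) => ? [].
Qed.

Lemma smooth_at_postlin W W' (L : {linear W -> W'}) (f : V -> W) x :
  continuous L -> smooth_at f x -> smooth_at (fun y => L (f y)) x.
Proof. by move=> cL [Q [oO Ox] sf]; exists Q => // k; exact: C_on_postlin. Qed.

Lemma smooth_atZ W (a : R) (f : V -> W) x :
  smooth_at f x -> smooth_at (fun y => a *: f y) x.
Proof. by apply: (smooth_at_postlin _ _ (GRing.scale a)); exact: scaler_continuous. Qed.

Lemma smooth_atN W (f : V -> W) x : smooth_at f x -> smooth_at (fun y => - f y) x.
Proof.
move=> /(smooth_atZ _ (-1)); apply: smooth_at_eq; apply: nearW => y.
by rewrite scaleN1r.
Qed.

Lemma smooth_atB W (f g : V -> W) x :
  smooth_at f x -> smooth_at g x -> smooth_at (fun y => f y - g y) x.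
Proof. by move=> sf sg; apply: smooth_atD => //; exact: smooth_atN. Qed.

Lemma smooth_at_sum W I (r : seq I) (f : I -> V -> W) x :
  (forall i, smooth_at (f i) x) -> smooth_at (fun y => \sum_(i <- r) f i y) x.
Proof.
move=> sf; elim: r => [|i r IH].
  apply: (smooth_at_eq _ (fun=> 0)); last exact: smooth_at_cst.
  by apply: nearW => y; rewrite big_nil.
apply: (smooth_at_eq _ (fun y => f i y + \sum_(i <- r) f i y)).
  by apply: nearW => y; rewrite big_cons.
exact: smooth_atD.
Qed.

Lemma smooth_atM (f g : V -> R) x :
  smooth_at f x -> smooth_at g x -> smooth_at (fun y => f y * g y) x.
Proof.
move=> [Q [oO Ox] sf] [U [oU Ux] sg]; exists (Q `&` U).
  by split=> //; exact: openI.
move=> k; apply: C_onM; first exact: openI.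
  by apply: C_on_subset (sf k) => ? [].
by apply: C_on_subset (sg k) => ? [].
Qed.

Lemma smooth_at_coord m n (f : V -> 'M[R]_(m, n)) i j x :
  smooth_at f x -> smooth_at (fun y => f y i j) x.
Proof. by move=> [Q [oO Ox] sf]; exists Q => // k; exact: C_on_coord. Qed.

Lemma smooth_at_mx m n (f : V -> 'M[R]_(m, n)) x :
  (forall i j, smooth_at (fun y => f y i j) x) -> smooth_at f x.
Proof.
move=> sf; apply: (smooth_at_eq _ (fun y => \sum_i \sum_j f y i j *: delta_mx i j)).
  by apply: nearW => y; rewrite -matrix_sum_delta.
do 2 (apply: smooth_at_sum => ?).
set M := delta_mx _ _.
have Mlin : linear (fun r : R => r *: M) by move=> a b c; rewrite scalerDl scalerA.
pose L : {linear R -> 'M[R]_(m, n)} :=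
  HB.pack (fun r : R => r *: M) (GRing.isLinear.Build _ _ _ _ _ Mlin).
by apply: (smooth_at_postlin _ _ L) => //; exact: scalel_continuous.
Qed.

Lemma smooth_at_mulmx m n p (f : V -> 'M[R]_(m, n)) (g : V -> 'M[R]_(n, p)) x :
  smooth_at f x -> smooth_at g x -> smooth_at (fun y => f y *m g y) x.
Proof.
move=> sf sg; apply: smooth_at_mx => i j.
apply: (smooth_at_eq _ (fun y => \sum_l f y i l * g y l j)).
  by apply: nearW => y; rewrite mxE.
by apply: smooth_at_sum => l; apply: smooth_atM; exact: smooth_at_coord.
Qed.

Lemma smooth_at_det n (f : V -> 'M[R]_n) x :
  smooth_at f x -> smooth_at (fun y => \det (f y)) x.
Proof. by move=> [Q [oO Ox] sf]; exists Q => // k; exact: C_on_det. Qed.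

Lemma unitmx_near n (f : V -> 'M[R]_n) x : smooth_at f x -> f x \in unitmx ->
  \near x, f x \in unitmx.
Proof.
move=> /smooth_at_det sd; rewrite unitmxE unitfE => d0.
have := smooth_at_near_set _ _ _ [set r : R | r != 0] sd (@open_neq _ 0) d0.
by apply: filterS => y /=; rewrite unitmxE unitfE.
Qed.

Lemma smooth_at_invmx n (f : V -> 'M[R]_n) x : smooth_at f x -> f x \in unitmx ->
  smooth_at (fun y => invmx (f y)) x.
Proof.
move=> sf /(unitmx_near _ _ _ sf) uf; have [Q [oO Ox] sfO] := sf.
have : nbhs x (Q `&` [set y | f y \in unitmx]).
  by apply: filterI => //; exact: open_nbhs_nbhs.
rewrite nbhsE => -[U [oU Ux] sU]; exists U => // k.
apply: C_on_invmx => //; first by move=> y /sU [].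
by apply: C_on_subset (sfO k) => y /sU [].
Qed.

Lemma smooth_at_comp m n p (f : 'rV[R]_n -> 'M[R]_(m, p)) (h : V -> 'rV[R]_n) x :
  smooth_at h x -> smooth_at f (h x) -> smooth_at (f \o h) x.
Proof.
move=> sh [Q [oO Ohx] sf]; have hO := smooth_at_near_set _ _ _ _ sh oO Ohx.
have [Q' [oO' Q'x] sh'] := sh.
have : nbhs x (Q' `&` [set y | Q (h y)]).
  by apply: filterI => //; exact: open_nbhs_nbhs.
rewrite nbhsE => -[U [oU Ux] sU]; exists U => // k.
apply: (C_on_comp _ _ _ _ Q) => //; first by move=> y /sU [].
by apply: C_on_subset (sh' k) => y /sU [].
Qed.

Lemma smooth_at_lsubmx m n p (f : V -> 'M[R]_(m, n + p)) x :
  smooth_at f x -> smooth_at (fun y => lsubmx (f y)) x.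
Proof. by apply: smooth_at_postlin; exact: continuous_lsubmx. Qed.

Lemma smooth_at_rsubmx m n p (f : V -> 'M[R]_(m, n + p)) x :
  smooth_at f x -> smooth_at (fun y => rsubmx (f y)) x.
Proof. by apply: smooth_at_postlin; exact: continuous_rsubmx. Qed.

Lemma smooth_at_row_mx m n p (f : V -> 'M[R]_(m, n)) (g : V -> 'M[R]_(m, p)) x :
  smooth_at f x -> smooth_at g x -> smooth_at (fun y => row_mx (f y) (g y)) x.
Proof.
move=> sf sg; apply: smooth_at_mx => i j.
case: (split_ordP j) => k ->.
  apply: (smooth_at_eq _ (fun y => f y i k)); last exact: smooth_at_coord.
  by apply: nearW => y; rewrite row_mxEl.
apply: (smooth_at_eq _ (fun y => g y i k)); last exact: smooth_at_coord.
by apply: nearW => y; rewrite row_mxEr.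
Qed.

Lemma smooth_at_linear n p q (L : 'rV[R]_n -> 'M[R]_(p, q)) (f : V -> 'rV[R]_n) x :
  linear L -> smooth_at f x -> smooth_at (fun y => L (f y)) x.
Proof.
move=> linL sf.
pose L' : {linear 'rV[R]_n -> 'M[R]_(p, q)} :=
  HB.pack L (GRing.isLinear.Build _ _ _ _ _ linL).
apply: (smooth_at_eq _ (fun y => \sum_j f y 0 j *: L (delta_mx 0 j))).
  apply: nearW => y; rewrite -[RHS]/(L' (f y)) [in RHS](row_sum_delta (f y)) linear_sum.
  by apply: eq_bigr => j _; rewrite linearZ.
apply: smooth_at_sum => j; apply: smooth_at_mx => a b.
apply: (smooth_at_eq _ (fun y => f y 0 j * L (delta_mx 0 j) a b)).
  by apply: nearW => y; rewrite mxE.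
by apply: smooth_atM; [exact: smooth_at_coord|exact: smooth_at_cst].
Qed.

End SmoothAt.

(** * The inverse function theorem *)

Section InverseFunction.
Context {R : realType} {n : nat}.
Implicit Types (f h : 'rV[R]_n -> 'rV[R]_n) (a x y v : 'rV[R]_n).

Lemma norm_coord_le m (v : 'rV[R]_m) j : `|v 0 j| <= `|v|.
Proof.
rewrite [leRHS]/Num.Def.normr /= mx_normrE; exact: (le_bigmax _ _ (0, j)).
Qed.

Lemma norm_row_le m (v : 'rV[R]_m) c :
  0 <= c -> (forall j, `|v 0 j| <= c) -> `|v| <= c.
Proof.
move=> c0 H; rewrite /Num.Def.normr /= mx_normrE; apply: bigmax_le => // -[i j] _ /=.
by rewrite (ord1 i).
Qed.

(** The one-variable mean value theorem along the segment from y to x, in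
    each coordinate; for the maximum norm this costs the factor n. *)
Lemma mean_value_row f a (r e : R) :
  (forall x, ball a r x -> differentiable f x) ->
  (forall x, ball a r x -> forall i j, `|('D_(delta_mx 0 i) f x) 0 j| <= e) ->
  forall x y, ball a r x -> ball a r y -> `|f x - f y| <= n%:R * e * `|x - y|.
Proof.
move=> df De x y ax ay.
have [r0|r0] := leP r 0.
  by move: ax; rewrite -ball_normE /= ltNge (le_trans r0).
have bl (t : R) : 0 <= t <= 1 -> ball a r (y + t *: (x - y)).
  move=> /andP[t0 t1]; move: ax ay; rewrite -!ball_normE /= => ax ay.
  have -> : a - (y + t *: (x - y)) = (1 - t) *: (a - y) + t *: (a - x).
    rewrite !scalerBr !scalerBl !scale1r; apply/rowP => i; rewrite !mxE; lra.
  rewrite (le_lt_trans (ler_normD _ _)) // !normrZ !ger0_norm ?subr_ge0 //.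
  have [->|tn0] := eqVneq t 0; first by rewrite subr0 mul1r mul0r addr0.
  have tp : 0 < t by rewrite lt_def tn0.
  have : (1 - t) * `|a - y| <= (1 - t) * r by apply: ler_wpM2l; lra.
  have : t * `|a - x| < t * r by rewrite ltr_pM2l.
  by move=> *; lra.
have e0 : n%:R * e >= 0.
  have [n0|n0] := posnP n; first by rewrite n0 mul0r.
  by rewrite mulr_ge0 // (le_trans _ (De x ax (Ordinal n0) (Ordinal n0))).
apply: norm_row_le => [|j]; first exact: mulr_ge0.
pose l (t : R) : 'rV[R]_n := y + t *: (x - y).
pose psi (t : R) : R := f (l t) 0 j.
have dl (t : R) : is_diff t l ( *:%R^~ (x - y)).
  have H := is_diffD (is_diff_cst y (t : R : normedModType R)) (is_diff_scalel t (x - y)).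
  exact: (is_diff_eq H (add0r _)).
have dpsi (t : R) : 0 <= t <= 1 ->
    is_derive t 1 psi (('d f (l t) (x - y)) 0 j).
  move=> /bl /df dfl.
  have dc := differentiable_coord (f (l t)) 0 j.
  have dfl' : differentiable (f \o l) t by apply: differentiable_comp.
  have dp : differentiable psi t.
    exact: (@differentiable_comp _ _ _ _ (f \o l) (fun N : 'rV[R]_n => N 0 j)).
  apply: DeriveDef; first exact: diff_derivable.
  rewrite deriveE // [LHS](_ : _ = ('d (f \o l) t 1) 0 j).
    by rewrite diff_comp //= diff_val scale1r.
  rewrite -deriveE // -deriveE // derive_mx ?mxE //.
  exact: diff_derivable.
have [|||c cc E] := @MVT_segment R psi (fun t => ('d f (l t) (x - y)) 0 j) 0 1.
- by [].
- move=> t; rewrite in_itv /= => /andP[t0 t1]; apply: dpsi; lra.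
- apply: derivable_within_continuous => t; rewrite in_itv /= => t01.
  by have [] := dpsi t t01.
have {}cc : 0 <= c <= 1 by move: cc; rewrite in_itv.
have -> : (f x - f y) 0 j = psi 1 - psi 0.
  by rewrite !mxE /psi /l scale1r scale0r addr0 subrKC.
rewrite E subr0 mulr1 [x - y in leLHS]row_sum_delta linear_sum summxE.
apply: le_trans (ler_norm_sum _ _ _) _.
rewrite -mulrA mulr_natl -[X in _ *+ X]card_ord -sumr_const; apply: ler_sum => i _.
rewrite linearZ /= mxE normrM mulrC -deriveE; last by apply: df; exact: bl.
apply: ler_pM => //; last exact: norm_coord_le.
by apply: De; exact: bl.
Qed.

Lemma smooth_at_jacobian f a : smooth_at f a -> smooth_at (jacobian f) a.
Proof.
move=> sf; apply: smooth_at_mx => i j.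
apply: (smooth_at_eq _ (fun x => ('D_(delta_mx 0 i) f x) 0 j)).
  apply: filterS (smooth_at_near _ _ _ sf) => x sx.
  rewrite deriveE; last exact: smooth_at_differentiable.
  by rewrite /jacobian mxE.
by apply: smooth_at_coord; exact: smooth_at_derive.
Qed.

(** On a small ball h differs from the identity by a map phi with Lipschitz
    constant 1/2.  This gives the second bound at once.  For the last claim, x is
    found by minimizing the distance from h x to y on a compact ball. *)
Lemma tangent_to_identity h a (P : set 'rV[R]_n) : smooth_at h a ->
  (forall v, 'd h a v = v) -> nbhs a P ->
  exists2 r, 0 < r & [/\
    forall x, ball a r x -> [/\ P x, smooth_at h x & jacobian h x \in unitmx],
    forall x y, ball a r x -> ball a r y -> `|x - y| <= 2 * `|h x - h y| &
    forall y, ball (h a) (r / 4) y -> exists2 x, ball a r x & h x = y].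
Proof.
move=> sh dh nP.
pose phi x := x - h x.
have sphi : smooth_at phi a.
  by apply: smooth_atB => //; exact: smooth_at_id.
have dphi i : 'D_(delta_mx 0 i) phi a = 0.
  have dha := smooth_at_differentiable _ _ _ sh.
  have didd : differentiable (id : 'rV[R]_n -> 'rV[R]_n) a by exact: ex_diff.
  rewrite -[LHS]/('D_(delta_mx 0 i) (id - h) a) deriveB; try exact: diff_derivable.
  by rewrite derive_id deriveE // dh subrr.
pose e : R := (2 * n.+1%:R)^-1.
have e0 : 0 < e by rewrite invr_gt0 mulr_gt0.
have nD : \near a, forall i j, `|('D_(delta_mx 0 i) phi a) 0 j| <= e.
  apply: (@filter_forall _ _ (fun i x => forall j, `|('D_(delta_mx 0 i) phi x) 0 j| <= e) (nbhs a)) => i.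
  apply: (@filter_forall _ _ (fun j x => `|('D_(delta_mx 0 i) phi x) 0 j| <= e) (nbhs a)) => j.
  have sD : smooth_at (fun x => ('D_(delta_mx 0 i) phi x) 0 j) a.
    by apply: smooth_at_coord; exact: smooth_at_derive.
  have /cvgrPdist_le /(_ e e0) := smooth_at_continuous _ _ _ sD.
  by apply: filterS => x; rewrite dphi mxE sub0r normrN.
have nJ : \near a, jacobian h a \in unitmx.
  apply: (unitmx_near _ (jacobian h)); first exact: smooth_at_jacobian.
  rewrite (_ : jacobian h a = 1%:M) ?unitmx1 //.
  by apply/row_matrixP => i; rewrite rowE /jacobian mul_rV_lin1 /= dh row1.
have /nbhs_ballP [r r0 Hr] : nbhs a (P `&` ([set x | smooth_at h x /\ smooth_at phi x]
    `&` ([set x | jacobian h x \in unitmx] `&`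
     [set x | forall i j, `|('D_(delta_mx 0 i) phi x) 0 j| <= e]))).
  apply: filterI => //; apply: filterI; last exact: filterI.
  exact: (filterI (smooth_at_near _ _ _ sh) (smooth_at_near _ _ _ sphi)).
have ne : n%:R * e <= 2^-1.
  rewrite /e invfM mulrCA ler_piMr ?invr_ge0 //.
  by rewrite ler_pdivrMr // mul1r ler_nat.
have lip x y : ball a r x -> ball a r y -> `|phi x - phi y| <= 2^-1 * `|x - y|.
  move=> ax ay; apply: le_trans (mean_value_row phi a r e _ _ x y ax ay) _.
  - by move=> z /Hr [_ [[_ /smooth_at_differentiable]]].
  - by move=> z /Hr [_ [_ [_]]].
  by apply: ler_wpM2r.
exists r => //; split.
- by move=> x /Hr [? [[? _] [? _]]].
- move=> x y ax ay; have := lip x y ax ay.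
  have : `|x - y| <= `|phi x - phi y| + `|h x - h y|.
    have -> : x - y = (phi x - phi y) + (h x - h y).
      by rewrite /phi; apply/rowP => i; rewrite !mxE; lra.
    exact: ler_normD.
  by move=> *; lra.
move=> y hy.
pose U : set 'rV[R]_n := closed_ball_ Num.Def.normr a (r / 2).
have Ua x : U x -> ball a r x.
  rewrite /U /closed_ball_ /= -ball_normE /= => /le_lt_trans; apply.
  by rewrite ltr_pdivrMr // ltr_pMr // ltr1n.
have aa : ball a r a by exact: ballxx.
pose T x := y + phi x.
have TU : {homo T : x / U x >-> U x}.
  move=> x Ux; rewrite /U /closed_ball_ /= /T.
  have -> : a - (y + phi x) = (h a - y) + (phi a - phi x).
    by rewrite /phi; apply/rowP => i; rewrite !mxE; lra.
  rewrite (le_trans (ler_normD _ _)) //.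
  move: hy; rewrite -ball_normE /= => hy.
  have := lip a x aa (Ua x Ux); move: Ux; rewrite /U /closed_ball_ /= => Ux L.
  by lra.
have cU : compact U.
  apply: bounded_closed_compact; last exact: closed_closed_ball_.
  exists (`|a| + r); split=> [|M rM x Ux]; first exact: num_real. apply: le_trans (ltW rM).
  have := Ua x Ux; rewrite -ball_normE /= => ax.
  rewrite -[x](subKr a) (le_trans (ler_normB _ _)) // lerD2l.
  exact: ltW.
have Ua' : U a by rewrite /U /closed_ball_ /= subrr normr0 divr_ge0 // ltW.
have sN : {within U, continuous (fun x => `|h x - y|)}.
  apply: continuous_in_subspaceT => x; rewrite inE => Ux.
  have [_ [[shx _] _]] := Hr x (Ua x Ux).
  apply: (@continuous_comp _ _ _ (fun x => h x - y) (fun v => `|v|)).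
    apply: smooth_at_continuous; apply: smooth_atB => //; exact: smooth_at_cst.
  exact: norm_continuous.
have [x0 + x0min] := EVT_min_rV (ex_intro _ a Ua') cU sN.
rewrite inE => Ux0; exists x0; first exact: Ua.
(* a minimizer of the distance to y which is not a solution is improved by
   the contraction *)
apply: contrapT => hx0; have p0 : 0 < `|h x0 - y|.
  by rewrite normr_gt0 subr_eq0; apply/eqP.
have UT := TU x0 Ux0; have := x0min (T x0); rewrite inE => /(_ UT).
have -> : h (T x0) - y = phi x0 - phi (T x0).
  have -> : h (T x0) = T x0 - phi (T x0) by rewrite /phi subKr.
  by rewrite [in LHS]/T; apply/rowP => i; rewrite !mxE; lra.
move=> le1; have := lip x0 (T x0) (Ua _ Ux0) (Ua _ UT).
have -> : x0 - T x0 = h x0 - y.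
  by rewrite /T /phi; apply/rowP => i; rewrite !mxE; lra.
move=> le2; lra.
Qed.

(** Apply the expansion of h at g y to g z - g y: its error is o(g z - g y),
    hence o(z - y) by the Lipschitz bound, and multiplication by the inverse
    Jacobian preserves this. *)
Lemma differentiable_inverse h (g : 'rV[R]_n -> 'rV[R]_n) y (c : R) :
  differentiable h (g y) -> jacobian h (g y) \in unitmx ->
  (\forall z \near y, h (g z) = z) ->
  (\forall z \near y, `|g z - g y| <= c * `|z - y|) ->
  is_diff y g (mulmxr (invmx (jacobian h (g y)))).
Proof.
move=> dh uJ hg lip.
set K := invmx _.
have [k0 [k0p kP]] : exists k : R, 0 < k /\ forall v : 'rV[R]_n, `|v *m K| <= k * `|v|.
  have [|k kp kP] := @linear_lipschitz R _ _ (mulmxr K : {linear 'rV[R]_n -> 'rV[R]_n}).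
    move=> x; apply: smooth_at_continuous; apply: smooth_at_mulmx; last exact: smooth_at_cst.
    exact: smooth_at_id.
  by exists k.
have cK : continuous (mulmxr K : 'rV[R]_n -> 'rV[R]_n).
  move=> x; apply: smooth_at_continuous; apply: smooth_at_mulmx; last exact: smooth_at_cst.
  exact: smooth_at_id.
have c1 : exists2 c1 : R, 0 < c1 & \forall z \near y, `|g z - g y| <= c1 * `|z - y|.
  exists (`|c| + 1); first by rewrite ltr_wpDl.
  apply: filterS lip => z /le_trans; apply; apply: ler_wpM2r => //.
  by rewrite (le_trans (ler_norm c)) // lerDl.
case: c1 => {lip}c c0 lip.
pose V : normedModType R := 'rV[R]_n.
pose L : {linear V -> V} := mulmxr K.
suff E : (g : V -> V) \o shift (y : V) = cst (g y : V) + L +o_ (0 : V) id.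
  have D := @diff_unique _ _ _ (g : V -> V) L y cK E.
  apply: DiffDef; last exact: D.
  by apply/diff_locallyP; rewrite D; split => //; exact: E.
apply/eqaddoP => e e0.
have /diff_locallyP [_ /eqaddoP hE] := dh.
have e1 : 0 < e / (k0 * c) by rewrite divr_gt0 // mulr_gt0.
have {}hE := hE _ e1.
have lip0 : \forall v \near (0 : 'rV[R]_n), `|g (v + y) - g y| <= c * `|v|.
  move: lip; rewrite (near_shift 0) /= subr0.
  by apply: filterS => v /=; rewrite addrK.
have gc0 : (g (v + y) - g y) @[v --> (0 : 'rV[R]_n)] --> (0 : 'rV[R]_n).
  apply/(@cvgrPdist_lt _ _ _ (nbhs (0 : 'rV[R]_n)) (nbhs_filter _)) => e' e'0.
  have H : nbhs (0 : 'rV[R]_n) (ball (0 : 'rV[R]_n) (c^-1 * e')).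
    by apply: nbhsx_ballx; rewrite mulr_gt0 // invr_gt0.
  apply: filterS (filterI lip0 H) => z [l]; rewrite -ball_normE /= => b.
  by rewrite sub0r normrN (le_lt_trans l) // -ltr_pdivlMl // -[`|z|]normrN -sub0r.
have {}hE : \forall v \near (0 : 'rV[R]_n),
    `|h (g (v + y)) - (h (g y) + 'd h (g y) (g (v + y) - g y))|
      <= e / (k0 * c) * `|g (v + y) - g y|.
  apply: (@filterS _ (nbhs (0 : 'rV[R]_n)) _ _ _ _ (gc0 _ hE)) => v.
  by rewrite /= -[X in `|X|]/(h (g (v + y) - g y + g y) - (h (g y) + _)) subrK.
have hg0 : \forall v \near (0 : 'rV[R]_n), h (g (v + y)) = v + y.
  by move: hg; rewrite (near_shift 0) /= subr0.
near=> v.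
have hEv : `|h (g (v + y)) - (h (g y) + 'd h (g y) (g (v + y) - g y))|
    <= e / (k0 * c) * `|g (v + y) - g y| by apply: (near hE v).
have hgy : h (g y) = y by have := nbhs_singleton hg.
rewrite (near hg0 v) // hgy in hEv.
have dhE w : 'd h (g y) w = w *m jacobian h (g y) by rewrite /jacobian mul_rV_lin1.
rewrite -[X in `|X|]/(g (v + y) - (g y + v *m K)).
have -> : g (v + y) - (g y + v *m K) =
   - ((v + y - (y + 'd h (g y) (g (v + y) - g y))) *m K).
  have aux (p q s : 'rV[R]_n) : p + q - (q + s) = p - s by rewrite opprD addrA addrK.
  by rewrite dhE aux mulmxBl -mulmxA mulmxV // mulmx1 opprB opprD addrA.
rewrite normrN (le_trans (kP _)) //.
rewrite (le_trans (ler_wpM2l (ltW k0p) hEv)) //.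
rewrite (le_trans (ler_wpM2l (ltW k0p) (ler_wpM2l (ltW e1) (near lip0 v _)))) //.
rewrite le_eqVlt; apply/orP; left; apply/eqP.
by field; rewrite !gt_eqF.
Unshelve. all: by end_near. Qed.

End InverseFunction.

Definition local_diffeo {R : realType} {n m : nat} (f : 'rV[R]_n -> 'rV[R]_m)
    (g : 'rV[R]_m -> 'rV[R]_n) (U : set 'rV[R]_n) : Prop :=
  [/\ open U, open (f @` U), forall x, U x -> g (f x) = x,
      forall x, U x -> smooth_at f x &
      forall y, (f @` U) y -> smooth_at g y].

Section LocalInverse.
Context {R : realType} {n : nat}.
Implicit Types (f h g : 'rV[R]_n -> 'rV[R]_n) (a x y v : 'rV[R]_n).

(** Bootstrap: the derivative of g is the inverse Jacobian of h composed with
    g, which is of class C^k as soon as g is. *)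
Lemma smooth_inverse h g (U V : set 'rV[R]_n) : open V ->
  (forall y, V y -> [/\ U (g y), smooth_at h (g y) & jacobian h (g y) \in unitmx]) ->
  (forall y, V y -> is_diff y g (mulmxr (invmx (jacobian h (g y))))) ->
  smooth_on V g.
Proof.
move=> oV hU dg; elim=> [|k IH].
  by move=> y /dg dgy; apply: differentiable_continuous; exact: ex_diff.
split=> [y /dg dgy|v]; first exact: ex_diff.
apply: (C_on_eq _ _ _ (fun y => v *m invmx (jacobian h (g y)))) => //.
  by move=> y Vy; have dgy := dg y Vy; rewrite deriveE ?diff_val //; exact: ex_diff.
pose Q := [set x | smooth_at h x].
have oQ : open Q by rewrite openE => x /smooth_at_near.
apply: C_on_mulmx => //; first exact: C_on_cst.
apply: C_on_invmx => //; first by move=> y /hU [].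
apply: (C_on_comp _ _ _ _ Q _ (jacobian h) g) => //; first by move=> y /hU [].
suff : smooth_on Q (jacobian h) by apply.
by apply/smooth_onP => // x; exact: smooth_at_jacobian.
Qed.

Lemma tangent_to_identity_diffeo h a (P : set 'rV[R]_n) : smooth_at h a ->
  (forall v, 'd h a v = v) -> nbhs a P ->
  exists U g, [/\ local_diffeo h g U, U a & U `<=` P].
Proof.
move=> sh dh nP.
have [r r0 [Hr inj surj]] := tangent_to_identity h a P sh dh nP.
pose V : set 'rV[R]_n := ball (h a) (r / 4).
pose U : set 'rV[R]_n := [set x | ball a r x /\ V (h x)].
have r40 : 0 < r / 4 by rewrite divr_gt0.
have oV : open V by exact: ball_open.
have oU : open U.
  rewrite openE => x [ax Vx]; apply: (@filterI _ (nbhs x)).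
    by apply: open_nbhs_nbhs; split=> //; exact: ball_open.
  by have [_ shx _] := Hr x ax; exact: smooth_at_near_set shx oV Vx.
have hUV : h @` U = V.
  apply/seteqP; split=> [_ [x [ax Vx] <-] //|y Vy].
  by have [x ax hx] := surj y Vy; exists x => //; split=> //; rewrite hx.
pose g y := xget a [set x | U x /\ h x = y].
have gP y : V y -> U (g y) /\ h (g y) = y.
  by rewrite -hUV => -[x Ux hx]; exact: (@xgetPex _ a [set x | U x /\ h x = y] (ex_intro _ x (conj Ux hx))).
have gK x : U x -> g (h x) = x.
  move=> Ux; have [ax Vx] := Ux; have [[agx _] E] := gP _ Vx.
  have := inj _ _ agx ax; rewrite E subrr normr0 mulr0 normr_le0 subr_eq0.
  by move/eqP.
have lip y z : V y -> V z -> `|g y - g z| <= 2 * `|y - z|.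
  move=> Vy Vz; have [[ay _] Ey] := gP _ Vy; have [[az _] Ez] := gP _ Vz.
  by have := inj _ _ ay az; rewrite Ey Ez.
have sg : smooth_on V g.
  apply: (smooth_inverse h g U) => // y Vy; have [[ay Vhy] Ey] := gP _ Vy.
    by have [_ shy uy] := Hr _ ay; split.
  have [_ shy uy] := Hr _ ay.
  have nV : nbhs y V by apply: open_nbhs_nbhs; split.
  apply: (differentiable_inverse h g y 2) => //.
  - exact: smooth_at_differentiable.
  - by apply: filterS nV => z /gP [].
  - by apply: filterS nV => z Vz; exact: lip.
exists U, g; split.
- split=> //; first by rewrite hUV.
    by move=> x [/Hr [_ shx _] _].
  by rewrite hUV => y Vy; exists V => //; split.
- by split; exact: ballxx.
by move=> x [/Hr [Px _ _] _].
Qed.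

(** After composition with the inverse of its Jacobian, f is tangent to the
    identity at a. *)
Theorem inverse_function f a (P : set 'rV[R]_n) : smooth_at f a ->
  (forall v, 'd f a v = 0 -> v = 0) -> nbhs a P ->
  exists U g, [/\ local_diffeo f g U, U a & U `<=` P].
Proof.
move=> sf df nP; have dfa := smooth_at_differentiable _ _ _ sf.
have dfE v : 'd f a v = v *m jacobian f a by rewrite /jacobian mul_rV_lin1.
have uJ : jacobian f a \in unitmx.
  rewrite -row_free_unit -kermx_eq0; apply/eqP/row_matrixP => i.
  rewrite row0; apply: df; rewrite dfE; apply/eqP.
  by rewrite -sub_kermx row_sub.
pose B := invmx (jacobian f a).
pose L : 'rV[R]_n -> 'rV[R]_n := mulmxr B.
have sL x : smooth_at L x.
  by apply: smooth_at_mulmx; [exact: smooth_at_id|exact: smooth_at_cst].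
have cL : continuous L by move=> x; exact: smooth_at_continuous.
pose W : normedModType R := 'rV[R]_n.
pose L' : {linear W -> W} := mulmxr B.
have dL : 'd (L : W -> W) (f a : W) = L :> (W -> W) by exact: (@diff_lin R W W L' (f a) cL).
pose h := L \o f.
have sh : smooth_at h a by exact: smooth_at_comp.
have dh v : 'd h a v = v.
  have dLa : differentiable (L : W -> W) (f a) by exact: smooth_at_differentiable.
  have E := congr1 (fun F => F v) (@diff_comp R W W W f L a dfa dLa).
  apply: (etrans E); apply: (etrans (congr1 (fun F => F ('d f a v)) dL)).
  by rewrite /L /= dfE -mulmxA mulmxV // mulmx1.
have [U [g [[oU ohU gK shU sg] Ua UP]]] := tangent_to_identity_diffeo h a P sh dh nP.
have LK y : L y *m jacobian f a = y by rewrite /L /= mulmxKV.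
have fE x : f x = h x *m jacobian f a by rewrite /h /= LK.
have hfU : f @` U = L @^-1` (h @` U).
  apply/seteqP; split=> [_ [x Ux <-]|y [x Ux hx]]; first by exists x.
  by exists x => //; rewrite fE hx LK.
exists U, (g \o L); split=> //; split=> //.
- by rewrite hfU; apply: open_comp => // x _; exact: cL.
- move=> x /shU sx; apply: (smooth_at_ext _ (fun x => h x *m jacobian f a)).
    by move=> z; rewrite [RHS]fE.
  by apply: smooth_at_mulmx => //; exact: smooth_at_cst.
- by rewrite hfU => y Uy; apply: smooth_at_comp => //; exact: sg.
Qed.

End LocalInverse.

(** * Plots, submanifolds and products *)

Set Implicit Arguments.
Unset Strict Implicit.

Lemma near_smooth_open {R : realType} {V W : normedModType R} (f : V -> W) (x : V)
    (P : set V) : smooth_at f x -> nbhs x P ->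
  exists Q, [/\ open Q, Q x, Q `<=` P & smooth_on Q f].
Proof.
move=> [Q [oQ Qx] sf] nP; have : nbhs x (Q `&` P).
  by apply: filterI => //; exact: open_nbhs_nbhs.
rewrite nbhsE => -[U [oU Ux] sU]; exists U; split=> //; first by move=> y /sU [].
by move=> k; apply: C_on_subset (sf k) => y /sU [].
Qed.

(** The part of the structure of a smooth manifold on which smoothness of maps
    depends.  It passes to submanifolds and products. *)
Definition compatible_atlas {R : realType} {T : Type} (A : atlas R T) : Prop :=
  (forall c, A c -> chart_valid c) /\
  (forall c1 c2, A c1 -> A c2 -> compatible c1 c2).

(** Smoothness near v in some chart; by [plot_chart] it then holds in every chart
    around f v. *)
Definition plot_at {R : realType} {T : Type} (A : atlas R T) {k : nat}
    (f : 'rV[R]_k -> T) (v : 'rV[R]_k) : Prop :=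
  exists c, [/\ A c, \forall w \near v, cdom c (f w) & smooth_at (cfun c \o f) v].

Section Plots.
Context {R : realType} {T : Type}.
Implicit Types (A : atlas R T) (c : chart R T) (S W : set T).

Lemma chart_image_near c x : chart_valid c -> cdom c x ->
  \forall w \near cfun c x, cdom c (cinv c w) /\ cfun c (cinv c w) = w.
Proof.
move=> [oc cK] cx; apply: (@filterS _ _ _ (cfun c @` cdom c)).
  by move=> _ [y cy <-]; rewrite cK.
by apply: open_nbhs_nbhs; split=> //; exists x.
Qed.

Lemma plot_eq A k (f g : 'rV[R]_k -> T) v :
  (\forall w \near v, f w = g w) -> plot_at A f v -> plot_at A g v.
Proof.
move=> fg [c [Ac nf sf]]; exists c; split=> //.
  by apply: filterS (filterI fg nf) => w [->].
by apply: smooth_at_eq sf; apply: filterS fg => w /= ->.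
Qed.

Lemma plot_ext A k (f g : 'rV[R]_k -> T) v :
  f =1 g -> plot_at A f v -> plot_at A g v.
Proof. by move=> fg; have -> : g = f by apply/funext => w; rewrite fg. Qed.

Lemma plot_comp A k l (f : 'rV[R]_k -> T) (h : 'rV[R]_l -> 'rV[R]_k) v :
  smooth_at h v -> plot_at A f (h v) -> plot_at A (f \o h) v.
Proof.
move=> sh [c [Ac nf sf]]; exists c; split=> //.
  exact: (smooth_at_continuous _ _ _ sh _ nf).
exact: (smooth_at_comp _ _ _ (cfun c \o f) h).
Qed.

Lemma plot_pts A k (f : 'rV[R]_k -> T) v : plot_at A f v -> pts A (f v).
Proof. by move=> [c [Ac nf _]]; exists c => //; exact: nbhs_singleton nf. Qed.

(** Smoothness of the transition map near each point also gives the openness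
    of the overlap. *)
Lemma compatible_intro c1 c2 : chart_valid c1 ->
  (forall x, cdom c1 x -> cdom c2 x ->
     (\forall w \near cfun c1 x, cdom c2 (cinv c1 w)) /\
     smooth_at (cfun c2 \o cinv c1) (cfun c1 x)) ->
  compatible c1 c2.
Proof.
move=> v1 H; have oI : open (cfun c1 @` (cdom c1 `&` cdom c2)).
  rewrite openE => _ [x [x1 x2] <-]; have [n2 _] := H x x1 x2.
  apply: filterS (filterI (chart_image_near v1 x1) n2) => w [[w1 wE] w2].
  by exists (cinv c1 w).
split=> //; apply/smooth_onP => // _ [x [x1 x2] <-].
by have [] := H x x1 x2.
Qed.

Lemma atlas_max A c : compatible_atlas A -> A c -> max_atlas A c.
Proof.
move=> [vA cA] Ac; split; first exact: vA; first by move=> x cx; exists c.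
by move=> c' Ac'; split; exact: cA.
Qed.

(** The charts of A are compatible with c, so that smoothness of a plot can be
    tested in any chart of the maximal atlas. *)
Lemma plot_chart A k (f : 'rV[R]_k -> T) v c : compatible_atlas A -> plot_at A f v ->
  max_atlas A c -> cdom c (f v) ->
  (\forall w \near v, cdom c (f w)) /\ smooth_at (cfun c \o f) v.
Proof.
move=> gA [c' [Ac' nd s]] [vc _ /(_ c' Ac') [_ [oI sI]]] cv.
have vc' := gA.1 _ Ac'; have c'v : cdom c' (f v) := nbhs_singleton nd.
have Iv : (cfun c' @` (cdom c' `&` cdom c)) ((cfun c' \o f) v) by exists (f v).
have nI := smooth_at_near_set _ _ _ _ s oI Iv.
split.
  apply: filterS (filterI nd nI) => w [c'w [y [c'y cy]]].
  by move=> /(congr1 (cinv c')) /=; rewrite !vc'.2 // => <-.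
apply: (@smooth_at_eq _ _ _ ((cfun c \o cinv c') \o (cfun c' \o f))).
  by apply: filterS nd => w c'w /=; rewrite vc'.2.
apply: smooth_at_comp => //.
by have /smooth_onP := sI; apply.
Qed.

(** The parametrization of a chart is a plot, which turns statements about
    plots into statements about charts. *)
Lemma chart_plot A c x : compatible_atlas A -> max_atlas A c -> cdom c x ->
  plot_at A (cinv c) (cfun c x).
Proof.
move=> gA [vc cA cc] cx; have [c' Ac' c'x] := cA x cx.
have [[oI sI] _] := cc c' Ac'.
have Ix : (cfun c @` (cdom c `&` cdom c')) (cfun c x) by exists x.
exists c'; split=> //; last by have /smooth_onP := sI; apply.
apply: (@filterS _ _ _ (cfun c @` (cdom c `&` cdom c'))); last exact: open_nbhs_nbhs.
by move=> _ [y [cy c'y] <-]; rewrite vc.2.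
Qed.

(** Compatibility with the charts of A follows from [chart_plot] and
    [plot_chart] applied to these charts. *)
Lemma max_intro A c : compatible_atlas A -> chart_valid c -> cdom c `<=` pts A ->
  (forall x, cdom c x -> plot_at A (cinv c) (cfun c x)) ->
  (forall k (f : 'rV[R]_k -> T) v, plot_at A f v -> cdom c (f v) ->
     (\forall w \near v, cdom c (f w)) /\ smooth_at (cfun c \o f) v) ->
  max_atlas A c.
Proof.
move=> gA vc cA pc cp; split=> // c' Ac'; have mc' := atlas_max gA Ac'.
split; apply: compatible_intro => //.
- by move=> x cx c'x; apply: (plot_chart gA (pc x cx) mc'); rewrite vc.2.
- by have [] := mc'.
- move=> x c'x cx; have [vc' _ _] := mc'; apply: cp; first exact: chart_plot.
  by rewrite vc'.2.
Qed.

(** Together with [plot_open]: the topology of the manifold is the finest one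
    making all plots continuous. *)
Lemma open_plot A W k (f : 'rV[R]_k -> T) v : compatible_atlas A -> atlas_open A W ->
  plot_at A f v -> W (f v) -> \forall w \near v, W (f w).
Proof.
move=> gA [WA oW] [c [Ac nf sf]] Wv; have vc := gA.1 _ Ac.
have Iv : (cfun c @` (W `&` cdom c)) ((cfun c \o f) v).
  by exists (f v) => //; split=> //; exact: nbhs_singleton nf.
apply: filterS (filterI nf (smooth_at_near_set _ _ _ _ sf (oW _ Ac) Iv)).
move=> w [cw [y [Wy cy]]] /(congr1 (cinv c)) /=.
by rewrite !vc.2 // => <-.
Qed.

Lemma plot_open A W : compatible_atlas A -> W `<=` pts A ->
  (forall k (f : 'rV[R]_k -> T) v, plot_at A f v -> W (f v) ->
     \forall w \near v, W (f w)) -> atlas_open A W.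
Proof.
move=> gA WA H; split=> // c Ac; rewrite openE => _ [x [Wx cx] <-].
have vc := gA.1 _ Ac.
have nW : \forall w \near cfun c x, W (cinv c w).
  by apply: H; [exact: chart_plot (atlas_max gA Ac) cx|rewrite vc.2].
apply: filterS (filterI (chart_image_near vc cx) nW) => w [[cw wE] Ww].
by exists (cinv c w).
Qed.

Lemma max_chart_open A c : compatible_atlas A -> max_atlas A c -> atlas_open A (cdom c).
Proof.
move=> gA mc; have [_ cA _] := mc; apply: plot_open => // k f v pf cv.
by have [] := plot_chart gA pf mc cv.
Qed.

Lemma atlas_openI A W W' : compatible_atlas A -> atlas_open A W -> atlas_open A W' ->
  atlas_open A (W `&` W').
Proof.
move=> gA oW oW'; apply: plot_open => //; first by move=> x [/(oW.1)].
by move=> k f v pf [Wv W'v]; apply: filterI; [exact: open_plot oW pf Wv|exact: open_plot oW' pf W'v].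
Qed.

(** A chart followed by a diffeomorphism between open sets of row spaces is a
    chart; all slice charts below are obtained in this way. *)
Lemma reparam_max A c q (F : 'rV[R]_(cdim c) -> 'rV[R]_q) G Q :
  compatible_atlas A -> max_atlas A c -> Q `<=` cfun c @` cdom c -> local_diffeo F G Q ->
  max_atlas A (Chart [set x | cdom c x /\ Q (cfun c x)] (F \o cfun c) (cinv c \o G)).
Proof.
move=> gA mc Qc [oQ oFQ GF sF sG]; have [vc cA _] := mc.
apply: max_intro => //=.
- split=> /=; last by move=> x [cx Qx]; rewrite GF // vc.2.
  suff -> : (F \o cfun c) @` [set x | cdom c x /\ Q (cfun c x)] = F @` Q by [].
  apply/seteqP; split=> [_ [x [cx Qx] <-]|_ [w Qw <-]]; first by exists (cfun c x).
  by have [x cx xw] := Qc w Qw; exists x; rewrite /= ?xw.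
- by move=> x [/cA].
- move=> x [cx Qx]; apply: plot_comp; first by apply: sG; exists (cfun c x).
  by rewrite GF //; exact: chart_plot.
- move=> k f v pf [cv Qv]; have [nc sc] := plot_chart gA pf mc cv.
  split; last by apply: smooth_at_comp => //; exact: sF.
  by apply: filterI => //; exact: (smooth_at_near_set _ _ _ _ sc).
Qed.

End Plots.

Section SmoothMapsPlots.
Context {R : realType} {T1 T2 : Type}.
Implicit Types (S : set T1) (F : T1 -> T2).

Lemma smooth_map_plot S (A1 : atlas R T1) (A2 : atlas R T2) F k (f : 'rV[R]_k -> T1) v :
  compatible_atlas A1 ->
  smooth_map S A1 A2 F -> plot_at A1 f v -> S (f v) -> plot_at A2 (F \o f) v.
Proof.
move=> gA sF pf Sv; have [c1 [c2 [Q [[A1c c1v] [A2c c2v] [oQ Qv QI] Qc2 sQ]]]] := sF _ Sv.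
have [n1 s1] := plot_chart gA pf (atlas_max gA A1c) c1v.
have vc1 := gA.1 _ A1c.
have nQ := smooth_at_near_set _ _ _ _ s1 oQ Qv.
exists c2; split=> //.
  by apply: filterS (filterI n1 nQ) => w [c1w /= /Qc2]; rewrite vc1.2.
apply: (@smooth_at_eq _ _ _ ((in_charts c1 c2 F) \o (cfun c1 \o f))).
  by apply: filterS n1 => w c1w; rewrite /in_charts /= vc1.2.
by apply: smooth_at_comp => //; have /smooth_onP := sQ; apply.
Qed.

Lemma smooth_map_intro S (A1 : atlas R T1) (A2 : atlas R T2) F :
  compatible_atlas A1 -> S `<=` pts A1 ->
  (forall k (f : 'rV[R]_k -> T1) v, plot_at A1 f v -> S (f v) ->
     plot_at A2 (F \o f) v) ->
  smooth_map S A1 A2 F.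
Proof.
move=> gA SA H x Sx; have [c1 A1c c1x] := SA x Sx; have vc := gA.1 _ A1c.
have p1 := chart_plot gA (atlas_max gA A1c) c1x.
have [] := H _ _ _ p1; first by rewrite vc.2.
move=> c2 [A2c n2 s2].
have nI : nbhs (cfun c1 x) (cfun c1 @` cdom c1).
  by apply: open_nbhs_nbhs; split; [exact: vc.1|exists x].
have [Q [oQ Qx QP sQ]] := near_smooth_open s2 (filterI nI n2).
exists c1, c2, Q; split=> //; first split=> //.
- by have := nbhs_singleton n2; rewrite /= vc.2.
- by split=> // w /QP [].
- by move=> w /QP [].
Qed.

End SmoothMapsPlots.

Section Submanifolds.
Context {R : realType} {T : Type}.
Implicit Types (A : atlas R T) (S W : set T).

Lemma pts_sub_atlas A S : pts (sub_atlas A S) `<=` S.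
Proof. by move=> x [_ [k [l [U [f [g [_ _ ->]]]]]]] [/=]. Qed.

Lemma slice_row k l (w : 'rV[R]_(k + l)) : rsubmx w = 0 -> row_mx (lsubmx w) 0 = w.
Proof. by move=> <-; rewrite hsubmxK. Qed.

Lemma smooth_at_row0 k l (v : 'rV[R]_k) :
  smooth_at (fun u : 'rV[R]_k => row_mx u (0 : 'rV[R]_l)) v.
Proof. by apply: smooth_at_row_mx; [exact: smooth_at_id|exact: smooth_at_cst]. Qed.

(** In a slice chart a point of S is recovered from its first coordinates by
    completing them with zeros. *)
Lemma sub_plot A S k (f : 'rV[R]_k -> T) v : compatible_atlas A ->
  plot_at (sub_atlas A S) f v -> plot_at A f v /\ \forall w \near v, S (f w).
Proof.
move=> gA [_ [[p [q [U [h [g [mc slice ->]]]]]] /= nc sc]].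
have [vc _ _] := mc; have [Uv Sv] := nbhs_singleton nc.
split; last by apply: filterS nc => w [].
have E w : U (f w) -> S (f w) -> g (row_mx (lsubmx (h (f w))) 0) = f w.
  by move=> Uw /(slice _ Uw) hw; rewrite slice_row //; exact: vc.2.
apply: (@plot_eq _ _ _ _ ((fun u => g (row_mx u 0)) \o (fun w => lsubmx (h (f w))))).
  by apply: filterS nc => w [Uw Sw]; exact: E.
apply: plot_comp; first exact: sc.
apply: (plot_comp (f := g)); first exact: smooth_at_row0.
rewrite slice_row; last exact/slice.
exact: (chart_plot gA mc Uv).
Qed.

(** In a slice chart, forget the last coordinates of the plot. *)
Lemma plot_sub A S k (f : 'rV[R]_k -> T) v : compatible_atlas A -> plot_at A f v ->
  (\forall w \near v, S (f w)) -> pts (sub_atlas A S) (f v) ->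
  plot_at (sub_atlas A S) f v.
Proof.
move=> gA pf nS [c sc cv]; exists c.
case: (sc) cv => p [q [U [h [g [mc slice -> /= [Uv Sv]]]]]].
have [nU sh] := plot_chart gA pf mc Uv.
split; last exact: smooth_at_lsubmx.
- by exists p, q, U, h, g.
- exact: filterI.
Qed.

Lemma sub_compatible A S : compatible_atlas A -> compatible_atlas (sub_atlas A S).
Proof.
move=> gA; have vS c : sub_atlas A S c -> chart_valid c.
  move=> [p [q [U [h [g [mc slice ->]]]]]]; have [[oI gh] _ _] := mc; split=> /=.
    have -> : (fun x => lsubmx (h x)) @` (U `&` S) =
        (fun u => row_mx u 0) @^-1` (h @` U).
      apply/seteqP; split=> [_ [x [Ux Sx] <-]|u [x Ux hx]].
        by exists x => //; rewrite slice_row //; exact/slice.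
      exists x; last by rewrite hx row_mxKl.
      by split=> //; apply/slice; rewrite // hx row_mxKr.
    apply: open_comp => // u _; exact/smooth_at_continuous/smooth_at_row0.
  move=> x [Ux Sx]; rewrite slice_row; first exact: gh.
  exact/slice.
split=> // c1 c2 s1 s2; apply: compatible_intro; first exact: vS.
move=> x x1 x2; have v1 := vS _ s1.
have nS := chart_image_near v1 x1.
case: s2 x2 => p2 [q2 [U2 [h2 [g2 [mc2 slice2 -> /= [U2x Sx]]]]]].
have pl : plot_at A (cinv c1) (cfun c1 x).
  case: s1 x1 v1 {nS} => p [q [U [h [g [mc slice -> /= [Ux _]]]]]] v1.
  apply: (plot_comp (f := g)); first exact: smooth_at_row0.
  rewrite slice_row; last exact/slice.
  exact: (chart_plot gA mc Ux).
have c1K : cinv c1 (cfun c1 x) = x by exact: v1.2.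
have [|n2 sh2] := plot_chart gA pl mc2; first by rewrite /= c1K.
split; last exact: smooth_at_lsubmx.
apply: filterI => //; apply: filterS nS => w [cw _].
by apply: (@pts_sub_atlas A S); exists c1.
Qed.

Lemma slice_intro A S c k l (F : 'rV[R]_(cdim c) -> 'rV[R]_(k + l)) G Q :
  compatible_atlas A -> max_atlas A c -> Q `<=` cfun c @` cdom c -> local_diffeo F G Q ->
  (forall y, cdom c y -> Q (cfun c y) -> (S y <-> rsubmx (F (cfun c y)) = 0)) ->
  sub_atlas A S (Chart ([set y | cdom c y /\ Q (cfun c y)] `&` S)
    (fun y => lsubmx (F (cfun c y))) (fun u => cinv c (G (row_mx u 0)))).
Proof.
move=> gA mc Qc FG sl.
exists k, l, [set y | cdom c y /\ Q (cfun c y)], (F \o cfun c), (cinv c \o G).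
by split=> //; [exact: reparam_max|move=> y [cy Qy]; exact: sl].
Qed.

Lemma sub_open1 A S W : compatible_atlas A -> S `<=` pts (sub_atlas A S) -> atlas_open A W ->
  atlas_open (sub_atlas A S) (W `&` S).
Proof.
move=> gA SS oW; apply: plot_open; first exact: sub_compatible.
  by move=> x [_ /SS].
move=> k f v pf [Wv Sv]; have [pA nS] := sub_plot gA pf.
by apply: filterI => //; exact: open_plot pA Wv.
Qed.

(** The topology of the submanifold is induced: in a slice chart, an open set of
    first coordinates is extended by all values of the last ones. *)
Lemma sub_open2 A S W x : compatible_atlas A -> atlas_open (sub_atlas A S) W -> W x ->
  exists W', [/\ atlas_open A W', W' x & W' `&` S `<=` W].
Proof.
move=> gA [WS oW] Wx; have [c sc cx] := WS x Wx; have := oW c sc.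
have vc := (sub_compatible S gA).1 _ sc.
case: sc cx vc => p [q [U [h [g [mc slice -> /= [Ux Sx]]]]]] vc oI.
pose W' := [set y | U y /\ ((fun y => lsubmx (h y)) @` (W `&` (U `&` S))) (lsubmx (h y))].
exists W'; split.
- have [_ UA _] := mc; apply: plot_open => //; first by move=> y [/UA].
  move=> k f v pf [Uv Iv]; have [nU sh] := plot_chart gA pf mc Uv.
  apply: filterI => //.
  exact: (smooth_at_near_set _ _ _ _ (smooth_at_lsubmx _ _ _ _ _ sh) oI).
- by split=> //; exists x.
- move=> y [[Uy [z [Wz [Uz Sz]] /= zy]] Sy].
  have := congr1 (fun u => g (row_mx u 0)) zy.
  have := vc.2 z (conj Uz Sz); rewrite /= => ->.
  by have := vc.2 y (conj Uy Sy); rewrite /= => -> <-.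
Qed.

Lemma smooth_manifold_compatible M A : smooth_manifold M A -> compatible_atlas A.
Proof. by move=> [_ vA cA _ _]. Qed.

(** Charts of S are compatible by [sub_compatible]; the Hausdorff property
    and a countable basis are inherited because the topology is induced. *)
Lemma sub_manifold M A S : smooth_manifold M A -> S `<=` pts (sub_atlas A S) ->
  smooth_manifold S (sub_atlas A S).
Proof.
move=> mA SS; have gA := smooth_manifold_compatible mA; have [pA _ _ hA [B cB [oB bB]]] := mA.
have gS := sub_compatible S gA.
have SA : S `<=` pts A.
  move=> x /SS [c [p [q [U [h [g [[_ UA _] slice ->]]]]]] [/UA ? _]] //.
split; [|exact: gS.1|exact: gS.2| |].
- by apply/seteqP; split=> //; exact: pts_sub_atlas.
- move=> x y /pts_sub_atlas Sx /pts_sub_atlas Sy xy.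
  have [W1 [W2 [op1 op2 W1x W2y W12]]] := hA x y (SA x Sx) (SA y Sy) xy.
  exists (W1 `&` S), (W2 `&` S); split=> //; try exact: sub_open1.
  by apply/seteqP; split=> // z [[W1z _] [W2z _]]; rewrite -W12.
- exists [set W `&` S | W in B]; first exact: sub_countable (card_image_le _ _) cB.
  split=> [_ [W BW <-]|W x oW Wx]; first by apply: sub_open1 => //; exact: oB.
  have [W' [oW' W'x W'S]] := sub_open2 gA oW Wx.
  have [W'' BW'' [W''x sW]] := bB W' x oW' W'x.
  exists (W'' `&` S); first by exists W''.
  split; last by move=> y [/sW W'y Sy]; exact: W'S.
  by split=> //; apply: (@pts_sub_atlas A S); exact: oW.1.
Qed.

End Submanifolds.

Section Products.
Context {R : realType} {T1 T2 : Type}.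

Lemma plot_pair (A1 : atlas R T1) (A2 : atlas R T2) k (f : 'rV[R]_k -> T1 * T2) v :
  plot_at A1 (fun w => (f w).1) v -> plot_at A2 (fun w => (f w).2) v ->
  plot_at (prod_atlas A1 A2) f v.
Proof.
move=> [c1 [A1c n1 s1]] [c2 [A2c n2 s2]]; exists (prod_chart c1 c2); split.
- by exists c1, c2.
- by apply: filterS (filterI n1 n2).
- exact: smooth_at_row_mx.
Qed.

Lemma plot_fst (A1 : atlas R T1) (A2 : atlas R T2) k (f : 'rV[R]_k -> T1 * T2) v :
  plot_at (prod_atlas A1 A2) f v -> plot_at A1 (fun w => (f w).1) v.
Proof.
move=> [_ [[c1 [c2 [A1c A2c ->]]] n /= s]]; exists c1; split=> //.
  by apply: filterS n => w [].
by apply: smooth_at_ext (smooth_at_lsubmx _ _ _ _ _ s) => w /=; rewrite row_mxKl.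
Qed.

Lemma plot_snd (A1 : atlas R T1) (A2 : atlas R T2) k (f : 'rV[R]_k -> T1 * T2) v :
  plot_at (prod_atlas A1 A2) f v -> plot_at A2 (fun w => (f w).2) v.
Proof.
move=> [_ [[c1 [c2 [A1c A2c ->]]] n /= s]]; exists c2; split=> //.
  by apply: filterS n => w [].
by apply: smooth_at_ext (smooth_at_rsubmx _ _ _ _ _ s) => w /=; rewrite row_mxKr.
Qed.

Lemma prod_compatible (A1 : atlas R T1) (A2 : atlas R T2) :
  compatible_atlas A1 -> compatible_atlas A2 -> compatible_atlas (prod_atlas A1 A2).
Proof.
move=> g1 g2.
have vP c : prod_atlas A1 A2 c -> chart_valid c.
  move=> [c1 [c2 [A1c A2c ->]]]; have [[op1 k1] [op2 k2]] := (g1.1 _ A1c, g2.1 _ A2c).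
  split=> /=; last by move=> [x y] [/= cx cy]; rewrite row_mxKl row_mxKr k1 // k2.
  have -> : (fun p : T1 * T2 => row_mx (cfun c1 p.1) (cfun c2 p.2)) @`
      (cdom c1 `*` cdom c2) =
      (lsubmx @^-1` (cfun c1 @` cdom c1)) `&` (rsubmx @^-1` (cfun c2 @` cdom c2)).
    apply/seteqP; split=> [_ [[x y] [/= cx cy] <-]|w [[x cx xw] [y cy yw]]].
      by split; rewrite /= ?row_mxKl ?row_mxKr; [exists x|exists y].
    by exists (x, y) => //=; rewrite xw yw hsubmxK.
  by apply: openI; apply: open_comp => // w _;
    [exact: continuous_lsubmx|exact: continuous_rsubmx].
split=> // c c' Pc Pc'; apply: compatible_intro; first exact: vP.
move=> x cx c'x.
case: Pc' c'x => c1' [c2' [A1c' A2c' -> [/= c1'x c2'x]]].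
case: Pc cx (vP _ Pc) => c1 [c2 [A1c A2c -> [/= c1x c2x]]] v.
have p1 : plot_at A1 (cinv c1 \o lsubmx) (row_mx (cfun c1 x.1) (cfun c2 x.2)).
  apply: plot_comp; first by apply: smooth_at_lsubmx; exact: smooth_at_id.
  by rewrite row_mxKl; exact: chart_plot (atlas_max g1 A1c) c1x.
have p2 : plot_at A2 (cinv c2 \o rsubmx) (row_mx (cfun c1 x.1) (cfun c2 x.2)).
  apply: plot_comp; first by apply: smooth_at_rsubmx; exact: smooth_at_id.
  by rewrite row_mxKr; exact: chart_plot (atlas_max g2 A2c) c2x.
have [|n1 s1] := plot_chart g1 p1 (atlas_max g1 A1c').
  by rewrite /= row_mxKl (g1.1 _ A1c).2.
have [|n2 s2] := plot_chart g2 p2 (atlas_max g2 A2c').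
  by rewrite /= row_mxKr (g2.1 _ A2c).2.
split; first by apply: filterS (filterI n1 n2).
exact: smooth_at_row_mx.
Qed.

End Products.

(** * Total spaces of vector bundles *)

Section ChartTopology.
Context {R : realType} {T : Type}.
Implicit Types (A : atlas R T) (c : chart R T).

Lemma chart_preim_open A c (Q : set 'rV[R]_(cdim c)) : compatible_atlas A -> max_atlas A c ->
  open Q -> atlas_open A [set x | cdom c x /\ Q (cfun c x)].
Proof.
move=> gA mc oQ; have [_ cA _] := mc; apply: plot_open => //.
  by move=> x [/cA].
move=> k f v pf [cv Qv]; have [nc sc] := plot_chart gA pf mc cv.
by apply: filterI => //; exact: (smooth_at_near_set _ _ _ _ sc oQ Qv).
Qed.

Lemma separated_in_chart A c x y : compatible_atlas A -> max_atlas A c -> cdom c x -> cdom c y ->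
  x <> y -> exists W1 W2, [/\ atlas_open A W1, atlas_open A W2, W1 x, W2 y &
                    W1 `&` W2 = set0].
Proof.
move=> gA mc cx cy xy; have [vc _ _] := mc.
pose e := `|cfun c x - cfun c y| / 2.
have e0 : 0 < e.
  rewrite divr_gt0 // normr_gt0 subr_eq0; apply/eqP => /(congr1 (cinv c)).
  by rewrite !vc.2.
exists [set z | cdom c z /\ ball (cfun c x) e (cfun c z)].
exists [set z | cdom c z /\ ball (cfun c y) e (cfun c z)].
split; try (apply: chart_preim_open => //; exact: ball_open).
- by split=> //; exact: ballxx.
- by split=> //; exact: ballxx.
apply/seteqP; split=> // z [[_ +] [_ +]]; rewrite -!ball_normE /= => xz yz.
have : `|cfun c x - cfun c y| < e + e.
  rewrite -(subrKA (cfun c z)) (le_lt_trans (ler_normD _ _)) // ltrD //.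
  by rewrite distrC.
by rewrite /e -splitr ltxx.
Qed.

(** Density of the rational points, the source of countable bases. *)
Lemma rational_row_near n (v : 'rV[R]_n) (e : R) : 0 < e ->
  exists q : 'rV[rat]_n, ball (map_mx ratr q : 'rV[R]_n) e v.
Proof.
move=> e0.
have H i : exists q : rat, `|ratr q - v 0 i| < e.
  have [q] := rat_in_itvoo (ltr_pwDr e0 (lexx (v 0 i))).
  rewrite in_itv /= => /andP[q1 q2]; exists q.
  by rewrite ger0_norm ?subr_ge0 ?(ltW q1) // ltrBlDl.
have [q qP] := choice H; exists (\row_i q i); split=> // i j.
by rewrite !mxE (ord1 i) -ball_normE /=.
Qed.

(** The pullbacks of the balls with rational center and radius 1/(k+1) under
    countably many charts covering the manifold form a basis. *)
Lemma second_countable_charts A I (J : set I) (ch : I -> option (chart R T)) :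
  compatible_atlas A -> countable J -> (forall i c, J i -> ch i = Some c -> A c) ->
  (forall x, pts A x -> exists i c, [/\ J i, ch i = Some c & cdom c x]) ->
  atlas_second_countable A.
Proof.
move=> gA cJ chA cov.
pose bas (c : chart R T) (qk : 'rV[rat]_(cdim c) * nat) : set T :=
  [set x | cdom c x /\ ball (map_mx ratr qk.1 : 'rV[R]_(cdim c)) (qk.2.+1%:R^-1) (cfun c x)].
pose Fb i : set (set T) := if ch i is Some c then range (bas c) else set0.
exists (\bigcup_(i in J) Fb i).
  apply: bigcup_countable => // i _; rewrite /Fb; case: (ch i) => [c|]; last first.
    exact: countable0.
  apply: sub_countable (card_image_le _ _) _; exact: countableP.
split=> [W [i Ji]|W x [WA oW] Wx].
  rewrite /Fb; case E: (ch i) => [c|] // -[[q k] _ <-].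
  have mc := atlas_max gA (chA _ _ Ji E).
  by apply: chart_preim_open => //; exact: ball_open.
have [i [c [Ji Ec cx]]] := cov x (WA x Wx).
have vc := gA.1 _ (chA _ _ Ji Ec).
have := open_nbhs_nbhs (conj (oW c (chA _ _ Ji Ec)) (ex_intro2 _ _ x (conj Wx cx) erefl)).
move=> /nbhs_ballP [e /= e0 He].
have [k _ kP] : exists2 k : nat, True & 2 * k.+1%:R^-1 < e.
  exists (Num.truncn (2 / e)) => //.
  by rewrite ltr_pdivrMr ?ltr0n // mulrC -ltr_pdivrMr // truncnS_gt.
have k0 : 0 < (k.+1%:R^-1 : R) by rewrite invr_gt0 ltr0n.
have [q qP] := rational_row_near (cfun c x) k0.
exists (bas c (q, k)); first by exists i => //; rewrite /Fb Ec; exists (q, k).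
split=> // y [cy qy]; have [z [Wz cz] zy] : (cfun c @` (W `&` cdom c)) (cfun c y).
  apply: He; apply: le_ball (ltW kP) _ _; rewrite mulr_natl mulr2n.
  by apply: ball_triangle qy; exact: ball_sym.
by rewrite -(vc.2 y cy) -zy vc.2.
Qed.

End ChartTopology.

Section TotalSpace.
Context {R : realType} {B : choiceType} (D : atlas R B) (F : B -> Type).
Context (Phi : set (trivialization R F)).
Hypothesis hD : smooth_manifold [set: B] D.
Hypothesis hPhi : forall t, Phi t -> atlas_open D (tdom t) /\
  forall d, tdom t d -> cancel (tfun t d) (tinv t d) /\ cancel (tinv t d) (tfun t d).
Hypothesis hcov : forall d, exists2 t, Phi t & tdom t d.

Let gD : compatible_atlas D. Proof. exact: smooth_manifold_compatible hD. Qed.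

Lemma base_chart d : exists2 c, D c & cdom c d.
Proof. by have [pD _ _ _ _] := hD; have : pts D d by rewrite pD. Qed.

Lemma total_chart_valid c t : D c -> Phi t -> chart_valid (total_chart c t).
Proof.
move=> Dc Pt; have vc := gD.1 _ Dc; have [ot ct] := hPhi Pt; split=> /=.
  have -> : (fun u : {d : B & F d} => row_mx (cfun c (tag u)) (tfun t (tag u) (tagged u))) @`
      [set u | cdom c (tag u) /\ tdom t (tag u)] =
      lsubmx @^-1` (cfun c @` (tdom t `&` cdom c)).
    apply/seteqP; split=> [_ [u [cu tu] <-]|w [d [td cd] dw]].
      by exists (tag u) => //; rewrite row_mxKl.
    exists (existT _ d (tinv t d (rsubmx w))) => //=.
    by rewrite (ct d td).2 dw hsubmxK.
  by apply: open_comp; [move=> w _; exact: continuous_lsubmx|exact: ot.2].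
move=> [d a] /= [cd td]; rewrite row_mxKl row_mxKr vc.2 //.
by rewrite (ct d td).1.
Qed.

Lemma pts_total : pts (total_atlas D Phi) = setT.
Proof.
apply/seteqP; split=> // -[d a] _; have [c Dc cd] := base_chart d.
have [t Pt td] := hcov d.
by exists (total_chart c t); [exists c, t|].
Qed.

Lemma plot_tag k (u : 'rV[R]_k -> {d : B & F d}) v :
  plot_at (total_atlas D Phi) u v -> plot_at D (fun w => tag (u w)) v.
Proof.
move=> [_ [[c [t [Dc Pt ->]]] n /= s]]; exists c; split=> //.
  by apply: filterS n => w [].
by apply: smooth_at_ext (smooth_at_lsubmx _ _ _ _ _ s) => w /=; rewrite row_mxKl.
Qed.

Lemma tdom_near k (b : 'rV[R]_k -> B) v t : Phi t -> plot_at D b v ->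
  tdom t (b v) -> \forall w \near v, tdom t (b w).
Proof. by move=> Pt pb; have [ot _] := hPhi Pt; exact: open_plot gD ot pb. Qed.

Lemma plot_total k (b : 'rV[R]_k -> B) t (a : 'rV[R]_k -> 'rV[R]_(trank t)) v :
  Phi t -> plot_at D b v -> tdom t (b v) -> smooth_at a v ->
  plot_at (total_atlas D Phi) (fun w => existT F (b w) (tinv t (b w) (a w))) v.
Proof.
move=> Pt pb tv sa; have nt := tdom_near Pt pb tv.
have [c Dc cv] := base_chart (b v).
have [nc sc] := plot_chart gD pb (atlas_max gD Dc) cv.
exists (total_chart c t); split; first by exists c, t.
  exact: filterS (filterI nc nt).
apply: (@smooth_at_eq _ _ _ (fun w => row_mx (cfun c (b w)) (a w))).
  by apply: filterS nt => w tw; rewrite /= ((hPhi Pt).2 _ tw).2.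
exact: smooth_at_row_mx.
Qed.

(** The transition maps of the total space are those of the base together with
    the changes of trivialization, whose smoothness along plots is the hypothesis. *)
Lemma total_compatible :
  (forall k (b : 'rV[R]_k -> B) t t' (a : 'rV[R]_k -> 'rV[R]_(trank t)) v,
     Phi t -> Phi t' -> plot_at D b v -> tdom t (b v) -> tdom t' (b v) ->
     smooth_at a v -> smooth_at (fun w => tfun t' (b w) (tinv t (b w) (a w))) v) ->
  compatible_atlas (total_atlas D Phi).
Proof.
move=> tr; split=> [c [c0 [t [Dc Pt ->]]]|]; first exact: total_chart_valid.
move=> _ _ [c [t [Dc Pt ->]]] [c' [t' [Dc' Pt' ->]]].
apply: compatible_intro; first exact: total_chart_valid.
move=> [d x] [/= cd td] [/= c'd t'd]; have vc := gD.1 _ Dc.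
set v := row_mx _ _.
have cv : cinv c (lsubmx v) = d by rewrite /v row_mxKl vc.2.
have pb : plot_at D (fun w : 'rV[R]_(cdim c + trank t) => cinv c (lsubmx w)) v.
  apply: (plot_comp (f := cinv c)); first by apply: smooth_at_lsubmx; exact: smooth_at_id.
  by rewrite /v row_mxKl; exact: chart_plot (atlas_max gD Dc) cd.
have [|nc sc] := plot_chart gD pb (atlas_max gD Dc'); first by rewrite cv.
split.
  apply: filterI => //; apply: tdom_near => //.
  by rewrite cv.
apply: smooth_at_row_mx => //; apply: tr; rewrite ?cv //.
by apply: smooth_at_rsubmx; exact: smooth_at_id.
Qed.

Hypothesis gE : compatible_atlas (total_atlas D Phi).

Lemma plot_coord k (u : 'rV[R]_k -> {d : B & F d}) v t : Phi t ->
  plot_at (total_atlas D Phi) u v -> tdom t (tag (u v)) ->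
  smooth_at (fun w => tfun t (tag (u w)) (tagged (u w))) v.
Proof.
move=> Pt pu tv; have [c Dc cv] := base_chart (tag (u v)).
have Ec : total_atlas D Phi (total_chart c t) by exists c, t.
have [_ s] := plot_chart gE pu (atlas_max gE Ec) (conj cv tv).
by apply: smooth_at_ext (smooth_at_rsubmx _ _ _ _ _ s) => w /=; rewrite row_mxKr.
Qed.

Lemma tag_preim_open W : atlas_open D W ->
  atlas_open (total_atlas D Phi) [set u | W (tag u)].
Proof.
move=> oW; apply: plot_open => //; first by rewrite pts_total.
by move=> k f v /plot_tag pf; exact: open_plot gD oW pf.
Qed.

(** Points in distinct fibers are separated in the base, points in the same
    fiber in one chart.  For a countable basis, a Lindelof argument: choosing one
    chart and one trivialization for each basic open set of the base contained in
    their domains leaves countably many charts of the total space. *)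
Lemma total_manifold :
  smooth_manifold [set: {d : B & F d}] (total_atlas D Phi).
Proof.
have [_ _ _ hDh [BB cB [oB bB]]] := hD.
split; [exact: pts_total|exact: gE.1|exact: gE.2| |].
  move=> x y _ _ xy; have [txy|txy] := pselect (tag x = tag y); last first.
    have px z : pts D z by have [-> _ _ _ _] := hD.
    have [W1 [W2 [op1 op2 W1x W2y W12]]] := hDh _ _ (px _) (px _) txy.
    exists [set u | W1 (tag u)], [set u | W2 (tag u)].
    split=> //; try exact: tag_preim_open.
    apply/seteqP; split=> // z [W1z W2z].
    have : (W1 `&` W2) (tag z) by split.
    by rewrite W12.
  have [c Dc cd] := base_chart (tag x); have [t Pt td] := hcov (tag x).
  have Ec : total_atlas D Phi (total_chart c t) by exists c, t.
  apply: (@separated_in_chart _ _ _ (total_chart c t)) => //.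
  - exact: atlas_max.
  - by rewrite /= -txy.
pose P W (c : chart R {d : B & F d}) := exists c0 t,
  [/\ D c0, Phi t, W `<=` cdom c0 `&` tdom t & c = total_chart c0 t].
pose ch W := if pselect (exists c, P W c) is left e then Some (sval (cid e)) else None.
apply: (@second_countable_charts _ _ _ _ BB ch) => //.
  move=> W c _; rewrite /ch; case: pselect => // e [<-].
  by have [c0 [t [Dc Pt _ ->]]] := svalP (cid e); exists c0, t.
move=> x _; have [c Dc cd] := base_chart (tag x); have [t Pt td] := hcov (tag x).
have oct : atlas_open D (cdom c `&` tdom t).
  apply: atlas_openI => //; first exact: max_chart_open (atlas_max gD Dc).
  by have [] := hPhi Pt.
have [W BW [Wx sW]] := bB _ (tag x) oct (conj cd td).
have PW : exists c, P W c by exists (total_chart c t), c, t.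
exists W; rewrite /ch; case: pselect => // e; exists (sval (cid e)); split=> //.
have [c0 [t0 [_ _ sW0 ->]]] := svalP (cid e).
by have [] := sW0 _ Wx.
Qed.

End TotalSpace.

(** * Smooth families of matrices over the algebras *)

Lemma mul_lin1_mx {R : realType} p q (f : 'rV[R]_p -> 'rV[R]_q) u : linear f ->
  u *m lin1_mx f = f u.
Proof.
move=> lf; pose f' : {linear 'rV[R]_p -> 'rV[R]_q} :=
  HB.pack f (GRing.isLinear.Build _ _ _ _ _ lf).
exact: (mul_rV_lin1 f').
Qed.

(** The scaling of matrices provided for 'M[K]_m has its scalars in the
    noncommutative ring K, so that the real vector space structure is spelled out. *)
Definition scale_entries {R : realType} {K : algType R} {m} (r : R) (X : 'M[K]_m) :
  'M[K]_m := map_mx (GRing.scale r) X.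

Section ScaleEntries.
Context {R : realType} {K : algType R} {m : nat}.
Implicit Types (r : R) (X Y : 'M[K]_m).

Definition rlinear (L : 'M[K]_m -> 'M[K]_m) : Prop :=
  forall r X Y, L (scale_entries r X + Y) = scale_entries r (L X) + L Y.

Lemma scale_mulmxl r X Y : scale_entries r X *m Y = scale_entries r (X *m Y).
Proof.
apply/matrixP => i j; rewrite !mxE scaler_sumr; apply: eq_bigr => k _.
by rewrite !mxE scalerAl.
Qed.

Lemma scale_mulmxr r X Y : X *m scale_entries r Y = scale_entries r (X *m Y).
Proof.
apply/matrixP => i j; rewrite !mxE scaler_sumr; apply: eq_bigr => k _.
by rewrite !mxE scalerAr.
Qed.

Lemma rlinear_mulmx X : rlinear (mulmx X).
Proof. by move=> r Y Z; rewrite mulmxDr scale_mulmxr. Qed.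

Lemma rlinear_comp L L' : rlinear L -> rlinear L' -> rlinear (L \o L').
Proof. by move=> l l' r X Y /=; rewrite l' l. Qed.

End ScaleEntries.

Section MatrixPlots.
Context {R : realType} {Delta : choiceType} (D : atlas R Delta).
Context {A : Delta -> algType R} (Phi : set (trivialization R (fun d => A d))).
Hypothesis hD : smooth_manifold [set: Delta] D.
Hypothesis hA : smooth_family_of_algebras D Phi.

Let E : atlas R {d : Delta & A d} := total_atlas D Phi.

Let gD : compatible_atlas D. Proof. exact: smooth_manifold_compatible hD. Qed.

Lemma algebra_total_compatible : compatible_atlas E.
Proof. by have [[_ mE] _ _] := hA; exact: smooth_manifold_compatible mE. Qed.
Let gE := algebra_total_compatible.

Lemma algebra_triv t : Phi t -> atlas_open D (tdom t) /\
  forall d, tdom t d -> cancel (tfun t d) (tinv t d) /\ cancel (tinv t d) (tfun t d).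
Proof.
have [[hPhi _] _ _] := hA; move=> /hPhi [ot H]; split=> // d /H [_ ? ?].
by split.
Qed.
Let hPhi := algebra_triv.

Lemma tfun_linear t d : Phi t -> tdom t d -> linear (tfun t d).
Proof. by have [[hP _] _ _] := hA; move=> /hP [_ H] /H []. Qed.

Lemma algebra_triv_cover d : exists2 t, Phi t & tdom t d.
Proof.
have [[_ [pE _ _ _ _]] _ _] := hA.
have : pts E (existT (fun d => A d) d (0 : A d)) by rewrite pE.
by move=> [_ [c [t [Dc Pt ->]]] [/= _ td]]; exists t.
Qed.
Let hcov := algebra_triv_cover.

Lemma tinv_linear t d : Phi t -> tdom t d -> linear (tinv t d).
Proof.
move=> Pt td r x y; have [k1 k2] := (hPhi Pt).2 _ td.
by apply: (can_inj k1); rewrite k2 (tfun_linear Pt td) !k2.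
Qed.

(** Sections along b, so that two plots with values in the same fibers can be
    multiplied without transport. *)
Definition eplot {k} (b : 'rV[R]_k -> Delta) (a : forall w, A (b w)) v : Prop :=
  plot_at E (fun w => existT (fun d => A d) (b w) (a w)) v.

Section EntryPlots.
Context {k : nat} (b : 'rV[R]_k -> Delta) (v : 'rV[R]_k).
Implicit Types (a : forall w, A (b w)).

Lemma eplot_base a : eplot a v -> plot_at D b v.
Proof. exact: plot_tag. Qed.

Lemma eplot_coord a t : Phi t -> tdom t (b v) -> eplot a v ->
  smooth_at (fun w => tfun t (b w) (a w)) v.
Proof. by move=> Pt tv pa; exact: (plot_coord hD gE Pt pa). Qed.

Lemma eplot_triv t (x : 'rV[R]_k -> 'rV[R]_(trank t)) : Phi t -> plot_at D b v ->
  tdom t (b v) -> smooth_at x v -> eplot (fun w => tinv t (b w) (x w)) v.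
Proof. exact: plot_total. Qed.

(** Smoothness along b can be tested in one trivialization. *)
Lemma eplot_of_coord t a : Phi t -> plot_at D b v -> tdom t (b v) ->
  smooth_at (fun w => tfun t (b w) (a w)) v -> eplot a v.
Proof.
move=> Pt pb tv sa; apply: plot_eq (eplot_triv Pt pb tv sa).
apply: filterS (tdom_near hD hPhi Pt pb tv) => w tw.
by rewrite ((hPhi Pt).2 _ tw).1.
Qed.

Lemma eplotD a a' : eplot a v -> eplot a' v -> eplot (fun w => a w + a' w) v.
Proof.
move=> pa pa'; have pb := eplot_base pa; have [t Pt tv] := hcov (b v).
apply: (eplot_of_coord Pt pb tv).
apply: (@smooth_at_eq _ _ _ (fun w => tfun t (b w) (a w) + tfun t (b w) (a' w))).
  apply: filterS (tdom_near hD hPhi Pt pb tv) => w tw.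
  by have := tfun_linear Pt tw 1 (a w) (a' w); rewrite !scale1r.
by apply: smooth_atD; exact: eplot_coord.
Qed.

Lemma eplotZ r a : eplot a v -> eplot (fun w => r *: a w) v.
Proof.
move=> pa; have pb := eplot_base pa; have [t Pt tv] := hcov (b v).
apply: (eplot_of_coord Pt pb tv).
apply: (@smooth_at_eq _ _ _ (fun w => r *: tfun t (b w) (a w))).
  apply: filterS (tdom_near hD hPhi Pt pb tv) => w tw.
  have lt := tfun_linear Pt tw; have := lt r (a w) 0; rewrite addr0 => ->.
  have := lt 1 0 0; rewrite !scale1r addr0 -{1}[tfun t (b w) 0]addr0 => /addrI <-.
  by rewrite addr0.
by apply: smooth_atZ; exact: eplot_coord.
Qed.

Lemma eplot0 : plot_at D b v -> @eplot k b (fun w => 0) v.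
Proof.
move=> pb; have [t Pt tv] := hcov (b v).
apply: plot_eq (eplot_triv (x := fun=> 0) Pt pb tv (smooth_at_cst _ 0 v)).
apply: filterS (tdom_near hD hPhi Pt pb tv) => w tw; congr existT.
have := tinv_linear Pt tw 1 0 0; rewrite !scale1r addr0 -{1}[tinv t (b w) 0]addr0.
by move=> /addrI.
Qed.

Lemma eplot_sum I (r : seq I) (a : I -> forall w, A (b w)) : plot_at D b v ->
  (forall i, eplot (a i) v) -> eplot (fun w => \sum_(i <- r) a i w) v.
Proof.
move=> pb pa; elim: r => [|i r IH].
  by apply: plot_ext (eplot0 pb) => w; rewrite big_nil.
by apply: plot_ext (eplotD (pa i) IH) => w; rewrite big_cons.
Qed.

Lemma eplot1 : plot_at D b v -> @eplot k b (fun w => 1) v.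
Proof. by move=> pb; have [_ _ s1] := hA; exact: (smooth_map_plot gD s1 pb). Qed.

(** The pair is a plot of the fiber square, on which the multiplication is
    smooth by hypothesis. *)
Lemma eplotM a a' : eplot a v -> eplot a' v -> eplot (fun w => a w * a' w) v.
Proof.
move=> pa pa'; have [_ sM _] := hA.
pose u w := (existT (fun d => A d) (b w) (a w), existT (fun d => A d) (b w) (a' w)).
have gP : compatible_atlas (prod_atlas E E) by exact: prod_compatible.
have Su w : fiber_square tag [set: {d : Delta & A d}] (u w) by split.
have pu : plot_at (fiber_square_atlas tag [set: {d : Delta & A d}] E) u v.
  apply: plot_sub => //; first exact: plot_pair.
    exact: (@filterE _ (nbhs v) _ _ Su).
  by have [c1 [_ [_ [[sc cu] _ _ _ _]]]] := sM _ (Su v); exists c1.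
apply: plot_ext (smooth_map_plot (sub_compatible _ gP) sM pu (Su v)) => w.
rewrite /= /fiberwise2 /=; congr existT; congr (_ * _).
exact: (@tagged_asE _ (fun d => A d : Type) (existT (fun d => A d) (b w) (a w)) (a' w)).
Qed.

End EntryPlots.

Section Matrices.
Context {m : nat}.

Let mxt (t : trivialization R (fun d => A d)) := mx_trivialization m t.
Let P' : set (trivialization R (fun d => 'M[A d]_m)) := mx_trivialization m @` Phi.

Definition mcoord t d (X : 'M[A d]_m) : 'rV[R]_(trank (mxt t)) := tfun (mxt t) d X.
Definition minv t d (x : 'rV[R]_(trank (mxt t))) : 'M[A d]_m := tinv (mxt t) d x.

Lemma mcoordE t d (X : 'M[A d]_m) i j k :
  mcoord t X 0 (mxvec_index (mxvec_index i j) k) = tfun t d (X i j) 0 k.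
Proof. by rewrite /mcoord /= mxvecE mxE mxvecE. Qed.

Lemma minvE t d (x : 'rV[R]_(trank (mxt t))) i j :
  minv d x i j = tinv t d (row (mxvec_index i j) (vec_mx x)).
Proof. by rewrite /minv /= mxE mxE. Qed.

Lemma row_mcoord t d (X : 'M[A d]_m) i j :
  row (mxvec_index i j) (vec_mx (mcoord t X)) = tfun t d (X i j).
Proof. by apply/rowP => k; rewrite mxE mxE mcoordE. Qed.

Lemma mcoordK t d : Phi t -> tdom t d -> cancel (@mcoord t d) (@minv t d).
Proof.
move=> Pt td X; apply/matrixP => i j.
by rewrite minvE row_mcoord ((hPhi Pt).2 _ td).1.
Qed.

Lemma minvK t d : Phi t -> tdom t d -> cancel (@minv t d) (@mcoord t d).
Proof.
move=> Pt td x; apply/rowP => p.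
case/mxvec_indexP: p => q k; case/mxvec_indexP: q => i j.
by rewrite mcoordE minvE ((hPhi Pt).2 _ td).2 !mxE.
Qed.

Lemma mcoord_linear t d r (X Y : 'M[A d]_m) : Phi t -> tdom t d ->
  mcoord t (scale_entries r X + Y) = r *: mcoord t X + mcoord t Y.
Proof.
move=> Pt td; apply/rowP => p.
case/mxvec_indexP: p => q k; case/mxvec_indexP: q => i j.
by rewrite mxE [in RHS]mxE !mcoordE !mxE (tfun_linear Pt td) !mxE.
Qed.

Lemma minv_linear t d r (x y : 'rV[R]_(trank (mxt t))) : Phi t -> tdom t d ->
  minv d (r *: x + y) = scale_entries r (minv d x) + minv d y.
Proof.
move=> Pt td; apply: (can_inj (mcoordK Pt td)).
by rewrite mcoord_linear // !minvK.
Qed.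

Lemma mcoordB t d (X Y : 'M[A d]_m) : Phi t -> tdom t d ->
  mcoord t (X - Y) = mcoord t X - mcoord t Y.
Proof.
move=> Pt td; have E1 := mcoord_linear (-1) Y X Pt td; rewrite scaleN1r in E1.
rewrite [RHS]addrC -E1; congr mcoord; apply/matrixP => i j.
by rewrite !mxE scaleN1r addrC.
Qed.

(** The matrix of L in a trivialization, acting on row vectors on the right.
    Composition of maps becomes the product of matrices in the opposite order. *)
Definition opmx t d (L : 'M[A d]_m -> 'M[A d]_m) : 'M[R]_(trank (mxt t)) :=
  lin1_mx (fun x => mcoord t (L (minv d x))).

Lemma opmxE t d L x : Phi t -> tdom t d -> rlinear L ->
  x *m opmx t L = mcoord t (L (@minv t d x)).
Proof.
move=> Pt td lL; apply: mul_lin1_mx => r y z.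
by rewrite minv_linear // lL mcoord_linear.
Qed.

Lemma mcoord_opmx t d L (X : 'M[A d]_m) : Phi t -> tdom t d -> rlinear L ->
  mcoord t X *m opmx t L = mcoord t (L X).
Proof. by move=> Pt td lL; rewrite opmxE // mcoordK. Qed.

Lemma opmx_comp t d (L L' : 'M[A d]_m -> 'M[A d]_m) : Phi t -> tdom t d ->
  rlinear L -> rlinear L' -> opmx t (L' \o L) = opmx t L *m opmx t L'.
Proof.
move=> Pt td lL lL'; apply/row_matrixP => i; rewrite !rowE mulmxA.
by rewrite !opmxE // ?minvK ?mcoordK //; exact: rlinear_comp.
Qed.

Lemma opmx_id t d (L : 'M[A d]_m -> 'M[A d]_m) : Phi t -> tdom t d ->
  L =1 id -> opmx t L = 1%:M.
Proof.
move=> Pt td L1; apply/row_matrixP => i; rewrite !rowE mulmx1.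
by rewrite opmxE // ?L1 ?minvK // => r X Y; rewrite !L1.
Qed.

(** Left multiplications by X and Y become square real matrices in a
    trivialization, and these commute when their product is the identity. *)
Lemma mulmx_inverseC d (X Y : 'M[A d]_m) : X *m Y = 1%:M -> Y *m X = 1%:M.
Proof.
move=> XY; have [t Pt td] := hcov d.
have /mulmx1C E1 : opmx t (mulmx Y) *m opmx t (mulmx X) = 1%:M.
  rewrite -opmx_comp //; try exact: rlinear_mulmx.
  by apply: opmx_id => // Z /=; rewrite mulmxA XY mul1mx.
have := congr1 (mulmx (mcoord t (1%:M : 'M[A d]_m))) E1.
rewrite -opmx_comp //; try exact: rlinear_mulmx.
rewrite mcoord_opmx //; last by apply: rlinear_comp; exact: rlinear_mulmx.
by rewrite mulmx1 /= mulmx1 => /(can_inj (mcoordK Pt td)).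
Qed.

Definition mplot {k} (b : 'rV[R]_k -> Delta) (M : forall w, 'M[A (b w)]_m) v : Prop :=
  plot_at D b v /\ forall i j, eplot (fun w => M w i j) v.

Section MatrixPlotOperations.
Context {k : nat} (b : 'rV[R]_k -> Delta) (v : 'rV[R]_k).
Implicit Types (M : forall w, 'M[A (b w)]_m).

Lemma mplot_coord M t : Phi t -> tdom t (b v) -> mplot M v ->
  smooth_at (fun w => mcoord t (M w)) v.
Proof.
move=> Pt tv [pb pM]; apply: smooth_at_mx => i p; rewrite (ord1 i).
case/mxvec_indexP: p => q l; case/mxvec_indexP: q => a c.
apply: (@smooth_at_ext _ _ _ (fun w => tfun t (b w) (M w a c) 0 l)).
  by move=> w; rewrite mcoordE.
by apply: smooth_at_coord; exact: eplot_coord.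
Qed.

Lemma mplot_triv t (x : 'rV[R]_k -> 'rV[R]_(trank (mxt t))) : Phi t ->
  plot_at D b v -> tdom t (b v) -> smooth_at x v -> mplot (fun w => minv (b w) (x w)) v.
Proof.
move=> Pt pb tv sx; split=> // i j.
apply: plot_ext (eplot_triv (x := fun w => row (mxvec_index i j) (vec_mx (x w))) Pt pb tv _).
  by move=> w; rewrite minvE.
apply: (@smooth_at_linear _ _ _ _ _ (fun y => row (mxvec_index i j) (vec_mx y))) => //.
by move=> r y z; rewrite !linearP.
Qed.

Lemma mplot_eq M M' : (\forall w \near v, M w = M' w) -> mplot M v -> mplot M' v.
Proof.
move=> MM [pb pM]; split=> // i j; apply: plot_eq (pM i j).
by apply: filterS MM => w ->.
Qed.

Lemma mplotM M M' : mplot M v -> mplot M' v -> mplot (fun w => M w *m M' w) v.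
Proof.
move=> [pb pM] [_ pM']; split=> // i j.
apply: plot_ext (eplot_sum (index_enum _) pb (fun l => eplotM (pM i l) (pM' l j))).
by move=> w; rewrite mxE.
Qed.

Lemma mplotB M M' : mplot M v -> mplot M' v -> mplot (fun w => M w - M' w) v.
Proof.
move=> [pb pM] [_ pM']; split=> // i j.
apply: plot_ext (eplotD (pM i j) (eplotZ (-1) (pM' i j))).
by move=> w; rewrite !mxE scaleN1r.
Qed.

Lemma mplot1 : plot_at D b v -> @mplot k b (fun w => 1%:M) v.
Proof.
move=> pb; split=> // i j; have [->|ij] := eqVneq i j.
  by apply: plot_ext (eplot1 pb) => w; rewrite mxE eqxx.
by apply: plot_ext (eplot0 pb) => w; rewrite mxE (negbTE ij).
Qed.

(** The rows of this matrix are the coordinates of the images under L of smooth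
    families of matrices, those with constant basis vectors as coordinates. *)
Lemma opmx_smooth t (L : forall w, 'M[A (b w)]_m -> 'M[A (b w)]_m) :
  Phi t -> tdom t (b v) -> plot_at D b v ->
  (forall M, mplot M v -> mplot (fun w => L w (M w)) v) ->
  smooth_at (fun w => opmx t (L w)) v.
Proof.
move=> Pt tv pb LM; apply: smooth_at_mx => i j.
apply: (@smooth_at_ext _ _ _ (fun w => mcoord t (L w (minv (b w) (delta_mx 0 i))) 0 j)).
  by move=> w; rewrite [RHS]mxE.
apply: smooth_at_coord; apply: mplot_coord => //; apply: LM.
by apply: (mplot_triv (x := fun=> delta_mx 0 i)) => //; exact: smooth_at_cst.
Qed.

(** The inverse of M is obtained by solving a linear system: its coordinates are
    those of the identity multiplied by the inverse of the real matrix of left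
    multiplication by M. *)
Lemma mplot_inverse M : mplot M v -> (\forall w \near v, invertible (M w)) ->
  mplot (fun w => inverse (M w)) v.
Proof.
move=> pM iM; have [pb _] := pM; have [t Pt tv] := hcov (b v).
have nt := tdom_near hD hPhi Pt pb tv.
have invP w : invertible (M w) -> is_inverse (M w) (inverse (M w)).
  by move=> [Y MY]; rewrite /inverse; exact: (@xgetPex _ 0 [set y | is_inverse (M w) y] (ex_intro _ Y MY)).
pose L w := opmx t (mulmx (M w)).
have sL : smooth_at L v.
  by apply: opmx_smooth => // M' pM'; exact: mplotM.
have LV w : tdom t (b w) -> invertible (M w) ->
    L w \in unitmx /\ mcoord t (inverse (M w)) =
      mcoord t (1%:M : 'M[A (b w)]_m) *m invmx (L w).
  move=> tw /invP [r1 r2]; have lX (Z : 'M[A (b w)]_m) := rlinear_mulmx Z.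
  have LL : opmx t (mulmx (inverse (M w))) *m L w = 1%:M.
    rewrite /L -opmx_comp //; apply: opmx_id => // Z /=.
    by rewrite mulmxA [X in X *m _]r1 mul1mx.
  have [_ uL] := mulmx1_unit LL; split=> //.
  have -> : invmx (L w) = opmx t (mulmx (inverse (M w))).
    by rewrite -[RHS]mulmx1 -(mulmxV uL) mulmxA LL mul1mx.
  by rewrite mcoord_opmx // mulmx1.
apply: (@mplot_eq (fun w => minv (b w)
  (mcoord t (1%:M : 'M[A (b w)]_m) *m invmx (L w)))).
  apply: filterS (filterI nt iM) => w [tw iw].
  by have [_ <-] := LV w tw iw; rewrite mcoordK.
apply: mplot_triv => //; apply: smooth_at_mulmx.
  by apply: mplot_coord => //; exact: mplot1.
apply: smooth_at_invmx => //.
by have [] := LV v tv (nbhs_singleton iM).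
Qed.

End MatrixPlotOperations.

Lemma mx_triv t : P' t -> atlas_open D (tdom t) /\
  forall d, tdom t d -> cancel (tfun t d) (tinv t d) /\ cancel (tinv t d) (tfun t d).
Proof.
move=> [t0 Pt <-]; have [ot _] := hPhi Pt; split=> //= d td.
by split; [exact: (mcoordK Pt td)|exact: (minvK Pt td)].
Qed.

Lemma mx_triv_cover d : exists2 t, P' t & tdom t d.
Proof. by have [t Pt td] := hcov d; exists (mxt t) => //; exists t. Qed.

Lemma mx_compatible : compatible_atlas (mx_atlas D Phi m).
Proof.
apply: (total_compatible hD mx_triv) => k b t1 t2 a v [t Pt E1] [t' Pt' E2] pb tv t'v sa.
subst t1 t2.
by apply: mplot_coord => //; exact: mplot_triv.
Qed.

Lemma mx_manifold : smooth_manifold [set: {d : Delta & 'M[A d]_m}] (mx_atlas D Phi m).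
Proof. exact: (total_manifold hD mx_triv mx_triv_cover mx_compatible). Qed.

Lemma mplotP k (b : 'rV[R]_k -> Delta) (M : forall w, 'M[A (b w)]_m) v :
  mplot M v <-> plot_at (mx_atlas D Phi m) (fun w => existT (fun d => 'M[A d]_m) (b w) (M w)) v.
Proof.
split=> [pM|pM].
  have [pb _] := pM; have [t Pt tv] := hcov (b v).
  have Pt' : P' (mxt t) by exists t.
  apply: plot_eq (plot_total hD mx_triv Pt' pb tv (mplot_coord Pt tv pM)).
  apply: filterS (tdom_near hD hPhi Pt pb tv) => w tw; congr existT.
  exact: mcoordK.
have pb : plot_at D b v by exact: (plot_tag pM).
have [t Pt tv] := hcov (b v).
have Pt' : P' (mxt t) by exists t.
apply: (@mplot_eq _ _ _ (fun w => minv (b w) (mcoord t (M w)))).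
  by apply: filterS (tdom_near hD hPhi Pt pb tv) => w tw; exact: mcoordK.
apply: mplot_triv => //.
exact: (plot_coord hD mx_compatible Pt' pM tv).
Qed.

End Matrices.
End MatrixPlots.

(** * Idempotents, involutions and diffeomorphisms *)

Section QuadraticDerivative.
Context {R : realType} {V W : normedModType R}.

(** The difference quotient in the direction v is e1 + s e2. *)
Lemma diff_quadratic (f : V -> W) (x v : V) (e1 e2 : W) : differentiable f x ->
  (forall s : R, f (s *: v + x) = f x + s *: e1 + s ^+ 2 *: e2) -> 'd f x v = e1.
Proof.
move=> df H; rewrite -deriveE //; apply: cvg_lim => //.
suff : (e1 + h *: e2) @[h --> (0 : R)^'] --> e1.
  apply: cvg_trans; apply: near_eq_cvg; near=> h.
  have h0 : h != 0 by near: h; exact: nbhs_dnbhs_neq.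
  rewrite [in RHS]/= H -(addrA (f x)) (addrC (f x)) addrK scalerDr !scalerA mulVf // scale1r.
  by rewrite expr2 mulKf.
rewrite -[X in _ --> X]addr0 -[X in _ --> _ + X](scale0r e2).
apply: cvgD; first exact: cvg_cst.
apply: cvgZr_tmp; exact: cvg_within.
Unshelve. all: by end_near. Qed.

Lemma diff_postlin (W' : normedModType R) (L : {linear W -> W'}) (f : V -> W) (x v : V) :
  continuous L -> differentiable f x -> 'd (L \o f) x v = L ('d f x v).
Proof.
move=> cL df; have dL : differentiable L (f x) by exact: linear_differentiable.
by rewrite diff_comp //= diff_lin.
Qed.

End QuadraticDerivative.

Section DiffeoOperations.
Context {R : realType}.

Lemma local_diffeo_sub n m (f : 'rV[R]_n -> 'rV[R]_m) g (U U' : set 'rV[R]_n) :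
  local_diffeo f g U -> open U' -> U' `<=` U -> local_diffeo f g U'.
Proof.
move=> [oU ofU gK sf sg] oU' sU; split=> //.
- rewrite openE => _ [x Ux <-].
  have fx : (f @` U) (f x) by exists x => //; exact: sU.
  have nfU : nbhs (f x) (f @` U) by apply: open_nbhs_nbhs; split.
  have gfx : g (f x) = x by apply: gK; exact: sU.
  have := smooth_at_near_set _ _ _ U' (sg _ fx) oU'; rewrite gfx => /(_ Ux) nU.
  apply: filterS (filterI nfU nU) => _ [[y Uy <-] /=]; rewrite gK // => U'y.
  by exists y.
- by move=> x /sU; exact: gK.
- by move=> x /sU; exact: sf.
- by move=> _ [x Ux <-]; apply: sg; exists x => //; exact: sU.
Qed.

(** The two spaces may be row spaces of sizes that are equal only propositionally,
    which is why isomorphisms are used instead of casts. *)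
Lemma local_diffeo_iso n m p (f : 'rV[R]_n -> 'rV[R]_m) g U
    (h : 'rV[R]_m -> 'rV[R]_p) h' : local_diffeo f g U ->
  cancel h h' -> cancel h' h -> (forall x, smooth_at h x) -> (forall x, smooth_at h' x) ->
  local_diffeo (h \o f) (g \o h') U.
Proof.
move=> [oU ofU gK sf sg] hK h'K sh sh'.
have hfU : (h \o f) @` U = h' @^-1` (f @` U).
  apply/seteqP; split=> [_ [x Ux <-]|y [x Ux fx]]; first by exists x; rewrite //= hK.
  by exists x => //=; rewrite fx.
split=> //.
- by rewrite hfU; apply: open_comp => // y _; exact: smooth_at_continuous.
- by move=> x Ux /=; rewrite hK gK.
- by move=> x Ux; apply: smooth_at_comp => //; exact: sf.
- by rewrite hfU => y Uy; apply: smooth_at_comp => //; exact: sg.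
Qed.

Lemma iso_local_diffeo n m (h : 'rV[R]_n -> 'rV[R]_m) h' U : open U ->
  cancel h h' -> cancel h' h -> (forall x, smooth_at h x) -> (forall x, smooth_at h' x) ->
  local_diffeo h h' U.
Proof.
move=> oU hK h'K sh sh'; split=> //.
suff -> : h @` U = h' @^-1` U by apply: open_comp => // y _; exact: smooth_at_continuous.
apply/seteqP; split=> [_ [x Ux <-]|y Uy]; first by rewrite /= hK.
by exists (h' y).
Qed.

End DiffeoOperations.

Section IdempotentSplitting.
Context {R : realType} {N : nat}.
Implicit Types e : 'M[R]_N.

Lemma row_base_col_base e : e *m e = e -> row_base e *m col_base e = 1%:M.
Proof.
move=> ee; have uc : row_free (row_base e) by rewrite row_base_free.
have uf : row_full (col_base e) by rewrite col_base_full.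
apply: (row_free_inj uc); apply: (row_full_inj uf).
by rewrite mul1mx mulmxA mulmxA mulmx_base -mulmxA mulmx_base.
Qed.

(** The factorization of e through its image. *)
Lemma idempotent_factor e : e *m e = e ->
  exists r (c : 'M[R]_(N, r)) (b : 'M[R]_(r, N)), c *m b = e /\ b *m c = 1%:M.
Proof.
move=> ee; exists (\rank e), (col_base e), (row_base e).
by split; [exact: mulmx_base|exact: row_base_col_base].
Qed.

Lemma factor_orthogonal e e' r r' (c : 'M[R]_(N, r)) b (c' : 'M[R]_(N, r')) b' :
  c *m b = e -> b *m c = 1%:M -> c' *m b' = e' -> b' *m c' = 1%:M ->
  e *m e' = 0 -> b *m c' = 0.
Proof.
move=> cb bc cb' bc' ee.
rewrite -[b]mul1mx -bc -[c' in LHS]mulmx1 -bc' -!mulmxA (mulmxA c) cb (mulmxA c') cb'.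
by rewrite (mulmxA e) ee mul0mx mulmx0.
Qed.

Lemma mul_factor_eq0 p (y : 'M[R]_(p, N)) e r (c : 'M[R]_(N, r)) b :
  c *m b = e -> b *m c = 1%:M -> (y *m c = 0) <-> (y *m e = 0).
Proof.
move=> cb bc; split=> ye; first by rewrite -cb mulmxA ye mul0mx.
by rewrite -[LHS]mulmx1 -bc mulmxA -(mulmxA y) cb ye mul0mx.
Qed.

End IdempotentSplitting.

Section Involution.
Context {R : realType} {K : algType R} (sigma : K -> K).
Hypothesis sK : involutive sigma.
Hypothesis sL : linear sigma.
Hypothesis s1 : sigma 1 = 1.
Hypothesis sM : forall a b, sigma (a * b) = sigma b * sigma a.
Context {m : nat}.
Implicit Types (X Y J : 'M[K]_m).

Let dag X : 'M[K]_m := dagger sigma X.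

Lemma invol_add a b : sigma (a + b) = sigma a + sigma b.
Proof. by have := sL 1 a b; rewrite !scale1r. Qed.

Lemma invol_zero : sigma 0 = 0.
Proof. by have := invol_add 0 0; rewrite addr0 -{1}[sigma 0]addr0 => /addrI. Qed.

Lemma invol_scale r a : sigma (r *: a) = r *: sigma a.
Proof. by have := sL r a 0; rewrite !addr0 invol_zero addr0. Qed.

Lemma invol_sum I (r : seq I) (f : I -> K) :
  sigma (\sum_(i <- r) f i) = \sum_(i <- r) sigma (f i).
Proof.
elim: r => [|i r IH]; first by rewrite !big_nil invol_zero.
by rewrite !big_cons invol_add IH.
Qed.

Lemma daggerE X i j : dag X i j = sigma (X j i).
Proof. by rewrite !mxE. Qed.

Lemma daggerK : involutive dag.
Proof. by move=> X; apply/matrixP => i j; rewrite !daggerE sK. Qed.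

Lemma daggerM X Y : dag (X *m Y) = dag Y *m dag X.
Proof.
apply/matrixP => i j; rewrite daggerE !mxE invol_sum; apply: eq_bigr => k _.
by rewrite sM !daggerE.
Qed.

Lemma dagger1 : dag 1%:M = 1%:M.
Proof.
apply/matrixP => i j; rewrite daggerE !mxE eq_sym.
by case: (i == j); rewrite ?invol_zero // s1.
Qed.

Lemma rlinear_dagger : rlinear dag.
Proof.
move=> r X Y; apply/matrixP => i j.
by rewrite [RHS]mxE [X in _ = X + _]mxE !daggerE !mxE sL.
Qed.

Lemma daggerB X Y : dag (X - Y) = dag X - dag Y.
Proof.
apply/matrixP => i j; rewrite [RHS]mxE [X in _ = _ + X]mxE !daggerE !mxE.
by rewrite invol_add -scaleN1r invol_scale scaleN1r.
Qed.

End Involution.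

(** Conjugation by the diagonal matrix with diagonal s. *)
Definition sign_conj {R : realType} {K : algType R} {m} (s : 'I_m -> R) (X : 'M[K]_m) :
  'M[K]_m := \matrix_(i, j) ((s i * s j) *: X i j).

Section SignConj.
Context {R : realType} {K : algType R} {m : nat} (s : 'I_m -> R).
Hypothesis ss : forall i, s i * s i = 1.
Implicit Types (X Y : 'M[K]_m).

Let tau : 'M[K]_m -> 'M[K]_m := sign_conj s.

Lemma sign_conjK : involutive tau.
Proof.
move=> X; apply/matrixP => i j; rewrite !mxE scalerA.
by rewrite mulrACA !ss mulr1 scale1r.
Qed.

Lemma sign_conjM X Y : tau (X *m Y) = tau X *m tau Y.
Proof.
apply/matrixP => i j; rewrite !mxE scaler_sumr; apply: eq_bigr => k _.
rewrite !mxE -scalerAl -scalerAr scalerA; congr (_ *: _).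
by rewrite mulrACA mulrC [s k * s j]mulrC mulrACA ss mulr1 mulrC.
Qed.

Lemma rlinear_sign_conj : rlinear tau.
Proof.
move=> r X Y; apply/matrixP => i j.
by rewrite !mxE scalerDr !scalerA mulrC.
Qed.

Lemma sign_conjB X Y : tau (X - Y) = tau X - tau Y.
Proof. by apply/matrixP => i j; rewrite !mxE scalerBr. Qed.

Lemma sign_conj_dagger (sigma : K -> K) X : linear sigma ->
  dagger sigma (tau X) = tau (dagger sigma X).
Proof.
by move=> sL; apply/matrixP => i j; rewrite !mxE invol_scale // mulrC.
Qed.

Lemma sign_conj_diag X : is_diag_mx X -> tau X = X.
Proof.
move=> /is_diag_mxP dX; apply/matrixP => i j; rewrite mxE.
have [->|ij] := eqVneq i j; first by rewrite ss scale1r.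
by rewrite dX // scaler0.
Qed.

End SignConj.

Section LinearSplitting.
Context {R : realType} {p N : nat} (P T : 'M[R]_N).
Hypothesis PP : P *m P = P.
Hypothesis TT : T *m T = 1%:M.
Hypothesis PT : P *m T = T *m P.

(** The idempotents (1 - P) (1 + T) / 2, (1 - P) (1 - T) / 2 and P are orthogonal
    with sum 1.  Factoring each of them through its image gives coordinates on the
    three summands, and p further coordinates are left unchanged. *)
Lemma linear_splitting : exists r1 r2 r3
    (h : 'rV[R]_(p + N) -> 'rV[R]_((p + (r1 + r2)) + r3)) h',
  [/\ cancel h h', cancel h' h, forall x, smooth_at h x & forall x, smooth_at h' x] /\
  forall z, [/\ lsubmx (lsubmx (h z)) = lsubmx z,
    rsubmx (h z) = 0 <-> rsubmx z *m P = 0 &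
    rsubmx z *m P = 0 ->
      (rsubmx (rsubmx (lsubmx (h z))) = 0 <-> rsubmx z *m T = rsubmx z)].
Proof.
pose S := 1%:M - P.
pose Tp := 2^-1 *: (1%:M + T); pose Tm := 2^-1 *: (1%:M - T).
have h2 (X : 'M[R]_N) : (2^-1 * 2^-1) *: (X + X) = 2^-1 *: X.
  by rewrite scalerDr -scalerDl; congr (_ *: _); field.
have h1 (X : 'M[R]_N) : 2^-1 *: (X + X) = X.
  by rewrite scalerDr -scalerDl -[RHS]scale1r; congr (_ *: _); field.
have SS : S *m S = S by rewrite /S mulmxBl mulmxBr mulmx1 mul1mx mulmxBr mulmx1 PP subrr subr0.
have SP : S *m P = 0 by rewrite mulmxBl mul1mx PP subrr.
have PS : P *m S = 0 by rewrite mulmxBr mulmx1 PP subrr.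
have ST : S *m T = T *m S by rewrite mulmxBl mulmxBr mul1mx mulmx1 PT.
have SE : S = 1%:M - P by [].
clearbody S.
have TpTp : Tp *m Tp = Tp.
  rewrite /Tp -scalemxAl -scalemxAr scalerA mulmxDl mul1mx mulmxDr mulmx1 TT.
  by rewrite [T + 1%:M]addrC h2.
have TmTm : Tm *m Tm = Tm.
  rewrite /Tm -scalemxAl -scalemxAr scalerA mulmxBl mul1mx mulmxBr mulmx1 TT.
  by rewrite -[T - 1%:M]opprB opprK h2.
have TpTm : Tp *m Tm = 0.
  rewrite /Tm -scalemxAl -scalemxAr scalerA mulmxDl mul1mx mulmxBr mulmx1 TT.
  by rewrite -[T - 1%:M]opprB subrr scaler0.
have TmTp : Tm *m Tp = 0.
  rewrite /Tm -scalemxAl -scalemxAr scalerA mulmxBl mul1mx mulmxDr mulmx1 TT.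
  by rewrite [T + 1%:M]addrC subrr scaler0.
have STp : S *m Tp = Tp *m S.
  by rewrite /Tp -scalemxAl -scalemxAr mulmxDl mulmxDr mulmx1 mul1mx ST.
have STm : S *m Tm = Tm *m S.
  by rewrite /Tm -scalemxAl -scalemxAr mulmxBl mulmxBr mulmx1 mul1mx ST.
pose e1 := S *m Tp; pose e2 := S *m Tm.
have e1e1 : e1 *m e1 = e1 by rewrite /e1 {1}STp -mulmxA (mulmxA S) SS STp mulmxA TpTp.
have e2e2 : e2 *m e2 = e2 by rewrite /e2 {1}STm -mulmxA (mulmxA S) SS STm mulmxA TmTm.
have e1e2 : e1 *m e2 = 0.
  by rewrite /e1 /e2 STm mulmxA -(mulmxA S) TpTm mulmx0 mul0mx.
have e2e1 : e2 *m e1 = 0.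
  by rewrite /e1 /e2 STp mulmxA -(mulmxA S) TmTp mulmx0 mul0mx.
have e1P : e1 *m P = 0 by rewrite /e1 STp -mulmxA SP mulmx0.
have e2P : e2 *m P = 0 by rewrite /e2 STm -mulmxA SP mulmx0.
have Pe1 : P *m e1 = 0 by rewrite /e1 mulmxA PS mul0mx.
have Pe2 : P *m e2 = 0 by rewrite /e2 mulmxA PS mul0mx.
have sum1 : e1 + e2 + P = 1%:M.
  rewrite /e1 /e2 -mulmxDr /Tp /Tm -scalerDr addrACA subrr addr0 h1.
  by rewrite mulmx1 SE subrK.
have e2E : e2 = S *m Tm by [].
clearbody e1 e2.
have [r1 [c1 [b1 [cb1 bc1]]]] := idempotent_factor e1e1.
have [r2 [c2 [b2 [cb2 bc2]]]] := idempotent_factor e2e2.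
have [r3 [c3 [b3 [cb3 bc3]]]] := idempotent_factor PP.
exists r1, r2, r3.
exists (fun z => row_mx (row_mx (lsubmx z)
  (row_mx (rsubmx z *m c1) (rsubmx z *m c2))) (rsubmx z *m c3)).
exists (fun y => row_mx (lsubmx (lsubmx y)) (lsubmx (rsubmx (lsubmx y)) *m b1
  + rsubmx (rsubmx (lsubmx y)) *m b2 + rsubmx y *m b3)).
split; first split.
- move=> z /=; rewrite !(row_mxKl, row_mxKr) -!mulmxA cb1 cb2 cb3 -!mulmxDr sum1 mulmx1.
  by rewrite hsubmxK.
- move=> y /=; rewrite !(row_mxKl, row_mxKr) !mulmxDl -!mulmxA.
  rewrite bc1 bc2 bc3 (factor_orthogonal cb1 bc1 cb2 bc2 e1e2)
    (factor_orthogonal cb2 bc2 cb1 bc1 e2e1) (factor_orthogonal cb1 bc1 cb3 bc3 e1P)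
    (factor_orthogonal cb2 bc2 cb3 bc3 e2P) (factor_orthogonal cb3 bc3 cb1 bc1 Pe1)
    (factor_orthogonal cb3 bc3 cb2 bc2 Pe2) !mulmx0 !mulmx1 !addr0 !add0r.
  by rewrite !hsubmxK.
- move=> x; do !apply: smooth_at_row_mx; try apply: smooth_at_mulmx;
    try exact: smooth_at_cst; try (apply: smooth_at_rsubmx; exact: smooth_at_id).
  by apply: smooth_at_lsubmx; exact: smooth_at_id.
- move=> x; apply: smooth_at_row_mx.
    by do 2 apply: smooth_at_lsubmx; exact: smooth_at_id.
  apply: smooth_atD; first apply: smooth_atD; apply: smooth_at_mulmx;
    try exact: smooth_at_cst.
  + by apply: smooth_at_lsubmx; apply: smooth_at_rsubmx; apply: smooth_at_lsubmx; exact: smooth_at_id.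
  + by apply: smooth_at_rsubmx; apply: smooth_at_rsubmx; apply: smooth_at_lsubmx; exact: smooth_at_id.
  + by apply: smooth_at_rsubmx; exact: smooth_at_id.
move=> z /=; rewrite !(row_mxKl, row_mxKr); split=> //; first exact: mul_factor_eq0 cb3 bc3.
move=> zP; rewrite (mul_factor_eq0 _ cb2 bc2) e2E mulmxA SE mulmxBr mulmx1 zP subr0.
rewrite /Tm -scalemxAr mulmxBr mulmx1; split=> [/eqP|->]; last by rewrite subrr scaler0.
by rewrite scaler_eq0 invr_eq0 pnatr_eq0 /= subr_eq0 => /eqP.
Qed.

End LinearSplitting.

(** * Slice charts of the unitary groups *)

Section UnitaryCharts.
Context {R : realType} {Delta : choiceType} (D : atlas R Delta).
Context {A : Delta -> algType R} (Phi : set (trivialization R (fun d => A d))).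
Hypothesis hD : smooth_manifold [set: Delta] D.
Hypothesis hA : smooth_family_of_algebras D Phi.
Context (sigma : forall d, A d -> A d).
Arguments sigma : clear implicits.
Hypothesis hsigma : smooth_involution D Phi sigma.
Context {m : nat} (J : forall d, 'M[A d]_m).
Hypothesis hJsmooth : smooth_map [set: Delta] D (mx_atlas D Phi m) (section J).
Hypothesis hJherm : forall d, Herm (sigma d) (J d).
Hypothesis hJnondeg : forall d, invertible (J d).

Let gD : compatible_atlas D. Proof. exact: smooth_manifold_compatible hD. Qed.
Let gE := algebra_total_compatible hA.

Lemma sigmaK d : involutive (sigma d). Proof. by have [H _ _ _ _] := hsigma. Qed.
Lemma sigmaL d : linear (sigma d). Proof. by have [_ H _ _ _] := hsigma. Qed.
Lemma sigma1 d : sigma d 1 = 1. Proof. by have [_ _ H _ _] := hsigma. Qed.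
Lemma sigmaM d a b : sigma d (a * b) = sigma d b * sigma d a.
Proof. by have [_ _ _ H _] := hsigma. Qed.

Lemma mplot_dagger k (b : 'rV[R]_k -> Delta) (M : forall w, 'M[A (b w)]_m) v :
  mplot D Phi M v -> mplot D Phi (fun w => dagger (sigma (b w)) (M w)) v.
Proof.
move=> [pb pM]; split=> // i j; have [_ _ _ _ ss] := hsigma.
apply: plot_ext (smooth_map_plot gE ss (pM j i) I) => w.
by rewrite /= /fiberwise1 /= !mxE.
Qed.

Lemma mplot_J k (b : 'rV[R]_k -> Delta) v : plot_at D b v ->
  mplot D Phi (fun w => J (b w)) v.
Proof.
by move=> pb; apply/(mplotP hD hA); exact: (smooth_map_plot gD hJsmooth pb I).
Qed.

Definition defect d (X : 'M[A d]_m) : 'M[A d]_m :=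
  dagger (sigma d) X *m J d *m X - J d.

Lemma mplot_defect k (b : 'rV[R]_k -> Delta) (M : forall w, 'M[A (b w)]_m) v :
  mplot D Phi M v -> mplot D Phi (fun w => defect (M w)) v.
Proof.
move=> pM; have [pb _] := pM; have pJ := mplot_J pb.
by apply: (mplotB hD hA) => //; do 2 apply: (mplotM hD hA) => //; exact: mplot_dagger.
Qed.

(** A matrix with zero defect has the left inverse J^-1 X^dagger J, which is an
    inverse by finite dimensionality. *)
Lemma unitaryP d (X : 'M[A d]_m) : unitary (sigma d) (J d) X <-> defect X = 0.
Proof.
split=> [[_ XJX]|/subr0_eq XJX]; first by rewrite /defect XJX subrr.
split=> //; have [Y [_ YJ]] := hJnondeg d.
have ZX : (Y *m (dagger (sigma d) X *m J d)) *m X = 1%:M by rewrite -mulmxA XJX.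
have XZ := mulmx_inverseC hA ZX.
by exists (Y *m (dagger (sigma d) X *m J d)); split; [exact: XZ|exact: ZX].
Qed.

(** Here the Hermitian symmetry of J enters. *)
Lemma dagger_defect d (X : 'M[A d]_m) : dagger (sigma d) (defect X) = defect X.
Proof.
have HJ : dagger (sigma d) (J d) = J d := hJherm d.
rewrite /defect daggerB; last exact: sigmaL.
rewrite !daggerM; try exact: sigmaL; try exact: sigmaM.
rewrite daggerK; last exact: sigmaK.
by rewrite HJ mulmxA.
Qed.

Section LocalChart.
Context (s : 'I_m -> R).
Hypothesis ss : forall i, s i * s i = 1.
Hypothesis sJ : forall d, sign_conj s (J d) = J d.
Context (c : chart R Delta) (t : trivialization R (fun d => A d)).
Context (d0 : Delta) (X0 : 'M[A d0]_m).
Hypothesis Dc : D c.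
Hypothesis Pt : Phi t.
Hypothesis cd0 : cdom c d0.
Hypothesis td0 : tdom t d0.
Hypothesis uX0 : unitary (sigma d0) (J d0) X0.
Hypothesis sX0 : sign_conj s X0 = X0.

Let C : chart R {d : Delta & 'M[A d]_m} := total_chart c (mx_trivialization m t).
Let p := cdim c.
Let N := trank (mx_trivialization m t).
Let co d (X : 'M[A d]_m) : 'rV[R]_N := mcoord t X.
Let inv d (x : 'rV[R]_N) : 'M[A d]_m := @minv R Delta A m t d x.
Let b (w : 'rV[R]_(p + N)) : Delta := cinv c (lsubmx w).
Let M (w : 'rV[R]_(p + N)) : 'M[A (b w)]_m := inv (b w) (rsubmx w).
Let im : set 'rV[R]_(p + N) := cfun C @` cdom C.
Let x0 : 'rV[R]_p := cfun c d0.
Let a0 : 'rV[R]_N := co X0.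
Let w0 : 'rV[R]_(p + N) := row_mx x0 a0.

Let vc : chart_valid c. Proof. exact: gD.1. Qed.

Lemma image_base w : im w -> [/\ cdom c (b w), tdom t (b w) & cfun c (b w) = lsubmx w].
Proof.
move=> [[d X] /= [cd td] <-]; rewrite /b row_mxKl vc.2 //; split=> //.
Qed.

Lemma image_w0 : im w0.
Proof. by exists (existT _ d0 X0). Qed.

Lemma base_w0 : b w0 = d0.
Proof. by rewrite /b row_mxKl vc.2. Qed.

Lemma base_plot w : im w -> plot_at D b w.
Proof.
move=> [[d X] /= [cd td] <-]; apply: (plot_comp (f := cinv c)).
  by apply: smooth_at_lsubmx; exact: smooth_at_id.
by rewrite row_mxKl; exact: (chart_plot gD (atlas_max gD Dc) cd).
Qed.

Lemma matrix_plot w : im w -> mplot D Phi M w.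
Proof.
move=> iw; have [_ tw _] := image_base iw.
apply: (mplot_triv hD hA (x := rsubmx)) => //; first exact: base_plot.
by apply: smooth_at_rsubmx; exact: smooth_at_id.
Qed.

(** The defect, as a function of the coordinates. *)
Let Q w : 'rV[R]_N := co (defect (M w)).

Lemma smooth_Q w : im w -> smooth_at Q w.
Proof.
move=> iw; have [_ tw _] := image_base iw.
by apply: (mplot_coord hD hA) => //; apply: mplot_defect; exact: matrix_plot.
Qed.

Let Dg w : 'M[R]_N := opmx t (fun X : 'M[A (b w)]_m => dagger (sigma (b w)) X).

Lemma smooth_Dg w : im w -> smooth_at Dg w.
Proof.
move=> iw; have [_ tw _] := image_base iw.
by apply: (opmx_smooth hD hA) => //; [exact: base_plot|move=> M'; exact: mplot_dagger].
Qed.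

(** The projector onto the Hermitian matrices, in coordinates. *)
Let P w : 'M[R]_N := 2^-1 *: (1%:M + Dg w).

Lemma rlinear_dag d : @rlinear R (A d) m (dagger (sigma d)).
Proof. by apply: rlinear_dagger; exact: sigmaL. Qed.

Lemma Dg_idem w : im w -> Dg w *m Dg w = 1%:M.
Proof.
move=> iw; have [_ tw _] := image_base iw; have rd := @rlinear_dag (b w).
rewrite /Dg -(opmx_comp hA) //; apply: (opmx_id hA) => // X /=.
by apply: daggerK; exact: sigmaK.
Qed.

Lemma Q_Dg w : im w -> Q w *m Dg w = Q w.
Proof.
move=> iw; have [_ tw _] := image_base iw; have rd := @rlinear_dag (b w).
by rewrite /Q /Dg (mcoord_opmx hA) // dagger_defect.
Qed.

Lemma Q_P w : im w -> Q w *m P w = Q w.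
Proof.
move=> iw; rewrite /P -scalemxAr mulmxDr mulmx1 Q_Dg // scalerDr -scalerDl.
by rewrite -[RHS]scale1r; congr (_ *: _); field.
Qed.

Lemma P_idem w : im w -> P w *m P w = P w.
Proof.
move=> iw; rewrite /P -scalemxAl -scalemxAr scalerA mulmxDl mul1mx mulmxDr mulmx1.
rewrite Dg_idem // [Dg w + 1%:M]addrC scalerDr -scalerDl; congr (_ *: _).
by field.
Qed.

Let P0 := P w0.
Let S0 : 'M[R]_N := 1%:M - P0.

Let near_dom : set 'rV[R]_(p + N) := [set w | im w /\ 1%:M - P w + P0 \in unitmx].

Lemma near_dom_w0 : nbhs w0 near_dom.
Proof.
have Cm : mx_atlas D Phi m C by exists c, (mx_trivialization m t); split=> //; exists t.
have [oC _] := (mx_compatible hD hA (m := m)).1 _ Cm.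
have sP : smooth_at (fun w => 1%:M - P w + P0) w0.
  apply: smooth_atD; last exact: smooth_at_cst.
  apply: smooth_atB; first exact: smooth_at_cst.
  apply: smooth_atZ; apply: smooth_atD; first exact: smooth_at_cst.
  by apply: smooth_Dg; exact: image_w0.
have nP : \forall w \near w0, 1%:M - P w + P0 \in unitmx.
  by apply: (unitmx_near _ _ _ sP); rewrite subrK unitmx1.
have nI : nbhs w0 im by apply: open_nbhs_nbhs; split=> //; exact: image_w0.
exact: filterI nI nP.
Qed.

(** If P w is the projector at w then Q P w = Q, so Q P0 = 0 forces
    Q (1 - P w + P0) = 0, and this matrix is invertible near w0. *)
Lemma defect_eq0 w : near_dom w -> Q w *m P0 = 0 -> Q w = 0.
Proof.
move=> [iw uw] QP; have := congr1 (mulmx (Q w)) (mulmxV uw).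
rewrite mulmxA mulmxDr mulmxBr mulmx1 Q_P // subrr add0r QP mul0mx.
by move=> <-.
Qed.

(** Left multiplication by X0^dagger J, in coordinates. *)
Let LK : 'M[R]_N := opmx t (mulmx (dagger (sigma d0) X0 *m J d0)).

Lemma LK_unit : LK \in unitmx.
Proof.
have [[Y [XY YX]] XJX] := uX0; have [Z [JZ ZJ]] := hJnondeg d0.
have L1 : (dagger (sigma d0) X0 *m J d0) *m (X0 *m Z) = 1%:M.
  by rewrite mulmxA XJX.
have L2 := mulmx_inverseC hA L1.
have : opmx t (mulmx (X0 *m Z)) *m LK = 1%:M.
  rewrite /LK -(opmx_comp hA) //; try exact: rlinear_mulmx.
  by apply: (opmx_id hA) => // W /=; rewrite mulmxA L1 mul1mx.
by case/mulmx1_unit.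
Qed.

Let sgrow : 'rV[R]_N :=
  mxvec (\matrix_(q < m * m, k < trank t) (mxvec (\matrix_(i, j) (s i * s j)) 0 q)).

(** The sign conjugation in coordinates: it is the same matrix in all fibers. *)
Let T : 'M[R]_N := diag_mx sgrow.

Lemma sgrowE i j k : sgrow 0 (mxvec_index (mxvec_index i j) k) = s i * s j.
Proof. by apply: etrans (mxvecE _ _ _) _; rewrite mxE mxvecE mxE. Qed.

Lemma coord_sign d (X : 'M[A d]_m) : tdom t d -> co (sign_conj s X) = co X *m T.
Proof.
move=> td; rewrite mul_mx_diag; apply/rowP => q; rewrite [RHS]mxE.
case/mxvec_indexP: q => q k; case/mxvec_indexP: q => i j.
rewrite sgrowE /co !mcoordE mxE.
have lt := tfun_linear hA Pt td; have := lt (s i * s j) (X i j) 0.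
have t0 : tfun t d 0 = 0.
  by have := lt 1 0 0; rewrite !scale1r addr0 -{1}[tfun t d 0]addr0 => /addrI.
by rewrite addr0 t0 addr0 => ->; rewrite mxE mulrC.
Qed.

Lemma T_opmx d : tdom t d -> T = opmx t (fun X : 'M[A d]_m => sign_conj s X).
Proof.
move=> td; apply/row_matrixP => i; rewrite !rowE.
rewrite (opmxE hA) //; last exact: rlinear_sign_conj.
by rewrite -/(co _) coord_sign // /co (minvK hA).
Qed.

Lemma TT : T *m T = 1%:M.
Proof.
rewrite (T_opmx td0) -(opmx_comp hA) //; try exact: rlinear_sign_conj.
by apply: (opmx_id hA) => // X /=; exact: sign_conjK.
Qed.

Lemma Dg_T w : im w -> Dg w *m T = T *m Dg w.
Proof.
move=> iw; have [_ tw _] := image_base iw; have rd := @rlinear_dag (b w).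
have rs := @rlinear_sign_conj R (A (b w)) m s.
rewrite (T_opmx tw) /Dg -!(opmx_comp hA) //; congr opmx; apply/funext => X /=.
by rewrite sign_conj_dagger //; exact: sigmaL.
Qed.

Lemma P0_T : P0 *m T = T *m P0.
Proof.
rewrite /P0 /P -scalemxAl -scalemxAr mulmxDl mulmxDr mul1mx mulmx1 Dg_T //.
exact: image_w0.
Qed.

Lemma LK_T : LK *m T = T *m LK.
Proof.
have rs := @rlinear_sign_conj R (A d0) m s.
rewrite (T_opmx td0) /LK -!(opmx_comp hA) //; try exact: rlinear_mulmx.
congr opmx; apply/funext => X /=; rewrite !sign_conjM //.
by rewrite -sign_conj_dagger ?sX0 ?sJ //; exact: sigmaL.
Qed.

Lemma a0_T : a0 *m T = a0.
Proof. by rewrite /a0 -coord_sign // sX0. Qed.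

(** The base coordinates are kept; the skew part of X0^dagger J (X - X0) and the
    Hermitian part of the defect become the fiber coordinates. *)
Let Psi w : 'rV[R]_(p + N) :=
  row_mx (lsubmx w) ((rsubmx w - a0) *m LK *m S0 + Q w *m P0).

Lemma smooth_Psi w : im w -> smooth_at Psi w.
Proof.
move=> iw; apply: smooth_at_row_mx.
  by apply: smooth_at_lsubmx; exact: smooth_at_id.
apply: smooth_atD; last by apply: smooth_at_mulmx; [exact: smooth_Q|exact: smooth_at_cst].
do 2 (apply: smooth_at_mulmx; last exact: smooth_at_cst).
apply: smooth_atB; last exact: smooth_at_cst.
by apply: smooth_at_rsubmx; exact: smooth_at_id.
Qed.

Let Qd d (x : 'rV[R]_N) : 'rV[R]_N := co (defect (inv d x)).

Lemma Q_w0 : Q w0 = 0.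
Proof.
rewrite -[LHS]/(Qd (b w0) (rsubmx w0)) base_w0 row_mxKr /Qd /inv /a0 /co (mcoordK hA) //.
rewrite (unitaryP X0).1 // -(subrr (J d0)) (mcoordB hA) // subrr //.
Qed.

(** The defect is quadratic on the fiber over d0.  It vanishes at X0, and its linear
    part is K + K^dagger with K = X0^dagger J H. *)
Lemma Qd_line (h : 'rV[R]_N) : exists q : 'rV[R]_N, forall r : R,
  Qd d0 (r *: h + a0) = r *: (h *m LK *m (1%:M + Dg w0)) + r ^+ 2 *: q.
Proof.
pose H := inv d0 h; pose K := dagger (sigma d0) X0 *m J d0 *m H.
exists (co (dagger (sigma d0) H *m J d0 *m H)) => r.
have sc1 (X : 'M[A d0]_m) : scale_entries 1 X = X.
  by apply/matrixP => i j; rewrite mxE scale1r.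
have coL := fun r X Y => mcoord_linear hA r (X : 'M[A d0]_m) Y Pt td0.
have sL : linear (sigma d0) by exact: sigmaL.
have HJ : dagger (sigma d0) (J d0) = J d0 := hJherm d0.
have dK : dagger (sigma d0) K = dagger (sigma d0) H *m J d0 *m X0.
  rewrite /K !daggerM //; try exact: sigmaM.
  by rewrite daggerK ?HJ ?mulmxA //; exact: sigmaK.
have kE : h *m LK = co K.
  by rewrite (opmxE hA) //; exact: rlinear_mulmx.
have kD : co K *m Dg w0 = co (dagger (sigma d0) K).
  by rewrite /Dg base_w0 (mcoord_opmx hA) //; exact: rlinear_dag.
rewrite kE mulmxDr mulmx1 kD.
have defE : defect (inv d0 (r *: h + a0)) =
    scale_entries r (scale_entries 1 K + dagger (sigma d0) K)
    + (scale_entries (r ^+ 2) (dagger (sigma d0) H *m J d0 *m H) + 0).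
  have -> : inv d0 (r *: h + a0) = scale_entries r H + X0.
    by rewrite /inv (minv_linear hA) // /a0 /co (mcoordK hA).
  have [_ XJX] := uX0.
  rewrite /defect rlinear_dagger // !mulmxDl !mulmxDr XJX dK sc1.
  rewrite !(scale_mulmxl, scale_mulmxr) addr0.
  have -> : scale_entries r (K + dagger (sigma d0) H *m J d0 *m X0) =
     scale_entries r K + scale_entries r (dagger (sigma d0) H *m J d0 *m X0).
    by apply/matrixP => i j; rewrite !mxE scalerDr.
  have -> : scale_entries r (scale_entries r (dagger (sigma d0) H *m J d0 *m H)) =
     scale_entries (r ^+ 2) (dagger (sigma d0) H *m J d0 *m H).
    by apply/matrixP => i j; rewrite !mxE scalerA expr2.
  rewrite -/K addrA addrK [RHS]addrC -addrA; congr (_ + _).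
  by rewrite addrC.
rewrite /Qd defE /co coL coL coL scale1r; congr (_ + _).
have -> : mcoord t (0 : 'M[A d0]_m) = 0 by rewrite -(subrr X0) (mcoordB hA) // subrr.
by rewrite addr0.
Qed.

Lemma Psi_line (h : 'rV[R]_N) : exists q : 'rV[R]_(p + N), forall r : R,
  Psi (r *: row_mx 0 h + w0) = Psi w0
    + r *: row_mx 0 (h *m LK *m S0 + 2 *: (h *m LK *m P0)) + r ^+ 2 *: q.
Proof.
have [q qE] := Qd_line h; exists (row_mx 0 (q *m P0)) => r.
have lE : lsubmx (r *: row_mx 0 h + w0) = x0.
  by rewrite scale_row_mx add_row_mx row_mxKl scaler0 add0r.
have rE : rsubmx (r *: row_mx 0 h + w0) = r *: h + a0.
  by rewrite scale_row_mx add_row_mx row_mxKr.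
have bE : b (r *: row_mx 0 h + w0) = d0 by rewrite /b lE vc.2.
have QE : Q (r *: row_mx 0 h + w0) = Qd d0 (r *: h + a0).
  by rewrite -[LHS]/(Qd (b _) (rsubmx _)) bE rE.
have PP : (1%:M + Dg w0) *m P0 = 2 *: P0.
  have -> : 1%:M + Dg w0 = 2 *: P0.
    by rewrite /P0 /P scalerA mulfV // scale1r.
  by rewrite -scalemxAl P_idem //; exact: image_w0.
rewrite /Psi QE qE lE rE Q_w0 row_mxKl row_mxKr subrr !mul0mx addr0 addrK.
rewrite !scale_row_mx !add_row_mx !scaler0 !addr0 add0r; congr row_mx.
rewrite mulmxDl -!scalemxAl -[in LHS](mulmxA (h *m LK)) PP -scalemxAr scalerDr.
by rewrite addrA.
Qed.

(** The component along the base shows that v is vertical.  On vertical vectors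
    the differential is h |-> k S0 + 2 k P0 with k = h LK, and the two terms lie in
    complementary subspaces. *)
Lemma diff_Psi_inj v : 'd Psi w0 v = 0 -> v = 0.
Proof.
have dP : differentiable Psi w0.
  by apply: smooth_at_differentiable; apply: smooth_Psi; exact: image_w0.
move=> dv.
have lv : lsubmx v = 0.
  have cl : continuous (lsubmx : 'rV[R]_(p + N) -> 'rV[R]_p).
    by move=> y; exact: continuous_lsubmx.
  have := @diff_postlin R _ _ _ (lsubmx : {linear 'rV[R]_(p + N) -> 'rV[R]_p}) Psi w0 v cl dP.
  rewrite dv linear0 => <-.
  have -> : lsubmx \o Psi = (lsubmx : 'rV[R]_(p + N) -> 'rV[R]_p).
    by apply/funext => w; rewrite /= row_mxKl.
  apply/esym; apply: (@diff_quadratic _ _ _ _ _ _ _ 0).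
    by apply: smooth_at_differentiable; apply: smooth_at_lsubmx; exact: smooth_at_id.
  by move=> r; rewrite scaler0 addr0 linearD linearZ addrC.
have vE : v = row_mx 0 (rsubmx v) by rewrite -lv hsubmxK.
set h := rsubmx v in vE; have [q qE] := Psi_line h.
move: dv; rewrite vE (diff_quadratic dP qE) => /(congr1 rsubmx).
rewrite row_mxKr linear0 => E0.
have PP := P_idem image_w0.
have kP : h *m LK *m P0 = 0.
  have := congr1 (mulmxr P0) E0; rewrite /= mul0mx mulmxDl -scalemxAl -!mulmxA.
  have -> : S0 *m P0 = 0 by rewrite /S0 mulmxBl mul1mx PP subrr.
  rewrite -/P0 in PP; rewrite PP !mulmx0 add0r => /eqP.
  by rewrite scaler_eq0 pnatr_eq0 /= => /eqP.
move: E0; rewrite kP scaler0 addr0 /S0 mulmxBr mulmx1 kP subr0 => hLK.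
have -> : h = 0 by rewrite -(mulmxK LK_unit h) hLK mul0mx.
by rewrite row_mx0.
Qed.

Lemma Q_cfun u : cdom C u -> Q (cfun C u) = co (defect (tagged u)).
Proof.
case: u => d X [/= cd td]; rewrite -[LHS]/(Qd (b _) (rsubmx _)) /b row_mxKl vc.2 //.
by rewrite row_mxKr /Qd /inv (mcoordK hA).
Qed.

Lemma unitary_Q u : cdom C u ->
  unitary (sigma (tag u)) (J (tag u)) (tagged u) <-> Q (cfun C u) = 0.
Proof.
move=> Cu; have [_ td] := Cu; rewrite Q_cfun // unitaryP.
have c0 : co (0 : 'M[A (tag u)]_m) = 0.
  by rewrite /co -(subrr (0 : 'M[A (tag u)]_m)) (mcoordB hA) // subrr.
by split=> [->//|]; rewrite -c0 => /(can_inj (mcoordK hA Pt td)).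
Qed.

Let tauc (w : 'rV[R]_(p + N)) : 'rV[R]_(p + N) := row_mx (lsubmx w) (rsubmx w *m T).

Lemma smooth_tauc w : smooth_at tauc w.
Proof.
apply: smooth_at_row_mx; first by apply: smooth_at_lsubmx; exact: smooth_at_id.
apply: smooth_at_mulmx; last exact: smooth_at_cst.
by apply: smooth_at_rsubmx; exact: smooth_at_id.
Qed.

(** Sign conjugation is an automorphism fixing J and commuting with the
    adjoint, so that it commutes with the defect. *)
Lemma Q_tauc w : im w -> Q w = 0 -> Q (tauc w) = 0.
Proof.
move=> iw Q0; have [_ tw _] := image_base iw.
have -> : Q (tauc w) = Qd (b w) (rsubmx w *m T).
  by rewrite -[LHS]/(Qd (b _) (rsubmx _)) /tauc /b row_mxKl row_mxKr.
have iE : inv (b w) (rsubmx w *m T) = sign_conj s (M w).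
  rewrite -[LHS](mcoordK hA Pt tw) /inv (minvK hA) // -[RHS](mcoordK hA Pt tw).
  by rewrite -/(co _) coord_sign // /M /inv /co (minvK hA).
rewrite /Qd iE.
have -> : defect (sign_conj s (M w)) = sign_conj s (defect (M w)).
  rewrite /defect sign_conjB sJ !sign_conjM // sJ sign_conj_dagger //.
  exact: sigmaL.
by rewrite coord_sign // -/(Q w) Q0 mul0mx.
Qed.

(** The domain is made stable under the sign conjugation, which commutes with the
    chart on unitary matrices.  There a matrix is fixed by the conjugation when the
    skew coordinates are, i.e. when their component in the -1 eigenspace vanishes. *)
Lemma unitary_local_chart : exists q1 q2 r
    (F : 'rV[R]_(p + N) -> 'rV[R]_((p + (q1 + q2)) + r)) G Om,
  [/\ local_diffeo F G Om, Om `<=` im & Om w0] /\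
  forall u, cdom C u -> Om (cfun C u) ->
   [/\ lsubmx (lsubmx (F (cfun C u))) = cfun c (tag u),
       unitary (sigma (tag u)) (J (tag u)) (tagged u) <-> rsubmx (F (cfun C u)) = 0 &
       unitary (sigma (tag u)) (J (tag u)) (tagged u) ->
         (sign_conj s (tagged u) = tagged u <->
          rsubmx (rsubmx (lsubmx (F (cfun C u)))) = 0)].
Proof.
have [U1 [g [dU Uw0 Usub]]] :=
  inverse_function Psi w0 near_dom (smooth_Psi image_w0) diff_Psi_inj near_dom_w0.
have [oU _ gK _ _] := dU.
pose Om : set 'rV[R]_(p + N) := U1 `&` (tauc @^-1` U1).
have oOm : open Om.
  apply: openI => //; apply: open_comp => // w _.
  exact/smooth_at_continuous/smooth_tauc.
have PP : P0 *m P0 = P0 by apply: P_idem; exact: image_w0.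
have [q1 [q2 [r [h [h' [[hK h'K sh sh'] hP]]]]]] :=
  @linear_splitting R p N P0 T PP TT P0_T.
exists q1, q2, r, (h \o Psi), (g \o h'), Om.
have OU : Om `<=` U1 by move=> w [].
split; first split.
- exact: local_diffeo_iso (local_diffeo_sub dU oOm OU) hK h'K sh sh'.
- by move=> w [/Usub []].
- split=> //; rewrite /= /tauc row_mxKl row_mxKr a0_T //.
move=> u Cu [Uu Uu']; set w := cfun C u in Uu Uu' *.
have [iw uw] := Usub _ Uu.
have [h1 h2 h3] := hP (Psi w); rewrite /=.
have SP : S0 *m P0 = 0 by rewrite /S0 mulmxBl mul1mx PP subrr.
have PsiP : rsubmx (Psi w) *m P0 = Q w *m P0.
  by rewrite row_mxKr mulmxDl -!mulmxA SP PP !mulmx0 add0r.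
split; first by rewrite h1 row_mxKl /w /= row_mxKl.
  split=> [/(unitary_Q Cu).1 Q0|/h2.1 QP]; last first.
    by apply/(unitary_Q Cu); apply: defect_eq0 => //; rewrite -PsiP.
  by apply/h2; rewrite PsiP -/w in Q0 *; rewrite Q0 mul0mx.
move=> /(unitary_Q Cu).1 Q0.
apply: iff_trans (iff_sym (h3 _)); last by rewrite PsiP -/w Q0 mul0mx.
have tu : tdom t (tag u) by case: Cu.
have PsiE w' : Q w' = 0 -> rsubmx (Psi w') = (rsubmx w' - a0) *m LK *m S0.
  by move=> Qw'; rewrite row_mxKr Qw' mul0mx addr0.
have ST : S0 *m T = T *m S0 by rewrite mulmxBl mulmxBr mul1mx mulmx1 P0_T.
have PsiT : rsubmx (Psi (tauc w)) = rsubmx (Psi w) *m T.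
  rewrite !PsiE //; last exact: Q_tauc.
  rewrite row_mxKr -[a0 in LHS]a0_T -mulmxBl -!mulmxA ST (mulmxA T) -LK_T.
  by rewrite !mulmxA.
have rw : rsubmx w = co (tagged u) by rewrite /w /= row_mxKr.
clearbody w.
split=> [su|PT].
  have tw : tauc w = w by rewrite /tauc rw -coord_sign // su -rw hsubmxK.
  by rewrite -PsiT tw.
have : Psi (tauc w) = Psi w.
  rewrite -[LHS]hsubmxK -[RHS]hsubmxK PsiT PT; congr row_mx.
  by rewrite !row_mxKl.
move=> /(congr1 g); rewrite !gK // => tw.
have E : co (sign_conj s (tagged u)) = co (tagged u).
  by rewrite coord_sign // -rw; have := congr1 rsubmx tw; rewrite row_mxKr.
exact: (can_inj (mcoordK hA Pt tu)) E.
Qed.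

End LocalChart.
End UnitaryCharts.

(** * Charts adapted to a projection *)

Section AdaptedCharts.
Context {R : realType} {B T : Type} (D : atlas R B) (pi : T -> B).
Hypothesis gD : compatible_atlas D.
Hypothesis pD : pts D = setT.

(** The chart of the base is imposed, so that two points of the same fiber admit
    adapted charts over the same chart of the base. *)
Definition adapted (A : atlas R T) (x : T) : Prop :=
  forall c, D c -> cdom c (pi x) ->
  exists q (V : set T) (f : T -> 'rV[R]_(cdim c + q)) g,
    [/\ A (Chart V f g), V x &
        forall y, V y -> cdom c (pi y) /\ lsubmx (f y) = cfun c (pi y)].

Context (A : atlas R T).
Hypothesis gA : compatible_atlas A.
Hypothesis adA : forall x, pts A x -> adapted A x.

Lemma base_chart_at b : exists2 c, D c & cdom c b.
Proof. by have : pts D b by rewrite pD. Qed.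

Lemma proj_plot k (f : 'rV[R]_k -> T) v : plot_at A f v -> plot_at D (pi \o f) v.
Proof.
move=> pf; have [c Dc cv] := base_chart_at (pi (f v)).
have [q [V [h [g [Ac Vx adx]]]]] := adA (plot_pts pf) Dc cv.
have [nV sh] := plot_chart gA pf (atlas_max gA Ac) Vx.
exists c; split=> //.
  by apply: filterS nV => w /adx [].
apply: (@smooth_at_eq _ _ _ (fun w => lsubmx (h (f w)))).
  by apply: filterS nV => w /adx [].
exact: smooth_at_lsubmx sh.
Qed.

(** In an adapted chart the projection is [lsubmx]. *)
Lemma adapted_submersion S : S `<=` pts A -> submersion S A D pi.
Proof.
move=> SA; split.
  by apply: smooth_map_intro => // k f v pf _; exact: proj_plot.
move=> x /SA Ax; have [c Dc cv] := base_chart_at (pi x).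
have [q [V [h [g [Ac Vx adx]]]]] := adA Ax Dc cv.
exists (Chart V h g), c; split=> // w.
have vh := gA.1 _ Ac.
have nE : \forall z \near h x, lsubmx z = in_charts (Chart V h g) c pi z.
  apply: filterS (chart_image_near vh Vx) => z [/= Vz hz].
  by rewrite /in_charts /=; have [_ <-] := adx _ Vz; rewrite hz.
have sl : smooth_at (lsubmx : 'rV[R]_(cdim c + q) -> 'rV[R]_(cdim c)) (h x).
  by apply: smooth_at_lsubmx; exact: smooth_at_id.
exists (row_mx w 0); rewrite -deriveE; last first.
  exact/smooth_at_differentiable/(smooth_at_eq _ _ _ _ nE sl).
rewrite -(near_eq_derive _ nE) deriveE; last exact: smooth_at_differentiable.
apply: (@diff_quadratic _ _ _ _ _ _ _ 0); first exact: smooth_at_differentiable.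
by move=> r; rewrite scaler0 addr0 linearD linearZ /= row_mxKl addrC.
Qed.

(** In an adapted chart the fiber is given by the vanishing of the difference of
    the base coordinates with those of d. *)
Lemma adapted_fiber S d : pts A = S -> fiber pi S d `<=` pts (sub_atlas A (fiber pi S d)).
Proof.
move=> pA x [Sx px]; have [c Dc cd] := base_chart_at d.
have Ax : pts A x by rewrite pA.
rewrite -px in cd; have [q [V [h [g [Ac Vx adx]]]]] := adA Ax Dc cd.
have vh := gA.1 _ Ac.
set W : set 'rV[R]_(cdim c + q) := h @` V.
pose F (w : 'rV[R]_(cdim c + q)) : 'rV[R]_(q + cdim c) :=
  row_mx (rsubmx w) (lsubmx w - cfun c d).
pose G (w : 'rV[R]_(q + cdim c)) : 'rV[R]_(cdim c + q) :=
  row_mx (rsubmx w + cfun c d) (lsubmx w).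
have dF : local_diffeo F G W.
  apply: iso_local_diffeo; first exact: vh.1.
  - by move=> w; rewrite /F /G row_mxKl row_mxKr subrK hsubmxK.
  - by move=> w; rewrite /F /G row_mxKl row_mxKr addrK hsubmxK.
  - move=> w; apply: smooth_at_row_mx; first by apply: smooth_at_rsubmx; exact: smooth_at_id.
    apply: smooth_atB; last exact: smooth_at_cst.
    by apply: smooth_at_lsubmx; exact: smooth_at_id.
  - move=> w; apply: smooth_at_row_mx; last by apply: smooth_at_lsubmx; exact: smooth_at_id.
    apply: smooth_atD; last exact: smooth_at_cst.
    by apply: smooth_at_rsubmx; exact: smooth_at_id.
have sl := @slice_intro _ _ A (fiber pi S d) (Chart V h g) _ _ F G W gA (atlas_max gA Ac).
eexists; first apply: sl => //.
  move=> y /= Vy _; have [cy hy] := adx y Vy; rewrite /F row_mxKr hy.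
  have vc := gD.1 _ Dc; split=> [[_ ->]|/eqP]; first by rewrite subrr.
  rewrite subr_eq0 => /eqP /(congr1 (cinv c)); rewrite -px !vc.2 // px => py.
  by split=> //; rewrite -pA; exists (Chart V h g).
by split=> //; split=> //; exists x.
Qed.

(** In adapted charts of the two factors over the same chart of the base, the fiber
    square is given by the equality of the two base coordinates. *)
Lemma adapted_square S : pts A = S ->
  fiber_square pi S `<=` pts (fiber_square_atlas pi S A).
Proof.
move=> pA [x1 x2] [/= Sx1 Sx2 px]; have [c Dc c1] := base_chart_at (pi x1).
have c2 : cdom c (pi x2) by rewrite -px.
have Ax1 : pts A x1 by rewrite pA.
have Ax2 : pts A x2 by rewrite pA.
have [q1 [V1 [h1 [g1 [Ac1 V1x ad1]]]]] := adA Ax1 Dc c1.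
have [q2 [V2 [h2 [g2 [Ac2 V2x ad2]]]]] := adA Ax2 Dc c2.
pose p := cdim c.
pose C := prod_chart (Chart V1 h1 g1) (Chart V2 h2 g2).
have gP : compatible_atlas (prod_atlas A A) by exact: prod_compatible.
have PC : prod_atlas A A C by exists (Chart V1 h1 g1), (Chart V2 h2 g2).
have vC := gP.1 _ PC.
pose F (w : 'rV[R]_((p + q1) + (p + q2))) : 'rV[R]_(((p + q1) + q2) + p) :=
  row_mx (row_mx (lsubmx w) (rsubmx (rsubmx w))) (lsubmx (rsubmx w) - lsubmx (lsubmx w)).
pose G (w : 'rV[R]_(((p + q1) + q2) + p)) : 'rV[R]_((p + q1) + (p + q2)) :=
  row_mx (lsubmx (lsubmx w))
    (row_mx (rsubmx w + lsubmx (lsubmx (lsubmx w))) (rsubmx (lsubmx w))).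
have sid k (w : 'rV[R]_k) : smooth_at id w by exact: smooth_at_id.
have dF : local_diffeo F G (cfun C @` cdom C).
  apply: iso_local_diffeo; first exact: vC.1.
  - by move=> w; rewrite /F /G !(row_mxKl, row_mxKr) subrK !hsubmxK.
  - by move=> w; rewrite /F /G !(row_mxKl, row_mxKr) addrK !hsubmxK.
  - move=> w; apply: smooth_at_row_mx; first apply: smooth_at_row_mx.
    + exact: smooth_at_lsubmx (sid _ _).
    + exact: smooth_at_rsubmx (smooth_at_rsubmx _ _ _ _ _ (sid _ _)).
    + apply: smooth_atB; first exact: smooth_at_lsubmx (smooth_at_rsubmx _ _ _ _ _ (sid _ _)).
      exact: smooth_at_lsubmx (smooth_at_lsubmx _ _ _ _ _ (sid _ _)).
  - move=> w; have s1 := smooth_at_lsubmx _ _ _ _ _ (sid _ w).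
    apply: smooth_at_row_mx; first exact: smooth_at_lsubmx s1.
    apply: smooth_at_row_mx; last exact: smooth_at_rsubmx s1.
    apply: smooth_atD; first exact: smooth_at_rsubmx (sid _ _).
    exact: smooth_at_lsubmx (smooth_at_lsubmx _ _ _ _ _ s1).
have sl := @slice_intro _ _ (prod_atlas A A) (fiber_square pi S) C _ _ F G (cfun C @` cdom C) gP (atlas_max gP PC).
eexists; first apply: sl => //.
  move=> [y1 y2] /= [V1y V2y] _; have [cy1 hy1] := ad1 y1 V1y.
  have [cy2 hy2] := ad2 y2 V2y.
  rewrite /F !(row_mxKl, row_mxKr) hy1 hy2.
  have vc := gD.1 _ Dc; split=> [[/= _ _ ->]|/eqP]; first by rewrite subrr.
  rewrite subr_eq0 => /eqP /(congr1 (cinv c)); rewrite !vc.2 // => py.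
  by split=> //=; rewrite -?pA //; [exists (Chart V1 h1 g1)|exists (Chart V2 h2 g2)].
by split=> //; split=> //; exists (x1, x2).
Qed.

End AdaptedCharts.

(** * Unitary groups and stabilizers over one algebra *)

Section TotalMatrixMaps.
Context {Delta : choiceType} {F : Delta -> Type}.

Lemma existT_tagged_as (u v : {d : Delta & F d}) : tag u = tag v ->
  existT F (tag u) (tagged_as u v) = v.
Proof.
case: u v => [i x] [j y] /= ij; subst j; congr existT.
exact: (@tagged_asE _ F (existT F i x) y).
Qed.

Lemma fiberwise2E (op : forall d, F d -> F d -> F d) d (x y : F d) :
  fiberwise2 op (existT F d x) (existT F d y) = existT F d (op d x y).
Proof.
rewrite /fiberwise2 /=; congr existT; congr op.
exact: (@tagged_asE _ F (existT F d x) y).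
Qed.

End TotalMatrixMaps.

Section UnitaryGroup.
Context {R : realType} {K : algType R} (sigma : K -> K).
Hypothesis sK : involutive sigma.
Hypothesis sL : linear sigma.
Hypothesis s1 : sigma 1 = 1.
Hypothesis sM : forall a b, sigma (a * b) = sigma b * sigma a.

Section AnySize.
Context {m : nat} (J : 'M[K]_m).
Implicit Types X Y : 'M[K]_m.

Lemma inverseP X : invertible X -> is_inverse X (inverse X).
Proof.
move=> [Y XY].
exact: (@xgetPex _ 0 [set y | is_inverse X y] (ex_intro _ Y XY)).
Qed.

Lemma is_inverseM X X' Y Y' : is_inverse X X' -> is_inverse Y Y' ->
  is_inverse (X *m Y) (Y' *m X').
Proof.
move=> [x1 x2] [y1 y2]; split; rewrite -[LHS]/(_ *m _).
  by rewrite mulmxA -(mulmxA X) [Y *m Y']y1 mulmx1.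
by rewrite mulmxA -(mulmxA Y') [X' *m X]x2 mulmx1.
Qed.

Lemma unitary_one : unitary sigma J 1%:M.
Proof.
split; first by exists 1%:M; split; rewrite -[LHS]/(_ *m _) mulmx1.
by rewrite dagger1 // mul1mx mulmx1.
Qed.

Lemma unitary_mul X Y : unitary sigma J X -> unitary sigma J Y ->
  unitary sigma J (X *m Y).
Proof.
move=> [[X' iX] XJX] [[Y' iY] YJY]; split; first by exists (Y' *m X'); exact: is_inverseM.
rewrite daggerM // !mulmxA -(mulmxA _ (dagger sigma X)) -(mulmxA _ _ X) XJX.
exact: YJY.
Qed.

Lemma unitary_inverse X : unitary sigma J X -> unitary sigma J (inverse X).
Proof.
move=> [iX XJX]; have [i1 i2] := inverseP iX.
split; first by exists X; split.
rewrite -{1}XJX !mulmxA -daggerM // [X *m inverse X]i1 dagger1 // mul1mx.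
by rewrite -mulmxA [X *m inverse X]i1 mulmx1.
Qed.

Lemma inverse_mulmxl X : invertible X -> inverse X *m X = 1%:M.
Proof. by move=> /inverseP []. Qed.

Lemma inverse_mulmxr X : invertible X -> X *m inverse X = 1%:M.
Proof. by move=> /inverseP []. Qed.

Lemma sign_conj_inverse (s : 'I_m -> R) X : (forall i, s i * s i = 1) ->
  invertible X -> sign_conj s X = X -> sign_conj s (inverse X) = inverse X.
Proof.
move=> ss iX sX; set Y := inverse X.
have YX : Y *m X = 1%:M by exact: inverse_mulmxl.
have XY : X *m Y = 1%:M by exact: inverse_mulmxr.
have d1 : sign_conj s (1%:M : 'M[K]_m) = 1%:M.
  by apply: sign_conj_diag => //; exact: scalar_mx_is_diag.
rewrite -[LHS]mulmx1 -XY mulmxA -[X in _ *m X *m _]sX -sign_conjM // YX d1 mul1mx.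
by [].
Qed.

End AnySize.

Lemma diagonal_form m (J X : 'M[K]_m) i j : is_diag_mx J ->
  (dagger sigma X *m J *m X) i j = \sum_k sigma (X k i) * J k k * X k j.
Proof.
move=> /is_diag_mxP dJ; rewrite mxE; apply: eq_bigr => k _; congr (_ * _).
rewrite mxE (bigD1 k) //= big1 ?addr0; first by rewrite !mxE.
by move=> l lk; rewrite dJ // mulr0.
Qed.

(** The matrices fixed by conjugation with these signs are the block diagonal
    ones, see [sign_conj_last]. *)
Definition last_sign {n : nat} (i : 'I_(n + 1)) : R :=
  (-1) ^+ (i == rshift n ord0).

Lemma last_signK n (i : 'I_(n + 1)) : last_sign i * last_sign i = 1.
Proof. by rewrite /last_sign -expr2 sqrr_sign. Qed.

Lemma last_signl n (i : 'I_n) : last_sign (lshift 1 i) = 1.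
Proof. by rewrite /last_sign eq_lrshift expr0. Qed.

Lemma last_signr n (i : 'I_1) : last_sign (rshift n i) = -1.
Proof. by rewrite /last_sign (ord1 i) eqxx expr1. Qed.

Lemma opp_fixed_eq0 (a : K) : (-1 : R) *: a = a -> a = 0.
Proof.
rewrite scaleN1r => /eqP; rewrite eq_sym -subr_eq0 opprK => /eqP aa.
have : (2 : R) *: a = 0 by rewrite scaler_nat mulr2n.
by move=> /(congr1 (GRing.scale (2^-1 : R))); rewrite scalerA mulVf // scale1r scaler0.
Qed.

Lemma sign_conj_last n (X : 'M[K]_(n + 1)) : sign_conj last_sign X = X <->
  ursubmx X = 0 /\ dlsubmx X = 0.
Proof.
split=> [sX|[ur dl]].
  split; apply/matrixP => i j; rewrite !mxE; apply: opp_fixed_eq0;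
    rewrite -[RHS](congr1 (fun Z : 'M[K]_(n + 1) => Z _ _) sX) mxE ?last_signl ?last_signr.
    by rewrite mul1r.
  by rewrite mulr1.
rewrite -[RHS]submxK -[X in LHS]submxK ur dl; apply/matrixP => i j; rewrite mxE.
case: (split_ordP i) => i' ->; case: (split_ordP j) => j' ->;
  rewrite ?last_signl ?last_signr ?(block_mxEul, block_mxEur, block_mxEdl, block_mxEdr) ?mxE
    ?scaler0 //.
- by rewrite mulr1 scale1r.
- by rewrite mulrNN mulr1 scale1r.
Qed.

(** For a block triangular X with last row (v, al), the entries of X^dagger J X
    left of the last diagonal one are sigma(al) j v, where j is the last diagonal
    entry of J.  They vanish, while al and j are invertible, so that v = 0.
    Conversely, the inverse of a block diagonal matrix has inverse diagonal blocks. *)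
Lemma unitary_stabilizerP n (J X : 'M[K]_(n + 1)) : is_diag_mx J -> invertible J ->
  unitary_stabilizer sigma J X <-> unitary sigma J X /\ sign_conj last_sign X = X.
Proof.
move=> dJ [J' [JJ' J'J]]; pose l : 'I_(n + 1) := rshift n ord0.
have /is_diag_mxP dJ' := dJ.
split=> [[uX [X1 [v [al [iX1 [be [ab ba]] XE]]]]]|[uX /sign_conj_last [ur dl]]].
  split=> //; apply/sign_conj_last; rewrite XE block_mxKur block_mxKdl; split=> //.
  apply/rowP => j; have [_ XJX] := uX.
  have Jl : J' l l * J l l = 1.
    have := congr1 (fun Z : 'M[K]_(n + 1) => Z l l) J'J; rewrite [in X in X -> _]mxE.
    rewrite (bigD1 l) //= big1 ?addr0 => [->|k kl]; first by rewrite mxE eqxx.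
    by rewrite dJ' // mulr0.
  have := congr1 (fun Z : 'M[K]_(n + 1) => Z l (lshift 1 j)) XJX.
  rewrite diagonal_form // dJ'; last by rewrite /= addn0 neq_ltn ltn_ord orbT.
  rewrite big_split_ord /= big1 ?add0r => [|k _]; last first.
    by rewrite XE block_mxEur mxE invol_zero // !mul0r.
  rewrite big_ord1 XE block_mxEdr block_mxEdl mxE eqxx mulr1n => E0.
  have : J' l l * (sigma be * (sigma al * J l l * v 0 j)) = 0.
    by rewrite [sigma al * _ * _](_ : _ = 0) ?mulr0 // -E0 (ord1 0).
  by rewrite !mulrA -(mulrA _ (sigma be)) -sM ab s1 mulr1 Jl mul1r => ->; rewrite mxE.
split=> //; have [[Y [XY YX]] _] := uX.
have XE : X = block_mx (ulsubmx X) 0 0 (drsubmx X) by rewrite -{1}[X]submxK ur dl.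
have [e1 e2] : ulsubmx X *m ulsubmx Y = 1%:M /\ drsubmx X *m drsubmx Y = 1%:M.
  have : X *m Y = 1%:M := XY.
  rewrite {1}XE -{1}[Y]submxK mulmx_block !mul0mx !addr0 !add0r (scalar_mx_block _ _ 1) => /eq_block_mx.
  by move=> [E1 _ _ E2]; split; [exact: E1|exact: E2].
have [e3 e4] : ulsubmx Y *m ulsubmx X = 1%:M /\ drsubmx Y *m drsubmx X = 1%:M.
  have : Y *m X = 1%:M := YX.
  rewrite {1}XE -{1}[Y]submxK mulmx_block !mulmx0 !addr0 !add0r (scalar_mx_block _ _ 1) => /eq_block_mx.
  by move=> [E1 _ _ E2]; split; [exact: E1|exact: E2].
exists (ulsubmx X), 0, (drsubmx X 0 0); split.
- by exists (ulsubmx Y); split.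
- have mulE (Z Z' : 'M[K]_1) : Z 0 0 * Z' 0 0 = (Z *m Z') 0 0.
    by rewrite mxE big_ord1 (ord1 0).
  have oneE : (1%:M : 'M[K]_1) 0 0 = 1 by rewrite mxE eqxx.
  by exists (drsubmx Y 0 0); split; rewrite mulE ?e2 ?e4 oneE.
- by rewrite -mx11_scalar.
Qed.

End UnitaryGroup.

(** * The family of unitary geometries *)

Section UnitaryFamily.
Context {R : realType} {Delta : choiceType} (D : atlas R Delta).
Context {A : Delta -> algType R} (Phi : set (trivialization R (fun d => A d))).
Hypothesis hD : smooth_manifold [set: Delta] D.
Hypothesis hA : smooth_family_of_algebras D Phi.
Context (sigma : forall d, A d -> A d).
Arguments sigma : clear implicits.
Hypothesis hsigma : smooth_involution D Phi sigma.
Context {n : nat} (J : forall d, 'M[A d]_(n + 1)).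
Hypothesis hJsmooth : smooth_map [set: Delta] D (mx_atlas D Phi (n + 1)) (section J).
Hypothesis hJherm : forall d, Herm (sigma d) (J d).
Hypothesis hJnondeg : forall d, invertible (J d).
Hypothesis hJdiag : forall d, is_diag_mx (J d).

Let Mat := {d : Delta & 'M[A d]_(n + 1)}.
Let MA : atlas R Mat := mx_atlas D Phi (n + 1).
Let U : set Mat := [set u | unitary (sigma (tag u)) (J (tag u)) (tagged u)].
Let USt : set Mat :=
  [set u | unitary_stabilizer (sigma (tag u)) (J (tag u)) (tagged u)].
Let AU : atlas R Mat := sub_atlas MA U.
Let one : Delta -> Mat := section (fun d => 1%:M : 'M[A d]_(n + 1)).
Let mul : Mat -> Mat -> Mat := fiberwise2 (fun d (X Y : 'M[A d]_(n + 1)) => X *m Y).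
Let inv : Mat -> Mat := fiberwise1 (fun d (X : 'M[A d]_(n + 1)) => inverse X).
Let mk d (X : 'M[A d]_(n + 1)) : Mat := existT (fun d => 'M[A d]_(n + 1)) d X.

Let gD : compatible_atlas D. Proof. exact: smooth_manifold_compatible hD. Qed.
Let pD : pts D = setT. Proof. by have [] := hD. Qed.
Let gM : compatible_atlas MA. Proof. exact: mx_compatible. Qed.
Let gU : compatible_atlas AU. Proof. exact: sub_compatible. Qed.

(** The slice charts of the ambient bundle restricted to the unitary groups. *)
Lemma unitary_chart (s : 'I_(n + 1) -> R) u c : (forall i, s i * s i = 1) ->
  U u -> sign_conj s (tagged u) = tagged u -> D c -> cdom c (tag u) ->
  exists q1 q2 (V : set Mat) (f : Mat -> 'rV[R]_(cdim c + (q1 + q2))) g,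
    [/\ AU (Chart V f g), V u & forall y, V y ->
      [/\ cdom c (tag y), lsubmx (f y) = cfun c (tag y), U y &
          sign_conj s (tagged y) = tagged y <-> rsubmx (rsubmx (f y)) = 0]].
Proof.
move=> ss Uu su Dc cu; have [t Pt tu] := algebra_triv_cover hA (tag u).
have sJ d : sign_conj s (J d) = J d by exact: sign_conj_diag.
have [q1 [q2 [r [F [G [Om [[dF Osub Ou] H]]]]]]] :=
  unitary_local_chart hD hA hsigma hJsmooth hJherm hJnondeg ss sJ Dc Pt cu tu Uu su.
pose C := total_chart c (mx_trivialization (n + 1) t).
have MC : MA C by exists c, (mx_trivialization (n + 1) t); split=> //; exists t.
have sl := @slice_intro _ _ MA U C _ _ F G Om gM (atlas_max gM MC) Osub dF.
have {}sl := sl (fun y Cy Oy => let: And3 _ HU _ := H y Cy Oy in HU).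
exists q1, q2; do 3 eexists; split; first exact: sl.
- by split=> //; split=> //; split.
- move=> y [[Cy Oy] Uy]; have [H1 _ H3] := H y Cy Oy.
  by split=> //; [have [] := Cy|exact: H3].
Qed.

Lemma sign_conj1 d (X : 'M[A d]_(n + 1)) : sign_conj (fun=> 1 : R) X = X.
Proof. by apply/matrixP => i j; rewrite mxE mulr1 scale1r. Qed.

Lemma pts_U : pts AU = U.
Proof.
apply/seteqP; split; first exact: pts_sub_atlas.
move=> u Uu; have [c Dc cu] := base_chart_at pD (tag u).
have [q1 [q2 [V [f [g [AV Vu _]]]]]] :=
  unitary_chart (fun=> mulr1 (1 : R)) Uu (sign_conj1 _) Dc cu.
by exists (Chart V f g).
Qed.

Lemma adapted_U x : pts AU x -> adapted D tag AU x.
Proof.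
rewrite pts_U => Ux c Dc cx.
have [q1 [q2 [V [f [g [AV Vu H]]]]]] :=
  unitary_chart (fun=> mulr1 (1 : R)) Ux (sign_conj1 _) Dc cx.
by exists (q1 + q2)%N, V, f, g; split=> // y /H [].
Qed.

Lemma UStP u : USt u <-> U u /\ sign_conj last_sign (tagged u) = tagged u.
Proof.
apply: unitary_stabilizerP => //; first exact: (sigmaL hsigma).
  exact: (sigma1 hsigma).
exact: (sigmaM hsigma).
Qed.

(** By [unitary_chart] for the signs [last_sign], the stabilizers are given in an
    adapted chart of the unitary groups by the vanishing of the last coordinates. *)
Lemma adapted_USt x : USt x ->
  pts (sub_atlas AU USt) x /\ adapted D tag (sub_atlas AU USt) x.
Proof.
move=> Sx; have [Ux sx] := (UStP x).1 Sx.
have key c : D c -> cdom c (tag x) -> exists q (V : set Mat) (f : Mat -> 'rV_(cdim c + q)) g,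
    [/\ sub_atlas AU USt (Chart V f g), V x &
        forall y, V y -> cdom c (tag y) /\ lsubmx (f y) = cfun c (tag y)].
  move=> Dc cx.
  have [q1 [q2 [V [f [g [AV Vx H]]]]]] := unitary_chart (@last_signK R n) Ux sx Dc cx.
  have vf := gU.1 _ AV; pose p := cdim c.
  pose F (w : 'rV[R]_(p + (q1 + q2))) : 'rV[R]_((p + q1) + q2) :=
    row_mx (row_mx (lsubmx w) (lsubmx (rsubmx w))) (rsubmx (rsubmx w)).
  pose G (w : 'rV[R]_((p + q1) + q2)) : 'rV[R]_(p + (q1 + q2)) :=
    row_mx (lsubmx (lsubmx w)) (row_mx (rsubmx (lsubmx w)) (rsubmx w)).
  have sid k (w : 'rV[R]_k) : smooth_at id w by exact: smooth_at_id.
  have dF : local_diffeo F G (f @` V).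
    apply: iso_local_diffeo; first exact: vf.1.
    - by move=> w; rewrite /F /G !(row_mxKl, row_mxKr) !hsubmxK.
    - by move=> w; rewrite /F /G !(row_mxKl, row_mxKr) !hsubmxK.
    - move=> w; have s1 := smooth_at_rsubmx _ _ _ _ _ (sid _ w).
      apply: smooth_at_row_mx; last exact: smooth_at_rsubmx s1.
      apply: smooth_at_row_mx; last exact: smooth_at_lsubmx s1.
      exact: smooth_at_lsubmx (sid _ _).
    - move=> w; have s1 := smooth_at_lsubmx _ _ _ _ _ (sid _ w).
      apply: smooth_at_row_mx; first exact: smooth_at_lsubmx s1.
      apply: smooth_at_row_mx; first exact: smooth_at_rsubmx s1.
      exact: smooth_at_rsubmx (sid _ _).
  have sl := @slice_intro _ _ AU USt (Chart V f g) _ _ F G (f @` V) gU (atlas_max gU AV).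
  exists q1; do 3 eexists; split; first apply: sl => //.
  - move=> y /= Vy _; have [_ _ Uy sy] := H y Vy; rewrite /F row_mxKr UStP.
    by split=> [[_ /sy]|/sy].
  - by split=> //; split=> //; exists x.
  move=> y /= [[Vy _] _]; have [cy fy _ _] := H y Vy; split=> //.
  by rewrite /F !row_mxKl.
split; last exact: key.
have [c Dc cx] := base_chart_at pD (tag x).
by have [q [V [f [g [AV Vx _]]]]] := key c Dc cx; exists (Chart V f g).
Qed.

Lemma U_manifold : smooth_manifold U AU.
Proof.
apply: (sub_manifold (M := setT)); first exact: mx_manifold.
by rewrite -/AU pts_U.
Qed.

Lemma matrix_part k (f : 'rV[R]_k -> Mat) v : plot_at MA f v ->
  mplot D Phi (fun w => tagged (f w)) v.
Proof.
move=> pf; apply/(mplotP hD hA); apply: plot_ext pf => w.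
by case: (f w).
Qed.

Lemma plot_AU k (f : 'rV[R]_k -> Mat) v : plot_at MA f v -> (\forall w \near v, U (f w)) ->
  plot_at AU f v.
Proof.
move=> pf nU; apply: plot_sub => //; rewrite -/AU pts_U.
exact: nbhs_singleton nU.
Qed.

Lemma mul_mk d (X Y : 'M[A d]_(n + 1)) : mul (mk X) (mk Y) = mk (X *m Y).
Proof. exact: fiberwise2E. Qed.

Lemma tag_mul x y : tag (mul x y) = tag x. Proof. by []. Qed.

Lemma U_mul x y : U x -> U y -> tag x = tag y -> U (mul x y).
Proof.
case: x y => [d X] [d' Y] Ux Uy /= E; subst d'.
rewrite -/(mk X) -/(mk Y) mul_mk; apply: unitary_mul Ux Uy.
  exact: (sigmaL hsigma).
exact: (sigmaM hsigma).
Qed.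

Lemma U_inv x : U x -> U (inv x).
Proof.
case: x => [d X] Ux; apply: unitary_inverse Ux.
- exact: (sigmaL hsigma).
- exact: (sigma1 hsigma).
- exact: (sigmaM hsigma).
Qed.

Lemma U_one d : U (one d).
Proof. by apply: unitary_one; [exact: (sigmaL hsigma)|exact: (sigma1 hsigma)]. Qed.

(** The product of two plots is a plot of the bundle of matrices, with values in
    the unitary groups. *)
Lemma plot_mul k (f1 f2 : 'rV[R]_k -> Mat) v : plot_at AU f1 v -> plot_at AU f2 v ->
  (\forall w \near v, tag (f1 w) = tag (f2 w)) ->
  plot_at AU (fun w => mul (f1 w) (f2 w)) v.
Proof.
move=> /(sub_plot gM) [p1 nU1] /(sub_plot gM) [p2 nU2] nt.
have m1 := matrix_part p1.
have m2 : mplot D Phi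
    (fun w => tagged_as (f1 w) (f2 w) : 'M[A (tag (f1 w))]_(n + 1)) v.
  apply/(mplotP hD hA); apply: plot_eq p2.
  by apply: filterS nt => w tw; rewrite existT_tagged_as.
apply: plot_AU.
  exact: ((mplotP hD hA _ _).1 (mplotM hD hA m1 m2)).
by apply: filterS (filterI nt (filterI nU1 nU2)) => w [tw [u1 u2]]; exact: U_mul.
Qed.

Lemma plot_inv k (f : 'rV[R]_k -> Mat) v : plot_at AU f v ->
  plot_at AU (fun w => inv (f w)) v.
Proof.
move=> /(sub_plot gM) [pf nU]; have mf := matrix_part pf.
apply: plot_AU; last by apply: filterS nU => w; exact: U_inv.
apply: ((mplotP hD hA _ _).1 (mplot_inverse hD hA mf _)).
by apply: filterS nU => w [].
Qed.

Lemma plot_one k (b : 'rV[R]_k -> Delta) v : plot_at D b v ->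
  plot_at AU (fun w => one (b w)) v.
Proof.
move=> pb; apply: plot_AU; first exact: ((mplotP hD hA _ _).1 (mplot1 hD hA pb)).
by apply: (@filterE _ (nbhs v)) => w; exact: U_one.
Qed.

Lemma fiber_group (S : set Mat) d : S `<=` U -> S (one d) ->
  (forall x y, S x -> S y -> tag x = tag y -> S (mul x y)) ->
  (forall x, S x -> S (inv x)) ->
  group_on (fiber tag S d) (one d) mul inv.
Proof.
move=> SU S1 Sm Si; split.
- split=> [|x y [Sx xd] [Sy yd]]; first by split.
  by split; [apply: Sm => //; rewrite xd yd|rewrite tag_mul].
- by move=> x [Sx xd]; split=> //; exact: Si.
- move=> [d1 X] [d2 Y] [d3 Z] [_ /= E1] [_ /= E2] [_ /= E3]; subst d1 d2 d3.
  by rewrite -/(mk X) -/(mk Y) -/(mk Z) !mul_mk mulmxA.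
- move=> [d1 X] [_ /= E1]; subst d1.
  by rewrite -/(mk X) -[one d]/(mk 1%:M) !mul_mk mul1mx mulmx1.
- move=> [d1 X] [/SU [iX _] /= E1]; subst d1.
  rewrite -/(mk X) -[one d]/(mk 1%:M) -[inv _]/(mk (inverse X)) !mul_mk.
  by rewrite inverse_mulmxl // inverse_mulmxr.
Qed.

Lemma U_group d : group_on (fiber tag U d) (one d) mul inv.
Proof. by apply: fiber_group => //; [exact: U_one|exact: U_mul|exact: U_inv]. Qed.

Lemma USt_group d : group_on (fiber tag USt d) (one d) mul inv.
Proof.
have sl := @last_signK R n.
apply: fiber_group.
- by move=> x /UStP [].
- apply/UStP; split; first exact: U_one.
  by apply: sign_conj_diag => //; exact: scalar_mx_is_diag.
- move=> [d1 X] [d2 Y] /UStP [Ux sx] /UStP [Uy sy] /= E; subst d2.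
  apply/UStP; split; first exact: U_mul.
  by rewrite -/(mk X) -/(mk Y) mul_mk /= sign_conjM //= sx sy.
- move=> [d1 X] /UStP [Ux sx]; apply/UStP; split; first exact: U_inv.
  by apply: sign_conj_inverse => //; have [] := Ux.
Qed.

(** The group laws of a fiber are restrictions of those of the family, and plots
    of the fiber are plots of the family. *)
Lemma fiber_lie_group d :
  lie_group (fiber tag U d) (sub_atlas AU (fiber tag U d)) (one d) mul inv.
Proof.
have pf := adapted_fiber gD pD gU adapted_U (d := d) pts_U.
have ptsf : pts (sub_atlas AU (fiber tag U d)) = fiber tag U d.
  by apply/seteqP; split=> //; exact: pts_sub_atlas.
have gF : compatible_atlas (sub_atlas AU (fiber tag U d)) by exact: sub_compatible.
have [[_ Fm] Fi _ _ _] := U_group d.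
split; [exact: sub_manifold U_manifold pf|exact: U_group| |].
- apply: smooth_map_intro; first exact: prod_compatible.
    move=> [x y] [/pf [c1 A1 c1x] /pf [c2 A2 c2y]].
    by exists (prod_chart c1 c2); [exists c1, c2|split].
  move=> k f v pp _.
  have [q1 n1] := sub_plot gU (plot_fst pp); have [q2 n2] := sub_plot gU (plot_snd pp).
  have nS : \forall w \near v, fiber tag U d (mul (f w).1 (f w).2).
    by apply: filterS (filterI n1 n2) => w [F1 F2]; exact: Fm.
  apply: plot_sub => //; last by apply: pf; exact: nbhs_singleton nS.
  apply: plot_mul => //.
  by apply: filterS (filterI n1 n2) => w [[_ ->] [_ ->]].
- apply: smooth_map_intro => // k f v pp _.
  have [q1 n1] := sub_plot gU pp.
  have nS : \forall w \near v, fiber tag U d (inv (f w)).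
    by apply: filterS n1 => w F1; exact: Fi.
  apply: plot_sub => //; last by apply: pf; exact: nbhs_singleton nS.
  exact: plot_inv.
Qed.

Lemma U_family_of_groups : family_of_groups D tag U AU one mul inv.
Proof.
have UA : U `<=` pts AU by rewrite pts_U.
split.
- split; first exact: U_manifold.
  by apply: (adapted_submersion pD gU) => //; exact: adapted_U.
- apply: smooth_map_intro => // k f v pf _; exact: plot_one.
- have gP : compatible_atlas (prod_atlas AU AU) by exact: prod_compatible.
  apply: smooth_map_intro.
  + exact: sub_compatible.
  + exact: (adapted_square gD pD gU adapted_U pts_U).
  move=> k f v pp _; have [q nq] := sub_plot gP pp.
  apply: plot_mul; [exact: plot_fst q|exact: plot_snd q|].
  by apply: filterS nq => w [].
- by apply: smooth_map_intro => // k f v pf _; exact: plot_inv.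
- by move=> d _; exact: fiber_lie_group.
Qed.

Lemma eplot_neq0 k (b : 'rV[R]_k -> Delta) (a : forall w, A (b w)) v :
  eplot D Phi a v -> a v != 0 -> \forall w \near v, a w != 0.
Proof.
move=> pa av; have pb := eplot_base pa; have [t Pt tv] := algebra_triv_cover hA (b v).
have nt := tdom_near hD (algebra_triv hA) Pt pb tv.
have t0 d : tdom t d -> tfun t d 0 = 0.
  move=> td; have := tfun_linear hA Pt td 1 0 0.
  by rewrite !scale1r addr0 -{1}[tfun t d 0]addr0 => /addrI.
have : tfun t (b v) (a v) != 0.
  apply: contraNneq av => tav; have [K _] := (algebra_triv hA Pt).2 _ tv.
  by rewrite -(K (a v)) tav -(t0 _ tv) K.
move=> /rV0Pn [j tj].
have sa := smooth_at_coord _ _ _ 0 j _ (eplot_coord hD hA Pt tv pa).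
have nj := smooth_at_near_set _ _ _ _ sa (@open_neq _ 0) tj.
apply: filterS (filterI nt nj) => w [tw fw]; apply/eqP => aw0.
by move/eqP: (fw : tfun t (b w) (a w) 0 j != 0); apply; rewrite aw0 t0 // mxE.
Qed.

(** A unitary matrix outside the stabilizer has a nonzero off-diagonal block entry,
    which stays nonzero along plots. *)
Lemma USt_closed : atlas_open AU (pts AU `\` USt).
Proof.
apply: plot_open => //.
move=> k f v pf [Uv nS]; have [pM nU] := sub_plot gM pf.
have [pb mf] := matrix_part pM; rewrite pts_U in Uv *.
have : exists i j, last_sign i * last_sign j = -1 :> R /\ tagged (f v) i j != 0.
  apply: contrapT => H; apply: nS; apply/UStP; split=> //.
  have {}H i j : last_sign i * last_sign j = -1 :> R -> tagged (f v) i j = 0.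
    by move=> sij; apply/eqP; apply: contrapT => /negP H0; apply: H; exists i, j.
  apply/sign_conj_last; split; apply/matrixP => i j; rewrite !mxE; apply: H;
    by rewrite last_signl last_signr ?mul1r ?mulr1.
move=> [i [j [sij fij]]]; have nij := eplot_neq0 (mf i j) fij.
apply: filterS (filterI nU nij) => w [Uw fw]; split=> // /UStP [_ sw].
move/eqP: fw; apply; apply: (@opp_fixed_eq0 R).
by have := congr1 (fun Z : 'M[A (tag (f w))]_(n + 1) => Z i j) sw; rewrite mxE sij.
Qed.

Lemma unitary_geometries :
  family_of_geometries D tag U AU one mul inv USt.
Proof.
have gC : compatible_atlas (sub_atlas AU USt) by exact: sub_compatible.
have ptsC : USt `<=` pts (sub_atlas AU USt) by move=> x /adapted_USt [].
split.
- exact: U_family_of_groups.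
- by move=> x /UStP [].
- split.
    split; last exact: USt_closed.
    by split=> //; rewrite pts_U => x /UStP [].
  apply: (adapted_submersion pD gC _ ptsC) => x px.
  exact: (adapted_USt (pts_sub_atlas px)).2.
- by move=> d _; exact: USt_group.
Qed.

End UnitaryFamily.

Unset Implicit Arguments.

Theorem mainTheorem20 (R : realType) (Delta : choiceType) (D : atlas R Delta)
    (hD : smooth_manifold [set: Delta] D)
    (A : Delta -> algType R) (Phi : set (trivialization R (fun d => A d)))
    (hA : smooth_family_of_algebras D Phi)
    (sigma : forall d, A d -> A d) (hsigma : smooth_involution D Phi sigma)
    (n : nat) (J : forall d, 'M[A d]_(n + 1))
    (hJsmooth : smooth_map [set: Delta] D (mx_atlas D Phi (n + 1)) (section J))
    (hJherm : forall d, Herm (sigma d) (J d))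
    (hJnondeg : forall d, invertible (J d))
    (hJdiag : forall d, is_diag_mx (J d)) :
  let Mat := {d : Delta & 'M[A d]_(n + 1)} in
  let U : set Mat := [set u | unitary (sigma (tag u)) (J (tag u)) (tagged u)] in
  let USt : set Mat :=
    [set u | unitary_stabilizer (sigma (tag u)) (J (tag u)) (tagged u)] in
  family_of_geometries D tag
    U (sub_atlas (mx_atlas D Phi (n + 1)) U)
    (section (fun d => 1%:M : 'M[A d]_(n + 1)))
    (fiberwise2 (fun d (X Y : 'M[A d]_(n + 1)) => X *m Y))
    (fiberwise1 (fun d (X : 'M[A d]_(n + 1)) => inverse X))
    USt.
Proof. exact: unitary_geometries. Qed.
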